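(* Let $H$, $A$, $V=D(A^{1/2})$, $\mathcal{H}=V\times H\times V\times H$ and the constants $a,b,\gamma>0$ be as in the context, and for $\theta\in[-1,1]$ let $\mathcal{A}_\theta$ be the operator on $\mathcal{H}$ defined in the context by $$\mathcal{A}_\theta(u,v,w,z)=\big(v,\,-aAu-\gamma A^\theta(v+z),\,z,\,-bAw-\gamma A^\theta(v+z)\big),$$ with $(S_\theta(t))_{t\ge0}$ the $C_0$-semigroup of contractions it generates on $\mathcal{H}$. Assume $a\neq b$. (i) For every $\theta\in(1/2,1]$, the semigroup $(S_\theta(t))_{t\ge0}$ is not analytic. In particular, for every $\theta\in(1/2,1]$ and every $r\in(2(1-\theta),1]$, $$\limsup_{|\lambda|\to\infty,\ \lambda\in\mathbb{R}}|\lambda|^{r}\,\big\|(i\lambda I-\mathcal{A}_\theta)^{-1}\big\|_{\mathcal{L}(\mathcal{H})}=\infty .$$ (ii) For every $\theta\in(0,1)$, the semigroup $(S_\theta(t))_{t\ge0}$ is differentiable; namely, there exist a positive constant $C$ and a large enough $\lambda_0>0$ such that $$\log(|\lambda|)\,\big\|(i\lambda I-\mathcal{A}_\theta)^{-1}\big\|_{\mathcal{L}(\mathcal{H})}\le C\qquad\text{for all }\lambda\in\mathbb{R}\text{ with }|\lambda|\ge\lambda_0 .$$ The differentiability of the semigroup is valid for all $t>3K_0$, where $$K_0:=\limsup_{|\lambda|\to\infty,\ \lambda\in\mathbb{R}}\Big[\log(|\lambda|)\,\big\|(i\lambda I-\mathcal{A}_\theta)^{-1}\big\|_{\mathcal{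L}(\mathcal{H})}\Big].$$
   Context: $H$ is a complex Hilbert space with inner product $(\cdot,\cdot)$ and norm $|\cdot|$. $A$ is a positive unbounded self-adjoint operator on $H$ with domain $D(A)$ dense in $H$, and $V=D(A^{1/2})$. It is assumed that $V\hookrightarrow H\hookrightarrow V'$, each injection being dense and compact, where $V'$ is the topological dual of $V$, and that there exists $a_0>0$ such that $|u|\le a_0|A^{1/2}u|$ for all $u\in V$. The numbers $a,b,\gamma$ are positive constants, and $\theta\in[-1,1]$. The space $\mathcal{H}=V\times H\times V\times H$, over $\mathbb{C}$, is a Hilbert space with the norm $$\|Z\|^2=a|A^{1/2}u|^2+|v|^2+b|A^{1/2}w|^2+|z|^2,\qquad Z=(u,v,w,z)\in\mathcal{H}.$$ The operator $\mathcal{A}_\theta$ is defined by $\mathcal{A}_\theta(u,v,w,z)=(v,\,-(aAu+\gamma A^\theta(v+z)),\,z,\,-(bAw+\gamma A^\theta(v+z)))$ on the domain $$D(\mathcal{A}_\theta)=\{(u,v,w,z)\in V^4:\ aAu+\gamma A^\theta(v+z)\in H\ \text{and}\ bAw+\gamma A^\theta(v+z)\in H\},$$ where the sums are understood in $V'$ (with $A$ extended to a bounded operator $V\to V'$). It is the generator associated with the system $y_{tt}+aAy+\gamma A^\theta(y_t+z_t)=0$, $z_{tt}+bAz+\gamma A^\theta(y_t+z_t)=0$. It generates a $C_0$-semigroup of contractions $(S_\theta(t))_{t\ge0}$ on $\mathcal{H}$, and, when $a\ne b$, $i\mathbb{R}\subset\rho(\mathcal{A}_\theta)$, the resolvent set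 of $\mathcal{A}_\theta$. A $C_0$-semigroup $(T(t))_{t\ge0}$ on a Hilbert space $X$ is called differentiable for $t>t_0$ if for every $x\in X$ the map $t\mapsto T(t)x$ is differentiable for $t>t_0$. *)

(* Defs.v *)
From HB Require Import structures.
From mathcomp Require Import all_boot all_order all_algebra.
From mathcomp Require Import all_classical all_reals all_analysis.
From mathcomp Require Import complex.

Set Implicit Arguments.
Unset Strict Implicit.
Unset Printing Implicit Defensive.

Import Order.TTheory GRing.Theory Num.Theory.
Import numFieldNormedType.Exports.

Local Open Scope classical_set_scope.
Local Open Scope ring_scope.
Local Open Scope complex_scope.

(* Several spaces below (D(A^{1/2}), its dual, the energy space) are not types
   of their own. They are a subset of a complex vector space, together with a
   norm that is only meaningful on that subset. *)
Record normed_space (R : realType) := NormedSpace {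
  ambient : lmodType R[i];
  carrier : set ambient;
  nrm : ambient -> R }.

Record operator (R : realType) (E : lmodType R[i]) := Operator {
  dom : set E;
  op_fun :> E -> E }.

Section NormedSpaceTheory.
Variables (R : realType) (X Y : normed_space R).
Local Notation E := (ambient X).
Implicit Types (f : E -> E) (T : operator E) (S : R -> E -> E).

Definition bounded_linear f :=
  [/\ forall x, carrier x -> carrier (f x),
      forall (c : R[i]) x y, carrier x -> carrier y ->
        f (c *: x + y) = c *: f x + f y
    & exists M : R, forall x, carrier x -> nrm (f x) <= M * nrm x].

Definition opnorm f : \bar R :=
  ereal_sup [set (nrm (f x))%:E | x in [set x | carrier x /\ nrm x <= 1]].

Definition dense_embedding (j : E -> ambient Y) :=
  forall y, carrier y -> forall e : R, 0 < e ->
    exists2 x, carrier x & nrm (j x - y) < e.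

(* Every bounded sequence has a subsequence whose image converges. *)
Definition compact_embedding (j : E -> ambient Y) :=
  forall u : nat -> E, (forall n, carrier (u n)) ->
    (exists M : R, forall n, nrm (u n) <= M) ->
    exists k : nat -> nat, {homo k : m n / (m < n)%N} /\
      exists2 l, carrier l &
        (fun n => nrm (j (u (k n)) - l)) @ \oo --> (0 : R).

Definition resolvent T (l : R[i]) (x : E) : E :=
  xget 0 [set y | dom T y /\ l *: y - T y = x].

Definition resolvent_set T : set R[i] := [set l |
  (forall x, carrier x -> exists! y, dom T y /\ l *: y - T y = x) /\
  exists M : R, forall y, dom T y -> nrm y <= M * nrm (l *: y - T y)].

Definition C0_semigroup S :=
  [/\ forall t, 0 <= t -> bounded_linear (S t),
      forall x, carrier x -> S 0 x = x,
      forall s t x, 0 <= s -> 0 <= t -> carrier x ->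
        S (s + t) x = S s (S t x)
    & forall x, carrier x -> nrm (S t x - x) @[t --> 0^'+] --> (0 : R)].

Definition contractive S :=
  forall t x, 0 <= t -> carrier x -> nrm (S t x) <= nrm x.

Definition generator S T := forall x y, carrier x -> carrier y ->
  (dom T x /\ T x = y) <->
  nrm ((t^-1)%:C *: (S t x - x) - y) @[t --> 0^'+] --> (0 : R).

Definition differentiable_for S (t0 : \bar R) :=
  forall (x : E) (t : R), carrier x -> (t0 < t%:E)%E ->
    exists2 y, carrier y &
      nrm ((h^-1)%:C *: (S (t + h) x - S t x) - y) @[h --> 0^'] --> (0 : R).

Definition sector (d : R) : set R[i] := [set z |
  exists r w : R, [/\ 0 < r, `|w| < d & z = (r * cos w) +i* (r * sin w)]].

(* Holomorphy of z |-> T z is in operator norm. *)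
Definition analytic_semigroup S :=
  exists d : R, 0 < d <= pi / 2 /\ exists T : R[i] -> E -> E,
  [/\ forall z, sector d z -> bounded_linear (T z),
      forall t x, 0 <= t -> carrier x -> T t%:C x = S t x,
      forall z1 z2 x, (sector d `|` [set 0]) z1 -> (sector d `|` [set 0]) z2 ->
        carrier x -> T (z1 + z2) x = T z1 (T z2 x),
      forall x, carrier x ->
        nrm (T z x - x) @[z --> within (sector d) (nbhs (0 : (R[i])^o))]
          --> (0 : R)
    & forall z, sector d z -> exists2 D : E -> E, bounded_linear D &
        opnorm (fun x => h^-1 *: (T (z + h) x - T z x) - D x)
          @[h --> (0 : (R[i])^o)^'] --> (0 : \bar R)].

End NormedSpaceTheory.

(* |lambda| -> oo, with lambda real *)
Definition abs_pinfty (R : realType) : set_system R :=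
  [set P | exists M : R, forall l, M < `|l| -> P l].

Definition resolvent_norm (R : realType) (X : normed_space R)
    (T : operator (ambient X)) (l : R) : \bar R :=
  opnorm (resolvent T ('i * l%:C)).

Section HilbertSpace.
Variables (R : realType) (H : completeNormedModType R[i]).
Variable dot : {dot H for Num.conj}.
Implicit Types (A : operator H) (s : R).

(* The norm of a normed module over R[i] takes values in R[i]. *)
Definition hnorm (x : H) : R := complex.Re `|x|.

Definition linear_operator A := dom A 0 /\
  forall (c : R[i]) x y, dom A x -> dom A y ->
    dom A (c *: x + y) /\ A (c *: x + y) = c *: A x + A y.

Definition self_adjoint A :=
  [/\ linear_operator A, closure (dom A) = setT
    & forall x y, (forall w, dom A w -> dot (A w) x = dot w y) <->
                  (dom A x /\ A x = y)].

Definition positive_operator A := forall x, dom A x -> 0 <= dot (A x) x.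

Definition unbounded A :=
  ~ exists M : R, forall x, dom A x -> hnorm (A x) <= M * hnorm x.

(* A projection-valued measure on the Borel sets of R; [smeas x] is the
   scalar measure B |-> (proj B x, x) = |proj B x|^2. *)
Record spectral_measure := SpectralMeasure {
  proj : set R -> H -> H;
  smeas : H -> {measure set (measurableTypeR R) -> \bar R};
  proj_linear : forall (B : set (measurableTypeR R)) (c : R[i]) x y,
    measurable B -> proj B (c *: x + y) = c *: proj B x + proj B y;
  proj_sym : forall (B : set (measurableTypeR R)) x y,
    measurable B -> dot (proj B x) y = dot x (proj B y);
  projI : forall (B C : set (measurableTypeR R)) x,
    measurable B -> measurable C -> proj (B `&` C) x = proj B (proj C x);
  projT : forall x, proj setT x = x;
  smeasE : forall (B : set (measurableTypeR R)) x,
    measurable B -> smeas x B = (hnorm (proj B x) ^+ 2)%:E }.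

Section SpectralIntegral.
Variables (E : spectral_measure) (f : R -> R).

Definition spectral_dom : set H :=
  [set x | (\int[smeas E x]_l ((f l) ^+ 2)%:E < +oo)%E].

(* The integral of f against the complex measure B |-> (proj B x, w), obtained
   from the measures [smeas] by polarization. *)
Definition spectral_form (x w : H) : R[i] :=
  4^-1 * \sum_(k < 4)
    'i ^+ k * (\int[smeas E (x + 'i ^+ k *: w)]_l f l)%:C.

Definition spectral_integral : operator H :=
  Operator spectral_dom (fun x =>
    xget 0 [set y | forall w, spectral_dom w -> dot y w = spectral_form x w]).

End SpectralIntegral.

Definition spectral_measure_of A (E : spectral_measure) :=
  let B := spectral_integral E id in
  dom A = dom B /\ forall x, dom A x -> A x = B x.

(* A^s for a positive self-adjoint A, by the Borel functional calculus; the
   spectral measure of a self-adjoint operator exists and is unique. The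
   operator with empty domain is returned when A has none. *)
Definition oppow A s : operator H :=
  if pselect (exists E, spectral_measure_of A E) is left AE
  then spectral_integral (projT1 (cid AE)) (fun l => l `^ s)
  else Operator set0 (fun=> 0).

Definition Hspace : normed_space R := @NormedSpace R H setT hnorm.

(* V = D(A^{1/2}) *)
Definition Vspace A : normed_space R :=
  @NormedSpace R H (dom (oppow A 2^-1)) (fun u => hnorm (oppow A 2^-1 u)).

Section Dual.
Variable A : operator H.
Let V : set H := @carrier R (Vspace A).
Let normV : H -> R := @nrm R (Vspace A).

(* V' consists of the bounded antilinear functionals on V, so that
   h |-> (h, .) is a linear embedding of H into V'. Functionals are functions
   on H of which only the values on V matter. *)
Definition V'space : normed_space R :=
  @NormedSpace R (H -> R[i])
    [set F | (forall (c : R[i]) x y, V x -> V y ->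
                F (c *: x + y) = Num.conj c * F x + F y) /\
             exists M : R, forall x, V x -> complex.Re `|F x| <= M * normV x]
    (fun F => sup [set complex.Re `|F x| | x in [set x | V x /\ normV x <= 1]]).

Definition toV' (h : H) : H -> R[i] := fun phi => dot h phi.

(* A^s u as an element of V', for u in V and s <= 1:
   <A^s u, phi> = (A^{s/2} u, A^{s/2} phi). *)
Definition oppowV' (s : R) (u : H) : H -> R[i] :=
  fun phi => dot (oppow A (s / 2) u) (oppow A (s / 2) phi).

Definition represents (F : H -> R[i]) (h : H) :=
  forall phi, V phi -> F phi = toV' h phi.

Definition inH (F : H -> R[i]) := exists h, represents F h.

Definition ofV' (F : H -> R[i]) : H := xget 0 [set h | represents F h].

Variables a b gamma : R.

Definition energy_space : normed_space R :=
  @NormedSpace R (H * H * H * H)%type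
    [set Z | let: (u, v, w, z) := Z in V u /\ V w]
    (fun Z => let: (u, v, w, z) := Z in
       Num.sqrt (a * hnorm (oppow A 2^-1 u) ^+ 2 + hnorm v ^+ 2
               + b * hnorm (oppow A 2^-1 w) ^+ 2 + hnorm z ^+ 2)).

(* k A u + gamma A^theta x in V' *)
Definition force (theta k : R) (u x : H) : H -> R[i] :=
  k%:C *: oppowV' 1 u + gamma%:C *: oppowV' theta x.

Definition system_operator (theta : R) : operator (ambient energy_space) :=
  @Operator R (H * H * H * H)%type
    [set Z | let: (u, v, w, z) := Z in
       [/\ V u, V v, V w & V z] /\
       inH (force theta a u (v + z)) /\ inH (force theta b w (v + z))]
    (fun Z => let: (u, v, w, z) := Z in
       (v, - ofV' (force theta a u (v + z)),
        z, - ofV' (force theta b w (v + z)))).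

End Dual.
End HilbertSpace.

(* Main.v *)
(* Compactness of V in H forces the spectral measure of A to be purely atomic,
   with countably many eigenspaces P_n H and eigenvalues mu_n. On P_n H the
   system is a 4 x 4 block with g = sqrt mu_n and d = gamma mu_n^theta. As
   a <> b, the damping of v + z is transmitted to all four components: a
   perturbed energy decays at rate r_n = c g min(1, g/d, d/g), so that the block
   resolvent is at most C / r_n on the imaginary axis and the block semigroup
   decays like exp(- c' r_n t). For theta in (0, 1), r_n grows like a power of
   mu_n; hence the resolvent decays like a power of 1/|lambda|, which beats the
   logarithm, and S(t) maps into the domain of the generator for every t > 0.

   For theta > 1/2 the characteristic equation
     g (s^2 + a) (s^2 + b) + d s (2 s^2 + a + b) = 0
   has a root within O(g/d) of i sqrt((a + b)/2). Thus the generator has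
   eigenvalues l with Im l -> oo and |Re l| = O((Im l)^(2(1 - theta))), which
   makes |lambda|^r |resolvent| unbounded for r > 2(1 - theta). An analytic
   extension T would multiply the eigenvectors by exp(l z), and with z = 1 - i t
   this is unbounded in l although T(z) is a bounded operator. *)
Require Import Defs.
From HB Require Import structures.
From mathcomp Require Import all_boot all_order all_algebra.
From mathcomp Require Import all_classical all_reals all_analysis.
From mathcomp Require Import measurable_realfun complex.
From mathcomp Require Import ring lra.

Set Implicit Arguments.
Unset Strict Implicit.
Unset Printing Implicit Defensive.

Import Order.TTheory GRing.Theory Num.Theory.
Import numFieldNormedType.Exports.

Local Open Scope classical_set_scope.
Local Open Scope ring_scope.
Local Open Scope complex_scope.


(** * Inner product *)

(** The semigroup is known only through its axioms, so its action on an eigenspace is not given by a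
    formula. What is available is the graph of its generator, which [graphP] describes coordinate by
    coordinate. Energies of single coordinates are differentiated along orbits, and Gronwall's
    inequality replaces matrix exponentials: from above for smoothing, from below for eigenvectors.
    All block estimates are explicit in mu_n.

    The decay of the resolvent comes from two regimes: if |lambda| is large against mu_n, the block
    is a small perturbation of i lambda; otherwise mu_n is at least of order |lambda|, so that 1 /
    r_n is small.

    As smoothing holds for every t > 0, the threshold 3 K_0 enters only through K_0 >= 0.

    Against analyticity: a short vertical segment through 1 lies in every sector. Along 1 - i t an
    eigenvector with eigenvalue l is stretched by exp(t Im l), which dominates exp(Re l) because Re
    l = o(Im l) when theta > 1/2. *)

Section RealInner.
Variables (R : realType) (H : completeNormedModType R[i]).
Variable dot : {dot H for Num.conj}.
Hypothesis dotE : forall x : H, `|x| ^+ 2 = dot x x.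
Implicit Types (x y z : H) (c : R[i]) (r t : R).

(** The energy estimates use the real part of the inner product, which makes them real inequalities
    within reach of [lra] and [nra]; [dot_rdot] recovers the imaginary part by testing against
    ['i *: y]. *)
Definition rdot x y : R := complex.Re (dot x y).
Local Notation "<[ x , y ]>" := (rdot x y).

(** Multiplied by a nonzero [c], both conjugates give the square of its modulus, so [c] cancels. *)
Lemma conj_conjc (c : R[i]) : Num.conj c = conjc c.
Proof.
have [->|c0] := eqVneq c 0; first by rewrite rmorph0 conjc0.
by apply: (mulfI c0); exact: etrans (esym (normCK c)) (sqr_normc c).
Qed.

Lemma dotC x y : dot x y = conjc (dot y x).
Proof. by rewrite -[RHS]conj_conjc [LHS]hermC expr0 mul1r. Qed.

Lemma dotDl x y z : dot (x + y) z = dot x z + dot y z.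
Proof. exact: linearDl. Qed.

Lemma dotZl c x z : dot (c *: x) z = c * dot x z.
Proof. exact: linearZl_LR. Qed.

Lemma dotZr c x z : dot x (c *: z) = conjc c * dot x z.
Proof. by rewrite dotC dotZl rmorphM /= -dotC. Qed.

Lemma rdotC x y : <[x, y]> = <[y, x]>.
Proof. by rewrite /rdot dotC; case: (dot y x). Qed.

Lemma rdotDl x y z : <[x + y, z]> = <[x, z]> + <[y, z]>.
Proof. by rewrite /rdot dotDl raddfD. Qed.

Lemma rdotZl r x z : <[r%:C *: x, z]> = r * <[x, z]>.
Proof. by rewrite /rdot dotZl; case: (dot x z) => a b /=; rewrite mul0r subr0. Qed.

Lemma rdotNl x z : <[- x, z]> = - <[x, z]>.
Proof. by rewrite -scaleN1r -(rmorph1 (real_complex R)) -rmorphN rdotZl mulN1r. Qed.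

Lemma rdotDr x y z : <[x, y + z]> = <[x, y]> + <[x, z]>.
Proof. by rewrite rdotC rdotDl !(rdotC _ x). Qed.

Lemma rdotNr x z : <[x, - z]> = - <[x, z]>.
Proof. by rewrite rdotC rdotNl rdotC. Qed.

Lemma rdotZr r x z : <[x, r%:C *: z]> = r * <[x, z]>.
Proof. by rewrite rdotC rdotZl rdotC. Qed.

Lemma rdot0l x : <[0, x]> = 0.
Proof. by rewrite -(scale0r (0 : H)) -(rmorph0 (real_complex R)) rdotZl mul0r. Qed.

Lemma rdot0r x : <[x, 0]> = 0.
Proof. by rewrite rdotC rdot0l. Qed.

Lemma rdot_suml I (s : seq I) (P : pred I) (F : I -> H) x :
  <[\sum_(i <- s | P i) F i, x]> = \sum_(i <- s | P i) <[F i, x]>.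
Proof.
by elim/big_rec2: _ => [|i a b _ <-]; rewrite ?rdot0l// rdotDl.
Qed.

Lemma rdot_sumr I (s : seq I) (P : pred I) (F : I -> H) x :
  <[x, \sum_(i <- s | P i) F i]> = \sum_(i <- s | P i) <[x, F i]>.
Proof. by rewrite rdotC rdot_suml; apply: eq_bigr => i _; rewrite rdotC. Qed.

Lemma dot_rdot x y : dot x y = <[x, y]> +i* <[x, 'i *: y]>.
Proof.
rewrite /rdot dotZr /=.
by case: (dot x y) => a b /=; rewrite mul0r mulN1r opprK add0r.
Qed.

Lemma rdotil x y : <['i *: x, y]> = - <[x, 'i *: y]>.
Proof.
rewrite /rdot dotZl dotZr /=.
by case: (dot x y) => a b /=; rewrite !mul0r mul1r mulN1r !sub0r opprK.
Qed.

Lemma rdotii x y : <['i *: x, 'i *: y]> = <[x, y]>.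
Proof.
by rewrite rdotil scalerA -expr2 sqr_i scaleN1r rdotNr opprK.
Qed.

Lemma rdot_i0 x : <[x, 'i *: x]> = 0.
Proof. by have := rdotil x x; rewrite rdotC => h; lra. Qed.

Lemma rdotZc c x y :
  <[c *: x, y]> = complex.Re c * <[x, y]> - complex.Im c * <[x, 'i *: y]>.
Proof.
have -> : c *: x = (complex.Re c)%:C *: x + (complex.Im c)%:C *: ('i *: x).
  by rewrite scalerA -scalerDl [(complex.Im c)%:C * _]mulrC -complexE.
by rewrite rdotDl !rdotZl rdotil mulrN.
Qed.

Lemma hnormC x : `|x| = (hnorm x)%:C.
Proof. by rewrite /hnorm RRe_real// normr_real. Qed.

Lemma hnorm_sqr x : hnorm x ^+ 2 = <[x, x]>.
Proof.
by apply: complexI; rewrite rmorphXn /= -hnormC dotE dot_rdot rdot_i0.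
Qed.

Lemma hnorm_ge0 x : 0 <= hnorm x.
Proof. by rewrite -lecR -hnormC normr_ge0. Qed.

Lemma hnorm0 : hnorm (0 : H) = 0.
Proof. by apply: complexI; rewrite -hnormC normr0. Qed.

Lemma hnorm_eq0 x : (hnorm x == 0) = (x == 0).
Proof. by rewrite -[RHS]normr_eq0 hnormC eq_complex /= eqxx andbT. Qed.

Lemma hnormN x : hnorm (- x) = hnorm x.
Proof. by rewrite /hnorm normrN. Qed.

Lemma hnormB x y : hnorm (x - y) = hnorm (y - x).
Proof. by rewrite -hnormN opprB. Qed.

Lemma hnormD x y : hnorm (x + y) <= hnorm x + hnorm y.
Proof. by rewrite -lecR rmorphD /= -!hnormC ler_normD. Qed.

Lemma rdot_ge0 x : 0 <= <[x, x]>.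
Proof. by rewrite -hnorm_sqr exprn_ge0// hnorm_ge0. Qed.

Lemma rdot_eq0 x : (<[x, x]> == 0) = (x == 0).
Proof. by rewrite -hnorm_sqr sqrf_eq0 hnorm_eq0. Qed.

Lemma hnormZr r x : hnorm (r%:C *: x) = `|r| * hnorm x.
Proof.
apply: complexI; rewrite -hnormC normrZ hnormC rmorphM /=; congr (_ * _).
by rewrite normc_def /= expr0n addr0 sqrtr_sqr.
Qed.

Lemma hnormi x : hnorm ('i *: x) = hnorm x.
Proof.
by apply/eqP; rewrite -(@eqrXn2 _ 2)// ?hnorm_ge0// !hnorm_sqr rdotii.
Qed.

(** Young's inequality with a free weight, from the nonnegativity of |t x + y|^2 and |t x - y|^2.
    The weight is tuned in [rdot_CS] and in each cross term of [lyapunov_weights]. *)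
Lemma rdot_le t x y : 0 < t ->
  `|<[x, y]>| <= (t * <[x, x]> + t^-1 * <[y, y]>) / 2.
Proof.
move=> t0.
have := rdot_ge0 (t%:C *: x + y); have := rdot_ge0 (t%:C *: x - y).
rewrite !(rdotDl, rdotDr, rdotNl, rdotNr, rdotZl, rdotZr) (rdotC y x) => h1 h2.
have tV : t * t^-1 = 1 by rewrite mulfV// gt_eqF.
have t'0 : 0 < t^-1 by rewrite invr_gt0.
have E : t * t^-1 * <[x, y]> = <[x, y]> by rewrite tV mul1r.
have E1 : t * t^-1 * t * <[x, x]> = t * <[x, x]> by rewrite tV mul1r.
rewrite ler_norml; apply/andP; split; nra.
Qed.

Lemma rdot_CS x y : `|<[x, y]>| <= hnorm x * hnorm y.
Proof.
have [->|x0] := eqVneq x 0; first by rewrite rdot0l normr0 mulr_ge0// hnorm_ge0.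
have [->|y0] := eqVneq y 0; first by rewrite rdot0r normr0 mulr_ge0// hnorm_ge0.
have hx : 0 < hnorm x by rewrite lt_def hnorm_ge0 hnorm_eq0 x0.
have hy : 0 < hnorm y by rewrite lt_def hnorm_ge0 hnorm_eq0 y0.
(* This weight makes the two halves of Young's bound equal. *)
have t0 : 0 < hnorm y / hnorm x by rewrite divr_gt0.
apply: (le_trans (rdot_le x y t0)); rewrite -!hnorm_sqr le_eqVlt; apply/orP; left.
by apply/eqP; field; rewrite !gt_eqF.
Qed.

Lemma rdot_ext x y : (forall z, <[x, z]> = <[y, z]>) -> x = y.
Proof.
move=> h; apply/eqP; rewrite -subr_eq0 -rdot_eq0.
by rewrite rdotDl rdotNl h subrr.
Qed.

(** Positive elements of [R[i]] are real, so the radii of balls in [H] are real numbers. *)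
Lemma gtc0_real (e : R[i]) : 0 < e -> exists2 r : R, 0 < r & e = r%:C.
Proof.
by case: e => r i; rewrite ltcE /= => /andP[/eqP -> r0]; exists r.
Qed.

Lemma hnorm_complete (u : nat -> H) :
  (forall e : R, 0 < e -> exists N, forall n, (N <= n)%N ->
     hnorm (u N - u n) < e) ->
  exists x, hnorm (u n - x) @[n --> \oo] --> (0 : R).
Proof.
move=> uC.
have /cauchy_cvgP /cvg_ex[x ux] : cauchy (u @ \oo).
  apply: cauchy_exP => _ /gtc0_real[e e0 ->].
  have [N uN] := uC e e0; exists (u N); exists N => // n /= Nn.
  by rewrite -ball_normE /= hnormC ltcR uN.
exists x; apply/cvgr0Pnorm_lt => e e0.
have e0C : 0 < e%:C :> R[i] by rewrite ltcR.
have := cvgr_dist_lt _ _ ux _ e0C.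
move=> /(_ _); apply: filterS => n /=; rewrite hnormC ltcR hnormB.
by rewrite ger0_norm// hnorm_ge0.
Qed.

Lemma rdot_cvg (u : nat -> H) x y : hnorm (u n - x) @[n --> \oo] --> (0 : R) ->
  <[u n, y]> @[n --> \oo] --> <[x, y]>.
Proof.
move=> ux; apply/subr_cvg0/norm_cvg0P.
have h : hnorm (u n - x) * hnorm y @[n --> \oo] --> (0 : R).
  by rewrite -[X in _ --> X](mul0r (hnorm y)); apply: cvgMl.
apply: (squeeze_cvgr _ (cvg_cst 0) h); near=> n.
rewrite normr_ge0 /=; apply: le_trans (rdot_CS _ _).
by rewrite rdotDl rdotNl.
Unshelve. all: by end_near. Qed.

Lemma hnorm_cvg (u : nat -> H) x : hnorm (u n - x) @[n --> \oo] --> (0 : R) ->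
  hnorm (u n) @[n --> \oo] --> hnorm x.
Proof.
move=> ux; apply/subr_cvg0/norm_cvg0P.
apply: (squeeze_cvgr _ (cvg_cst 0) ux); near=> n.
rewrite normr_ge0 /= ler_norml; apply/andP; split.
  have := hnormD (u n) (x - u n); rewrite addrC subrK hnormB; lra.
have := hnormD x (u n - x); rewrite addrC subrK; lra.
Unshelve. all: by end_near. Qed.

End RealInner.

(** * Spectral decomposition *)

Section SpectralMeasure.
Variables (R : realType) (H : completeNormedModType R[i]).
Variable dot : {dot H for Num.conj}.
Hypothesis dotE : forall x : H, `|x| ^+ 2 = dot x x.
Variable E : spectral_measure dot.
Local Notation "<[ x , y ]>" := (rdot dot x y).
Local Notation T := (measurableTypeR R).
Local Notation proj := Defs.proj.
Local Notation hnorm_sqr := (hnorm_sqr dotE).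
Implicit Types (x y z w : H) (B C : set T).

Lemma rdot_proj B C x y : measurable B -> measurable C ->
  <[proj E B x, proj E C y]> = <[proj E (B `&` C) x, y]>.
Proof. by move=> mB mC; rewrite /rdot -proj_sym// setIC projI. Qed.

Lemma proj_symr B x y : measurable B -> <[proj E B x, y]> = <[x, proj E B y]>.
Proof. by move=> mB; rewrite /rdot proj_sym. Qed.

Lemma proj_idem B x : measurable B -> proj E B (proj E B x) = proj E B x.
Proof. by move=> mB; rewrite -projI// setIid. Qed.

Lemma proj_comm B C x : measurable B -> measurable C ->
  proj E B (proj E C x) = proj E C (proj E B x).
Proof. by move=> mB mC; rewrite -!projI// setIC. Qed.

Lemma projD B x y : measurable B -> proj E B (x + y) = proj E B x + proj E B y.
Proof. by move=> mB; have := proj_linear E 1 x y mB; rewrite !scale1r. Qed.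

Lemma proj_at0 B : measurable B -> proj E B 0 = 0.
Proof. by move=> mB; apply: (addrI (proj E B 0)); rewrite -projD// !addr0. Qed.

Lemma projZ B c x : measurable B -> proj E B (c *: x) = c *: proj E B x.
Proof. by move=> mB; have := proj_linear E c x 0 mB; rewrite !addr0 proj_at0// addr0. Qed.

Lemma projN B x : measurable B -> proj E B (- x) = - proj E B x.
Proof. by move=> mB; rewrite -scaleN1r projZ// scaleN1r. Qed.

Lemma smeas_rdot B x : measurable B -> smeas E x B = (<[proj E B x, x]>)%:E.
Proof. by move=> mB; rewrite smeasE// hnorm_sqr rdot_proj// setIid. Qed.

Lemma proj_set0 x : proj E set0 x = 0.
Proof.
apply/eqP; rewrite -hnorm_eq0 -sqrf_eq0 -eqe -smeasE ?measure0//.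
Qed.

Lemma proj_disj B C x : measurable B -> measurable C -> B `&` C = set0 ->
  proj E B (proj E C x) = 0.
Proof. by move=> mB mC BC; rewrite -projI// BC proj_set0. Qed.

(** Additivity of the measures only concerns squared norms; the vector identity follows because the
    squared norm of the difference of the two sides expands to 0. *)
Lemma projU B C x : measurable B -> measurable C -> B `&` C = set0 ->
  proj E (B `|` C) x = proj E B x + proj E C x.
Proof.
move=> mB mC BC; have mU := measurableU _ _ mB mC.
have /= h := measureU (smeas E x) mB mC BC.
rewrite !smeas_rdot// -EFinD in h; case: h => h.
apply/eqP; rewrite -subr_eq0 -(rdot_eq0 dotE).
rewrite !(rdotDl, rdotDr, rdotNl, rdotNr) !rdot_proj// !setIid.
rewrite (setIC _ B) (setIC _ C) (setIC C B) BC proj_set0 rdot0l.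
have -> : B `&` (B `|` C) = B by apply/seteqP; split=> r /=; tauto.
have -> : C `&` (B `|` C) = C by apply/seteqP; split=> r /=; tauto.
by rewrite h; apply/eqP; ring.
Qed.

Lemma hnorm_proj B x : measurable B -> hnorm (proj E B x) <= hnorm x.
Proof.
move=> mB; rewrite -(@ler_pXn2r _ 2)// ?nnegrE ?hnorm_ge0//.
rewrite -lee_fin -smeasE// -[x in leRHS](projT E) -smeasE; last exact: measurableT.
by rewrite le_measure ?inE//; exact: measurableT.
Qed.

Lemma smeas_sub B C x : measurable B -> measurable C -> proj E B x = x ->
  B `<=` C -> proj E C x = x.
Proof.
move=> mB mC Bx BC; rewrite -{1}Bx -projI//.
by rewrite (_ : C `&` B = B)// setIC; apply/setIidl.
Qed.

Lemma proj_cvg_up (F : nat -> set T) x : (forall n, measurable (F n)) ->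
  nondecreasing_seq F ->
  hnorm (proj E (F n) x) ^+ 2 @[n --> \oo] --> hnorm (proj E (\bigcup_n F n) x) ^+ 2.
Proof.
move=> mF ndF; have mU : measurable (\bigcup_n F n) by exact: bigcup_measurable.
have h : smeas E x \o F @ \oo --> (hnorm (proj E (\bigcup_n F n) x) ^+ 2)%:E.
  by rewrite -smeasE//; exact: nondecreasing_cvg_mu.
rewrite (_ : (fun n => _) = fine \o (smeas E x \o F)); first exact: fine_cvg h.
by apply/funext => n /=; rewrite smeasE.
Qed.

Lemma proj_cvg_down (F : nat -> set T) x : (forall n, measurable (F n)) ->
  nonincreasing_seq F ->
  hnorm (proj E (F n) x) ^+ 2 @[n --> \oo] --> hnorm (proj E (\bigcap_n F n) x) ^+ 2.
Proof.
move=> mF ndF; have mU : measurable (\bigcap_n F n) by exact: bigcap_measurable.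
have h : smeas E x \o F @ \oo --> (hnorm (proj E (\bigcap_n F n) x) ^+ 2)%:E.
  by rewrite -smeasE//; apply: nonincreasing_cvg_mu => //; rewrite smeasE// ltry.
rewrite (_ : (fun n => _) = fine \o (smeas E x \o F)); first exact: fine_cvg h.
by apply/funext => n /=; rewrite smeasE.
Qed.

Definition itvn (n : nat) : set T := `[- n%:R, n%:R]%classic.

Lemma measurable_itvn n : measurable (itvn n).
Proof. exact: measurable_itv. Qed.
Hint Resolve measurable_itvn : core.

Lemma nondecreasing_itvn : nondecreasing_seq itvn.
Proof.
move=> m n mn; apply/subsetPset => l; rewrite /itvn /=.
have mnR : m%:R <= n%:R :> R by rewrite ler_nat.
by rewrite !in_itv /= => /andP[h1 h2]; apply/andP; split; lra.
Qed.

Lemma bigcup_itvn : \bigcup_n itvn n = setT.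
Proof.
rewrite -subTset => r _; rewrite /itvn; exists (Num.Def.truncn `|r|).+1 => //=.
by rewrite in_itv /= -ler_norml ltW// truncnS_gt.
Qed.

Lemma proj_itvn_cvg x : hnorm (proj E (itvn n) x) ^+ 2 @[n --> \oo] --> hnorm x ^+ 2.
Proof.
have := @proj_cvg_up itvn x measurable_itvn nondecreasing_itvn.
by rewrite bigcup_itvn projT.
Qed.

Lemma proj_itvn_neq0 x : x != 0 -> exists n, proj E (itvn n) x != 0.
Proof.
move=> x0; apply/not_existsP => h; move/eqP: x0; apply; apply/eqP.
rewrite -hnorm_eq0 -sqrf_eq0; apply/eqP.
have := @proj_itvn_cvg x; rewrite (_ : (fun n => _) = cst 0).
  by move=> h0; apply: (cvg_unique _ h0) => //; exact: cvg_cst.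
apply/funext => n /=.
have -> : proj E (itvn n) x = 0 by apply/eqP/negPn/negP/h.
by rewrite hnorm0 expr0n.
Qed.

End SpectralMeasure.

(** * Bounds for spectral integrals over sets where the integrand is bounded *)

Section SpectralIntegralBound.
Variables (R : realType) (H : completeNormedModType R[i]).
Variable dot : {dot H for Num.conj}.
Hypothesis dotE : forall x : H, `|x| ^+ 2 = dot x x.
Variable E : spectral_measure dot.
Local Notation "<[ x , y ]>" := (rdot dot x y).
Local Notation T := (measurableTypeR R).
Local Notation proj := Defs.proj.
Local Notation hnorm_sqr := (hnorm_sqr dotE).
Implicit Types (x y z w : H) (B C I : set T).

Lemma smeas_T x : smeas E x setT = (hnorm x ^+ 2)%:E.
Proof. by rewrite smeasE// projT. Qed.

Lemma smeas_i x B : measurable B -> smeas E ('i *: x) B = smeas E x B.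
Proof. by move=> mB; rewrite !smeasE// projZ// (hnormi dotE). Qed.

Variable f : R -> R.
Hypothesis mf : measurable_fun setT (f : T -> R).

(** The real part of [spectral_form]; by [spectral_formE] the imaginary part is the same expression
    at ['i *: w]. *)
Definition rform x w : R :=
  (\int[smeas E (x + w)]_l f l - \int[smeas E (x - w)]_l f l) / 4.

Lemma spectral_formE x w :
  spectral_form E f x w = rform x w +i* rform x ('i *: w).
Proof.
rewrite /spectral_form /rform !big_ord_recr big_ord0 /= add0r.
rewrite !expr0 !expr1 !scale1r mul1r sqr_i (exprS _ 2) sqr_i mulrN1.
rewrite !scaleNr !scale1r.
set a := Rintegral _ _ _; set b := Rintegral _ _ _.
set c := Rintegral _ _ _; set d := Rintegral _ _ _.
have -> : (4 : R[i])^-1 = (4^-1 : R)%:C by rewrite fmorphV rmorph_nat.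
set q : R := 4^-1.
by apply/eqP; rewrite eq_complex /=; apply/andP; split; apply/eqP; ring.
Qed.

Lemma spectral_dom_i x : spectral_dom E f x -> spectral_dom E f ('i *: x).
Proof.
rewrite /spectral_dom /=; congr (_ < _)%E.
by apply: eq_measure_integral => A mA _; rewrite smeas_i.
Qed.

Lemma spectral_repP x y :
  (forall w, spectral_dom E f w -> dot y w = spectral_form E f x w) <->
  (forall w, spectral_dom E f w -> <[y, w]> = rform x w).
Proof.
split=> h w dw; first by rewrite /rdot h// spectral_formE.
by rewrite dot_rdot spectral_formE !h//; exact: spectral_dom_i.
Qed.

Section BoundedRangeDom.
Variables (I : set T) (C : R).
Hypothesis mI : measurable I.
Hypothesis C0 : 0 < C.
Hypothesis fC : forall l, I l -> `|f l| <= C.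

Lemma ae_range x : proj E I x = x -> {ae smeas E x, forall l, I l}.
Proof.
move=> Ix; have mC := measurableC mI; exists (~` I); split => //.
by rewrite smeasE// -Ix (proj_disj E _ mC mI (setICl _)) hnorm0 expr0n.
Qed.

Lemma spectral_dom_bounded x : proj E I x = x -> spectral_dom E f x.
Proof.
move=> Ix; rewrite /spectral_dom /=.
under eq_integral do rewrite -(ger0_norm (sqr_ge0 _)) -abse_EFin.
apply: (@le_lt_trans _ _ ((C ^+ 2)%:E * smeas E x setT)%E); last first.
  by rewrite smeas_T -EFinM ltry.
apply: integral_le_bound => //.
- by apply/measurable_EFinP; apply: measurable_funX.
- by rewrite lee_fin sqr_ge0.
- apply: filterS (ae_range Ix) => l Il _.
  by rewrite lee_fin normrX lerXn2r ?nnegrE ?(ltW C0)// fC.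
Qed.

End BoundedRangeDom.

Section BoundedRange.
Variables (I : set T) (C : R).
Hypothesis mI : measurable I.
Hypothesis C0 : 0 < C.
Hypothesis fC : forall l, I l -> `|f l| <= C.

Lemma Rintegral_bounded x : proj E I x = x ->
  `|\int[smeas E x]_l f l| <= C * hnorm x ^+ 2.
Proof.
move=> Ix.
have h : (\int[smeas E x]_l `|(f l)%:E| <= C%:E * smeas E x setT)%E.
  apply: integral_le_bound => //; first exact/measurable_EFinP.
    by rewrite lee_fin ltW.
  by apply: filterS (ae_range mI Ix) => l Il _; rewrite lee_fin fC.
have fi : (smeas E x).-integrable setT (EFin \o f).
  apply/integrableP; split; first exact/measurable_EFinP.
  by apply: le_lt_trans h _; rewrite smeas_T -EFinM ltry.
rewrite -lee_fin EFin_normr_Rintegral//.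
apply: le_trans (le_abse_integral _ _ _) _ => //; first exact/measurable_EFinP.
by apply: le_trans h _; rewrite smeas_T.
Qed.

(** The vectors [x] and [w] live on complementary spectral sets, so the cross terms vanish and
    [x + w], [x - w] have the same scalar measure. *)
Lemma rform_disj x w : proj E I x = x -> proj E I w = 0 -> rform x w = 0.
Proof.
move=> Ix Iw; rewrite /rform.
suff -> : \int[smeas E (x + w)]_l f l = \int[smeas E (x - w)]_l f l.
  by rewrite subrr mul0r.
rewrite /Rintegral; congr fine; apply: eq_measure_integral => B mB _.
rewrite !smeasE// !(projD,projN)// !hnorm_sqr.
rewrite !(rdotDl, rdotDr, rdotNl, rdotNr) !rdot_proj// setIid.
suff -> : <[proj E B x, w]> = 0.
  have -> : <[proj E B w, x]> = 0.
    by rewrite -Ix -proj_symr// proj_comm// Iw proj_at0// rdot0l.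
  by congr EFin; ring.
by rewrite -Ix proj_comm// proj_symr// Iw rdot0r.
Qed.

Lemma rform_bounded x w : proj E I x = x -> proj E I w = w ->
  `|rform x w| <= C * (hnorm x ^+ 2 + hnorm w ^+ 2) / 2.
Proof.
move=> Ix Iw.
have h1 : `|\int[smeas E (x + w)]_l f l| <= C * hnorm (x + w) ^+ 2.
  by apply: Rintegral_bounded; rewrite projD// Ix Iw.
have h2 : `|\int[smeas E (x - w)]_l f l| <= C * hnorm (x - w) ^+ 2.
  by apply: Rintegral_bounded; rewrite projD// projN// Ix Iw.
have -> : C * (hnorm x ^+ 2 + hnorm w ^+ 2) / 2 =
    (C * hnorm (x + w) ^+ 2 + C * hnorm (x - w) ^+ 2) / 4.
  by rewrite !hnorm_sqr !(rdotDl, rdotDr, rdotNl, rdotNr) (rdotC _ w); field.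
rewrite /rform normrM (ger0_norm (x := 4^-1))// ler_pM2r//.
by apply: le_trans (ler_normB _ _) _; exact: lerD.
Qed.

(** The value [y] of the integral is known only through its products with vectors of the domain, and
    [y] itself need not be one. It is therefore cut by the sets where |f| <= n: the cut vectors are
    admissible tests, the part outside [I] contributes nothing, and the bound survives as n
    grows. *)
Lemma hnorm_spectral_integral x : proj E I x = x ->
  hnorm (spectral_integral E f x) <= C * hnorm x.
Proof.
move=> Ix; rewrite /spectral_integral /=; case: xgetP => [y _ /spectral_repP yE|_]; last first.
  by rewrite hnorm0 mulr_ge0 ?hnorm_ge0// ltW.
pose J n : set T := f @^-1` itvn n.
have mJ n : measurable (J n : set T).
  by rewrite -[X in measurable X]setTI; apply: mf => //; exact: measurable_itvn.
suff JC n : hnorm (proj E (J n) y) ^+ 2 <= (C * hnorm x) ^+ 2.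
  rewrite -(@ler_pXn2r _ 2)// ?nnegrE ?mulr_ge0 ?hnorm_ge0 ?(ltW C0)//.
  have ndJ : nondecreasing_seq J.
    move=> m n mn; apply/subsetPset => l /=.
    by move: (nondecreasing_itvn R mn) => /subsetPset; apply.
  have := @proj_cvg_up _ _ _ E _ y mJ ndJ.
  rewrite (_ : \bigcup_n J n = setT); last first.
    by rewrite -preimage_bigcup bigcup_itvn preimage_setT.
  rewrite projT => h; rewrite -(cvg_lim _ h)//.
  apply: limr_le; first by apply/cvg_ex; eexists; exact: h.
  by apply: nearW.
set p := proj E (J n `&` I) y.
have mJI := measurableI _ _ (mJ n) mI.
have mJC := measurableI _ _ (mJ n) (measurableC mI).
have JE : proj E (J n) y = p + proj E (J n `&` ~` I) y.
  rewrite /p -(projU dotE)// -?setIUr ?setUv ?setIT//.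
  by rewrite setIACA setICr setI0.
have q0 : <[y, proj E (J n `&` ~` I) y]> = 0.
  rewrite yE; last first.
    apply: (spectral_dom_bounded (C := n.+1%:R) mJC) => [|l [Jl _]|]; last 1 first.
    - by rewrite proj_idem.
    - by rewrite ltr0n.
    by move: Jl; rewrite /J /itvn /= in_itv /= -ler_norml => /le_trans; apply; rewrite ler_nat.
  apply: rform_disj => //; rewrite (proj_disj E)//.
  by apply/seteqP; split=> l /=; tauto.
have yJ : hnorm (proj E (J n) y) ^+ 2 = hnorm p ^+ 2.
  by rewrite !hnorm_sqr !rdot_proj// !setIid !proj_symr// JE rdotDr q0 addr0.
have Ip : proj E I p = p.
  by rewrite /p -projI// setIC -setIA setIid.
have yp : <[y, p]> = hnorm p ^+ 2.
  by rewrite hnorm_sqr rdot_proj// setIid proj_symr.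
(* The test vector is p / C rather than p: this balances the two halves of [rform_bounded], so that
   |p|^2 can be absorbed on the left. *)
have ICp : proj E I ((C^-1)%:C *: p) = (C^-1)%:C *: p by rewrite projZ// Ip.
have := rform_bounded Ix ICp; rewrite -yE; last exact: (spectral_dom_bounded mI C0).
rewrite rdotZr yp hnormZr exprMn yJ => /(le_trans (ler_norm _)).
rewrite ger0_norm ?invr_ge0 ?(ltW C0)// => h.
have CV : C * C^-1 = 1 by rewrite mulfV// gt_eqF.
have : C * (C^-1 * hnorm p ^+ 2) <=
    C * (C * (hnorm x ^+ 2 + C^-1 ^+ 2 * hnorm p ^+ 2) / 2) by rewrite ler_pM2l.
have -> : C * (C * (hnorm x ^+ 2 + C^-1 ^+ 2 * hnorm p ^+ 2) / 2) =
  (C ^+ 2 * hnorm x ^+ 2 + (C * C^-1) ^+ 2 * hnorm p ^+ 2) / 2 by ring.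
rewrite mulrA CV exprMn; lra.
Qed.
End BoundedRange.
End SpectralIntegralBound.

(** * Compactness forces a pure point spectrum *)

Section PurePoint.
Variables (R : realType) (H : completeNormedModType R[i]).
Variable dot : {dot H for Num.conj}.
Hypothesis dotE : forall x : H, `|x| ^+ 2 = dot x x.
Variable E : spectral_measure dot.
Local Notation "<[ x , y ]>" := (rdot dot x y).
Local Notation T := (measurableTypeR R).
Local Notation proj := Defs.proj.
Local Notation hnorm_sqr := (hnorm_sqr dotE).
Implicit Types (x y z w : H) (B C I : set T).

Lemma smeas_eq0 x B : measurable B -> (smeas E x B == 0)%E = (proj E B x == 0).
Proof. by move=> mB; rewrite smeasE// eqe sqrf_eq0 hnorm_eq0. Qed.

Lemma proj_sub0 x B C : measurable B -> measurable C -> B `<=` C ->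
  proj E C x = 0 -> proj E B x = 0.
Proof.
by move=> mB mC BC Cx; rewrite -(setIidl BC) projI// Cx proj_at0.
Qed.

(** The point is the supremum of the t for which the spectral measure of [x] does not charge the
    half-line up to t. If a window around it were null, the null half-line could be extended past
    the supremum. *)
Lemma support_point N x : proj E (itvn N) x = x -> x != 0 ->
  exists t : R, forall e : R, 0 < e -> proj E (`]t - e, t + e[%classic : set T) x != 0.
Proof.
move=> Nx x0.
pose G : set R := [set t | proj E (`]-oo, t]%classic : set T) x = 0].
have mI (t : R) : measurable (`]-oo, t]%classic : set T) by exact: measurable_itv.
have mitv := @measurable_itvn R.
have ubG : ubound G N%:R.
  move=> t Gt; rewrite leNgt; apply/negP => Nt; move/eqP: x0; apply.
  rewrite -Nx; apply: (proj_sub0 _ _ _ Gt) => // r.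
  by rewrite /itvn /= !in_itv /= => /andP[_ rN]; exact: le_trans rN (ltW Nt).
have supG : has_sup G.
  split; last by exists N%:R.
  exists (- N%:R - 1); rewrite /G /= -Nx; apply: (proj_disj E) => //.
  by apply/seteqP; split => // r [] /=; rewrite /itvn /= !in_itv /=; lra.
exists (sup G) => e e0; apply/eqP => h.
have e2 : 0 < e / 2 by rewrite divr_gt0.
have [s Gs sG] := sup_adherent e2 supG.
have : ~ G (sup G + e / 2).
  by move=> /(ub_le_sup (ex_intro _ _ ubG)); lra.
apply; rewrite /G /=; apply/eqP; rewrite -smeas_eq0// -measure_le0.
have mJ : measurable (`]sup G - e, sup G + e[%classic : set T) by exact: measurable_itv.
have sJ : smeas E x `]-oo, s]%classic = 0%E by apply/eqP; rewrite smeas_eq0//; exact/eqP.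
have eJ : smeas E x `]sup G - e, sup G + e[%classic = 0%E.
  by apply/eqP; rewrite smeas_eq0//; exact/eqP.
have := measureU2 (smeas E x) (mI s) mJ; rewrite [X in (_ <= X + _)%E]sJ
    [X in (_ <= _ + X)%E]eJ adde0.
apply: le_trans.
apply: le_measure; rewrite ?inE//; first exact: measurableU.
move=> r /=; rewrite !in_itv /= => rG.
by have [rs|rs] := leP r s; [left|right; apply/andP; split; lra].
Qed.

(** This is what the compact embedding of V in H gives: on a bounded spectral window the norm of V
    is controlled by that of H. *)
Hypothesis spectral_compact : forall N (u : nat -> H),
  (forall n, proj E (itvn N) (u n) = u n) -> (forall n, hnorm (u n) <= 1) ->
  exists k : nat -> nat, {homo k : m n / (m < n)%N} /\
    exists l, hnorm (u (k n) - l) @[n --> \oo] --> (0 : R).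

Lemma homo_geq_id (k : nat -> nat) : {homo k : m n / (m < n)%N} ->
  forall n, (n <= k n)%N.
Proof. by move=> hk; elim=> // n IH; apply: leq_ltn_trans IH (hk _ _ _). Qed.

Lemma hnorm_normalize x : x != 0 -> hnorm ((hnorm x)^-1%:C *: x) = 1.
Proof.
move=> x0; rewrite hnormZr ger0_norm ?invr_ge0 ?hnorm_ge0// mulVf//.
by rewrite hnorm_eq0.
Qed.

Lemma proj_fix_lim B (u : nat -> H) l : measurable B ->
  (\forall n \near \oo, proj E B (u n) = u n) ->
  hnorm (u n - l) @[n --> \oo] --> (0 : R) -> proj E B l = l.
Proof.
move=> mB uB ul; apply/eqP; rewrite -subr_eq0 -hnorm_eq0 eq_le hnorm_ge0 andbT.
have h2 : hnorm (u n - l) * 2 @[n --> \oo] --> (0 : R).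
  by rewrite -[X in _ --> X](mul0r 2); apply: cvgMl.
apply: (cvgr_to_ge h2); apply: filterS uB => n un.
have -> : proj E B l - l = (u n - l) - proj E B (u n - l).
  by rewrite projD// projN// un opprD opprK addrACA subrr add0r addrC.
apply: le_trans (hnormD _ _) _; rewrite hnormN mulr_natr mulr2n lerD2l.
exact: hnorm_proj.
Qed.

Lemma proj_norm_fix B x : measurable B ->
  hnorm (proj E B x) ^+ 2 = hnorm x ^+ 2 -> proj E B x = x.
Proof.
move=> mB; rewrite !hnorm_sqr => h; apply/eqP; rewrite -subr_eq0 -(rdot_eq0 dotE).
rewrite !(rdotDl, rdotDr, rdotNl, rdotNr) (rdotC _ x) -h.
by rewrite rdot_proj// setIid; apply/eqP; ring.
Qed.

(** Suppose a nonzero [x] charges no point. Around a point t of its support, normalise its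
    projections on windows shrinking to t and extract a limit l by compactness. Then |l| = 1 and l
    is fixed by the projection on {t}; but that projection kills the whole sequence, so l is
    orthogonal to it and hence to itself. *)
Lemma pure_point x : (forall m : R, proj E ([set m] : set T) x = 0) -> x = 0.
Proof.
move=> xp; apply/eqP/negPn/negP => /(proj_itvn_neq0 E)[N].
set x1 := proj E (itvn N) x => x10.
have mitv := @measurable_itvn R.
have Nx1 : proj E (itvn N) x1 = x1 by rewrite proj_idem.
have [t tx] := support_point Nx1 x10.
have [d d0 [d_le d_lim]] : exists2 d : nat -> R, (forall n, 0 < d n) &
    (forall m n, (m <= n)%N -> d n <= d m) /\ forall e, 0 < e -> exists n, d n < e.
  exists (fun n => n.+1%:R^-1); first by move=> n; rewrite invr_gt0.
  split=> [m n mn|e e0]; first by rewrite lef_pV2 ?posrE// ler_nat.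
  by have [n _ /(_ n (leqnn n))] := near_infty_natSinv_lt (PosNum e0); exists n.
pose I n : set T := `]t - d n, t + d n[%classic.
have mI n : measurable (I n) by exact: measurable_itv.
have In m n : (m <= n)%N -> I n `<=` I m.
  move=> mn r; rewrite /I /= !in_itv /=.
  have := d_le _ _ mn.
  by move=> h /andP[h1 h2]; apply/andP; split; lra.
pose p n := proj E (I n) x1.
have p0 n : p n != 0 by exact: tx.
pose u n := (hnorm (p n))^-1%:C *: p n.
have Iu m n : (m <= n)%N -> proj E (I m) (u n) = u n.
  move=> mn; rewrite /u projZ//; congr (_ *: _).
  by apply: (smeas_sub (mI n) (mI m)); [rewrite proj_idem|exact: In].
have uN n : proj E (itvn N) (u n) = u n.
  by rewrite /u projZ// /p proj_comm// Nx1.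
have u1 n : hnorm (u n) = 1 by exact: hnorm_normalize.
have [|k [hk [l kl]]] := spectral_compact uN; first by move=> n; rewrite u1.
have Il m : proj E (I m) l = l.
  apply: (proj_fix_lim _ _ kl) => //; exists m => // n /= mn.
  by apply: Iu; apply: leq_trans mn (homo_geq_id hk n).
have mt : measurable ([set t] : set T) by exact: measurable_set1.
have tl : proj E ([set t] : set T) l = l.
  have IE : \bigcap_n I n = [set t].
    apply/seteqP; split => [r h|r -> n _]; last first.
      rewrite /I /= in_itv /=.
      by have := d0 n; lra.
    apply/eqP; rewrite -subr_eq0 -normr_le0 leNgt; apply/negP => rt.
    have [n] := d_lim _ rt; apply/negP; rewrite -leNgt.
    have := h n Logic.I; rewrite /I /= in_itv /= => /andP[h1 h2].
    by rewrite ler_norml; lra.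
  apply: proj_norm_fix => //; rewrite -IE.
  have niI : nonincreasing_seq I by move=> m n mn; apply/subsetPset; exact: In.
  have h := @proj_cvg_down _ _ _ E _ l mI niI.
  apply: (cvg_unique _ h) => //; rewrite (_ : (fun _ => _) = cst (hnorm l ^+ 2)).
    exact: cvg_cst.
  by apply/funext => n; rewrite Il.
have : <[l, l]> = 0.
  have h := @rdot_cvg _ _ _ dotE _ l l kl.
  apply/esym/(cvg_unique _ _ h) => //; rewrite (_ : (fun _ => _) = cst 0); first exact: cvg_cst.
  apply/funext => n /=; rewrite -tl -proj_symr// /u projZ//.
  by rewrite /p /x1 !(proj_comm E _ mt)// xp !proj_at0// scaler0 rdot0l.
rewrite -hnorm_sqr => /eqP; rewrite sqrf_eq0 => /eqP l0.
have := hnorm_cvg kl; rewrite l0 (_ : (fun _ => _) = cst 1); last by apply/funext => n; rewrite u1.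
move=> h1; have : (0 : R) = 1 by apply: (cvg_unique _ h1) => //; exact: cvg_cst.
by move=> /esym/eqP; rewrite oner_eq0.
Qed.
Definition point_spectrum : set T := [set m | exists x, proj E ([set m] : set T) x != 0].
Local Notation Lam := point_spectrum.

(** Infinitely many atoms in a bounded window would give an orthonormal sequence there; its terms
    stay at distance sqrt 2 from each other, so no subsequence converges. *)
Lemma finite_point_spectrum N : finite_set (Lam `&` itvn N).
Proof.
apply: contrapT => /infiniteP/pcard_leP[e].
have e_in n : (Lam `&` itvn N) (e n) by apply: (@funS _ _ _ _ e n).
have m1 (t : R) : measurable ([set t] : set T) by exact: measurable_set1.
have /choice[v vP] n : exists v, proj E ([set (e n : R)] : set T) v = v /\ hnorm v = 1.
  have [[x x0] _] := e_in n.
  exists ((hnorm (proj E [set e n : R] x))^-1%:C *: proj E [set e n : R] x).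
  by rewrite projZ// proj_idem// hnorm_normalize.
have [n||k [hk [l kl]]] := @spectral_compact N v.
- have [vn _] := vP n; apply: (smeas_sub (m1 (e n)) (@measurable_itvn R N)) => //.
  by move=> _ ->; have [] := e_in n.
- by move=> n; rewrite (vP n).2.
have vo i j : i != j -> hnorm (v i - v j) ^+ 2 = 2.
  move=> ij; rewrite hnorm_sqr !(rdotDl, rdotDr, rdotNl, rdotNr) -!hnorm_sqr !(vP _).2.
  suff z p q : p != q -> <[v p, v q]> = 0 by rewrite !z// 1?eq_sym//; ring.
  move=> pq; rewrite -(vP p).1 -(vP q).1 rdot_proj//.
  rewrite (_ : _ `&` _ = set0) ?proj_set0 ?rdot0l//.
  apply/seteqP; split => // r [/= -> /inj] h; move/eqP: pq; apply.
  by apply: h; rewrite inE.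
have /cvgr0Pnorm_lt/(_ (2^-1)) := kl; case=> [|M _ hM]; first by rewrite invr_gt0.
have h1 := hM M (leqnn M); have h2 := hM M.+1 (leqnSn M).
move: h1 h2; rewrite /= !ger0_norm ?hnorm_ge0// => h1 h2.
have := hnormD (v (k M) - l) (l - v (k M.+1)); rewrite addrA subrK hnormB in h2 *.
move=> h3; have : hnorm (v (k M) - v (k M.+1)) ^+ 2 = 2.
  by apply: vo; rewrite neq_ltn hk.
have := hnorm_ge0 (v (k M) - v (k M.+1)); nra.
Qed.

Lemma countable_point_spectrum : countable Lam.
Proof.
have -> : Lam = \bigcup_N (Lam `&` itvn N).
  by rewrite -setI_bigcupr bigcup_itvn setIT.
by apply: bigcup_countable => // N _; apply: finite_set_countable; exact: finite_point_spectrum.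
Qed.

Lemma proj_point_spectrum x : proj E (~` Lam) x = 0.
Proof.
have mL : measurable Lam.
  apply: countable_measurable; last exact: countable_point_spectrum.
  by move=> t; exact: measurable_set1.
have mLC := measurableC mL.
have m1 (t : R) : measurable ([set t] : set T) by exact: measurable_set1.
apply: pure_point => t; have [tL|tL] := pselect (Lam t).
  apply: (proj_disj E) => //; apply/seteqP; split => // r [-> ]; exact.
by apply/eqP/negPn/negP => h; apply: tL; exists (proj E (~` Lam) x).
Qed.

End PurePoint.

(** * Countable orthogonal decompositions *)

Section Diagonal.
Variables (R : realType) (H : completeNormedModType R[i]).
Variable dot : {dot H for Num.conj}.
Hypothesis dotE : forall x : H, `|x| ^+ 2 = dot x x.
Local Notation "<[ x , y ]>" := (rdot dot x y).
Local Notation hnorm_sqr := (hnorm_sqr dotE).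
Implicit Types (x y z w : H) (P : nat -> H -> H).

(** An orthogonal resolution of the identity, some members of which may be zero; completeness is
    carried by Parseval's identity. *)
Record diagonal P : Prop := Diagonal {
  diag_linear : forall n (c : R[i]) x y, P n (c *: x + y) = c *: P n x + P n y;
  diag_sym : forall n x y, <[P n x, y]> = <[x, P n y]>;
  diag_orth : forall m n x, P m (P n x) = if m == n then P n x else 0;
  diag_parseval : forall x,
    \sum_(i < n) <[P i x, P i x]> @[n --> \oo] --> <[x, x]> }.

Arguments diag_parseval {P} _ x.

Variable P : nat -> H -> H.
Hypothesis dP : diagonal P.

Lemma diagD n x y : P n (x + y) = P n x + P n y.
Proof. by have := diag_linear dP n 1 x y; rewrite !scale1r. Qed.

Lemma diag0 n : P n 0 = 0.
Proof. by apply: (addrI (P n 0)); rewrite -diagD !addr0. Qed.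

Lemma diagZ n (c : R[i]) x : P n (c *: x) = c *: P n x.
Proof. by have := diag_linear dP n c x 0; rewrite !addr0 diag0 addr0. Qed.

Lemma diagN n x : P n (- x) = - P n x.
Proof. by rewrite -scaleN1r diagZ scaleN1r. Qed.

Lemma diag_idem n x : P n (P n x) = P n x.
Proof. by rewrite (diag_orth dP) eqxx. Qed.

Lemma diag_sum n I (s : seq I) (F : I -> H) :
  P n (\sum_(i <- s) F i) = \sum_(i <- s) P n (F i).
Proof. by elim/big_rec2: _ => [|i a b _ <-]; rewrite ?diag0// diagD. Qed.

Lemma diag_rdot n x y : <[P n x, P n y]> = <[P n x, y]>.
Proof. by rewrite -(diag_sym dP) diag_idem. Qed.

Lemma diag_orth_rdot m n x y : m != n -> <[P m x, P n y]> = 0.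
Proof. by move=> mn; rewrite -(diag_sym dP) (diag_orth dP) eq_sym (negPf mn) rdot0l. Qed.

Lemma psum_le (u : nat -> R) l n : (forall i, 0 <= u i) ->
  \sum_(i < n) u i @[n --> \oo] --> l -> \sum_(i < n) u i <= l.
Proof.
move=> u0 ul; apply: (cvgr_to_ge ul); exists n => // m /= nm.
rewrite -!(big_mkord xpredT u) (big_cat_nat (leq0n n) nm)//= lerDl.
by apply: sumr_ge0 => i _.
Qed.

Lemma diag_bessel n x : \sum_(i < n) <[P i x, P i x]> <= <[x, x]>.
Proof.
have h := diag_parseval dP x;
apply: (@psum_le (fun i => <[P i x, P i x]>) _ n _ h) => i; exact: rdot_ge0.
Qed.

Lemma diag_le n x : <[P n x, P n x]> <= <[x, x]>.
Proof.
apply: le_trans (diag_bessel n.+1 x); rewrite big_ord_recr /= lerDr.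
by apply: sumr_ge0 => i _; exact: rdot_ge0.
Qed.

Lemma hnorm_diag n x : hnorm (P n x) <= hnorm x.
Proof. by rewrite -(@ler_pXn2r _ 2)// ?nnegrE ?hnorm_ge0// !hnorm_sqr diag_le. Qed.

Lemma diag_polar x y : \sum_(i < n) <[P i x, P i y]> @[n --> \oo] --> <[x, y]>.
Proof.
have E a b : <[a, b]> = (<[a + b, a + b]> - <[a - b, a - b]>) / 4.
  by rewrite !(rdotDl, rdotDr, rdotNl, rdotNr) (rdotC _ b a); field.
rewrite E (_ : (fun n => _) = fun n => (\sum_(i < n) <[P i (x + y), P i (x + y)]> -
   \sum_(i < n) <[P i (x - y), P i (x - y)]>) / 4).
  by apply: cvgMl; apply: cvgB; exact: diag_parseval.
apply/funext => n; rewrite -sumrB mulr_suml; apply: eq_bigr => i _.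
by rewrite [LHS]E !diagD diagN.
Qed.

Lemma diag_ext x y : (forall n, P n x = P n y) -> x = y.
Proof.
move=> h; apply/eqP; rewrite -subr_eq0 -(rdot_eq0 dotE); apply/eqP.
have := diag_parseval dP (x - y); rewrite (_ : (fun _ => _) = cst 0).
  by move=> h0; apply: (cvg_unique _ h0) => //; exact: cvg_cst.
apply/funext => n; rewrite big1// => i _.
by rewrite diagD diagN h subrr rdot0l.
Qed.

Lemma diag_proj_sum n m (y : nat -> H) : (forall i, P i (y i) = y i) ->
  P m (\sum_(i < n) y i) = if (m < n)%N then y m else 0.
Proof.
move=> Py; rewrite diag_sum; under eq_bigr => i _ do rewrite -Py (diag_orth dP) Py.
case: ifPn => mn; last first.
  rewrite big1// => i _; case: eqP => // mi; move: mn; rewrite mi ltn_ord//.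
by rewrite (bigD1 (Ordinal mn))//= eqxx big1 ?addr0// => i; rewrite -val_eqE /= eq_sym => /negPf ->.
Qed.

Lemma diag_norm_sum m n (y : nat -> H) : (forall i, P i (y i) = y i) ->
  <[\sum_(m <= i < n) y i, \sum_(m <= i < n) y i]> = \sum_(m <= i < n) <[y i, y i]>.
Proof.
move=> Py; rewrite rdot_suml; apply: eq_big_nat => i /andP[mi ni].
rewrite rdot_sumr (bigD1_seq i)/= ?mem_index_iota ?mi ?iota_uniq//.
rewrite big1 ?addr0// => j ji.
by rewrite -Py -(Py j) diag_orth_rdot// eq_sym.
Qed.

Lemma psum_cvg (u : nat -> R) M : (forall i, 0 <= u i) ->
  (forall n, \sum_(i < n) u i <= M) -> cvgn (fun n => \sum_(i < n) u i).
Proof.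
move=> u0 uM; apply: nondecreasing_is_cvgn; last by exists M => _ [n _ <-].
apply/nondecreasing_seqP => n; rewrite big_ord_recr /= lerDl//.
Qed.

(** Riesz-Fischer: by orthogonality the squared norm of a block of the series is a difference of
    bounded increasing partial sums, so the series is Cauchy; continuity of [P n] then identifies
    the components of its sum. *)
Lemma diag_synth (y : nat -> H) M : (forall i, P i (y i) = y i) ->
  (forall n, \sum_(i < n) <[y i, y i]> <= M) -> exists Y, forall n, P n Y = y n.
Proof.
move=> Py yM.
have /cvg_ex[/= l ul] := psum_cvg (fun i => rdot_ge0 dotE (y i)) yM.
pose S n := \sum_(i < n) y i.
have [e e0|Y SY] := @hnorm_complete _ _ S.
  have e20 : 0 < e ^+ 2 by rewrite exprn_gt0.
  have /cvgrPdist_lt/(_ _ e20)[N _ hN] := ul.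
  exists N => n Nn; rewrite -(@ltr_pXn2r _ 2)// ?nnegrE ?hnorm_ge0 ?(ltW e0)//.
  rewrite hnormB hnorm_sqr /S -!(big_mkord xpredT y) (big_cat_nat (leq0n N) Nn)//=.
  rewrite addrAC subrr add0r diag_norm_sum//.
  have := hN N (leqnn N); have := hN n Nn.
  have := @psum_le _ _ n (fun i => rdot_ge0 dotE (y i)) ul.
  rewrite /= -!(big_mkord xpredT (fun i => <[y i, y i]>)) (big_cat_nat (leq0n N) Nn)//=.
  by rewrite !ltr_norml => h1 /andP[h2 h3] /andP[h4 h5]; lra.
exists Y => n; apply/eqP; rewrite -subr_eq0 -hnorm_eq0 eq_le hnorm_ge0 andbT.
apply: (cvgr_to_ge SY); exists n.+1 => // m /= nm.
apply: le_trans (hnorm_diag n _); rewrite diagD diagN /S diag_proj_sum// nm.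
by rewrite hnormB.
Qed.

End Diagonal.

(** * Functional calculus as a series over atoms *)

Section SpectralDecomposition.
Variables (R : realType) (H : completeNormedModType R[i]).
Variable dot : {dot H for Num.conj}.
Hypothesis dotE : forall x : H, `|x| ^+ 2 = dot x x.
Variable E : spectral_measure dot.
Local Notation "<[ x , y ]>" := (rdot dot x y).
Local Notation T := (measurableTypeR R).
Local Notation proj := Defs.proj.
Local Notation hnorm_sqr := (hnorm_sqr dotE).
Implicit Types (x y z w : H).

(** [B n] is contained in {mu n} and may be empty; this lets all natural numbers index a point
    spectrum that may be finite or enumerated with gaps. *)
Record atoms (B : nat -> set T) (mu : nat -> R) : Prop := Atoms {
  atom_measurable : forall n, measurable (B n);
  atom_sub : forall n r, B n r -> r = mu n;
  atom_triv : trivIset setT B;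
  atom_full : forall x, proj E (~` (\bigcup_n B n)) x = 0 }.

Variables (B : nat -> set T) (mu : nat -> R).
Hypothesis BP : atoms B mu.

Let P n x := proj E (B n) x.
Let mB := atom_measurable BP.

Let mU : measurable (\bigcup_n B n).
Proof. exact: bigcup_measurable. Qed.

Lemma atomic_integral x (g : R -> R) : measurable_fun setT (g : T -> R) ->
  (forall l, 0 <= g l) ->
  (\int[smeas E x]_l (g l)%:E = \sum_(n <oo) (g (mu n) * <[P n x, P n x]>)%:E)%E.
Proof.
move=> mg g0.
have mgE D : measurable_fun D (fun l : T => (g l)%:E).
  by apply/measurable_EFinP; exact: measurable_funS mg.
rewrite (ge0_negligible_integral (measurableC mU))//; last 2 first.
- by move=> l _; rewrite lee_fin.
- by rewrite smeasE ?(atom_full BP) ?hnorm0 ?expr0n//; exact: measurableC.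
rewrite setTD setCK ge0_integral_bigcup//; last exact: (atom_triv BP).
  apply: eq_eseriesr => n _.
  rewrite (eq_integral (cst (g (mu n))%:E)); last first.
    by move=> l; rewrite inE => /(atom_sub BP) ->.
  by rewrite integral_cst// smeasE// hnorm_sqr -EFinM.
by move=> l _; rewrite lee_fin.
Qed.

Lemma atomic_cvg x (g : R -> R) : measurable_fun setT (g : T -> R) ->
  (forall l, 0 <= g l) -> (\int[smeas E x]_l (g l)%:E < +oo)%E ->
  \sum_(i < n) g (mu i) * <[P i x, P i x]> @[n --> \oo] --> \int[smeas E x]_l g l.
Proof.
move=> mg g0 gfin.
have u0 n : (0 <= (g (mu n) * <[P n x, P n x]>)%:E)%E.
  by rewrite lee_fin mulr_ge0// (rdot_ge0 dotE).
have /= h := is_cvg_nneseries (N := 0%N) (P := xpredT) (fun n _ _ => u0 n).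
rewrite (_ : (fun n => _) = fine \o (fun n =>
    (\sum_(0 <= i < n) (g (mu i) * <[P i x, P i x]>)%:E)%E)); last first.
  by apply/funext => n; rewrite /= sumEFin big_mkord.
apply: fine_cvg; rewrite fineK; last first.
  rewrite ge0_fin_numE//; apply: integral_ge0 => l _; rewrite lee_fin//.
by rewrite atomic_integral.
Qed.

Lemma atomic_finite x (g : R -> R) : measurable_fun setT (g : T -> R) ->
  (forall l, 0 <= g l) ->
  (\int[smeas E x]_l (g l)%:E < +oo)%E <->
  exists M, forall n, \sum_(i < n) g (mu i) * <[P i x, P i x]> <= M.
Proof.
move=> mg g0.
have u0 n : (0 <= (g (mu n) * <[P n x, P n x]>)%:E)%E.
  by rewrite lee_fin mulr_ge0// (rdot_ge0 dotE).
split=> [gfin|[M hM]].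
  exists (\int[smeas E x]_l g l) => n.
  apply: (@psum_le _ (fun i => g (mu i) * <[P i x, P i x]>)); last exact: atomic_cvg.
  by move=> i; rewrite -lee_fin.
rewrite atomic_integral//; apply: (@le_lt_trans _ _ M%:E); last exact: ltry.
apply: lime_le; first exact: is_cvg_nneseries.
by apply: nearW => n; rewrite sumEFin big_mkord lee_fin.
Qed.

Lemma atoms_diagonal : diagonal dot P.
Proof.
split => [n c x y|n x y|m n x|x].
- exact: proj_linear.
- exact: proj_symr.
- case: eqP => [->|/eqP mn]; first exact: proj_idem.
  apply: proj_disj => //; apply: contrapT => /eqP/set0P[r [h1 h2]].
  by move/eqP: mn; apply; apply: (atom_triv BP) => //; exists r.
have ic : (\int[smeas E x]_l (cst 1 l : R)%:E = (hnorm x ^+ 2)%:E)%E.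
  have := @integral_cst _ _ _ (smeas E x) _ (@measurableT _ T) 1%:E.
  by rewrite mul1e smeas_T.
have := @atomic_cvg x (cst 1); rewrite /Rintegral ic hnorm_sqr => h.
rewrite (_ : (fun n => _) = fun n => \sum_(i < n) cst 1 (mu i) * <[P i x, P i x]>).
  by apply: h => //; rewrite ltry.
by apply/funext => n; apply: eq_bigr => i _; rewrite /= mul1r.
Qed.

Let dP := atoms_diagonal.
Variable f : R -> R.
Hypothesis mf : measurable_fun setT (f : T -> R).

Lemma spectral_domP x : spectral_dom E f x <->
  exists M, forall n, \sum_(i < n) f (mu i) ^+ 2 * <[P i x, P i x]> <= M.
Proof.
apply: (@atomic_finite x (fun l => f l ^+ 2)); last by move=> l; exact: sqr_ge0.
exact: measurable_funX.
Qed.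

Lemma spectral_domD x y : spectral_dom E f x -> spectral_dom E f y ->
  spectral_dom E f (x + y).
Proof.
move=> /spectral_domP[M hM] /spectral_domP[N hN]; apply/spectral_domP.
exists (2 * M + 2 * N) => n.
apply: le_trans (lerD (ler_wpM2l _ (hM n)) (ler_wpM2l _ (hN n))) => //.
rewrite !mulr_sumr -big_split /=; apply: ler_sum => i _.
have := rdot_ge0 dotE (P i x - P i y); rewrite (diagD dP).
rewrite !(rdotDl, rdotDr, rdotNl, rdotNr) (rdotC _ (P i y) (P i x)).
have := sqr_ge0 (f (mu i)); set a := f _ ^+ 2; nra.
Qed.

Lemma spectral_domN x : spectral_dom E f x -> spectral_dom E f (- x).
Proof.
move=> /spectral_domP[M hM]; apply/spectral_domP; exists M => n.
apply: le_trans (hM n); apply: ler_sum => i _.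
by rewrite (diagN dP) rdotNl rdotNr opprK.
Qed.

Lemma spectral_dom_atom n x : spectral_dom E f (P n x).
Proof.
apply/spectral_domP; exists (f (mu n) ^+ 2 * <[P n x, P n x]>) => m.
have t0 : 0 <= f (mu n) ^+ 2 * <[P n x, P n x]>.
  by rewrite mulr_ge0 ?sqr_ge0// (rdot_ge0 dotE).
under eq_bigr => i _ do rewrite (diag_orth dP).
case: (ltnP n m) => nm; last first.
  by rewrite big1// => i _; case: eqP => [ni|];
    [move: (ltn_ord i); rewrite ni ltnNge nm|rewrite rdot0l mulr0].
rewrite (bigD1 (Ordinal nm))//= eqxx big1 ?addr0// => i.
by rewrite -val_eqE /= => /negPf ->; rewrite rdot0l mulr0.
Qed.

Lemma atomic_Rintegral x : spectral_dom E f x ->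
  \sum_(i < n) f (mu i) * <[P i x, P i x]> @[n --> \oo] --> \int[smeas E x]_l f l.
Proof.
move=> xf.
(* The series formula is available for nonnegative integrands. Both 1 + f^2 and 1 + f^2 - f are
   nonnegative, integrable on the domain of f, and differ by f. *)
pose h l := 1 + f l ^+ 2; pose g l := h l - f l.
have h0 l : 0 <= h l by rewrite addr_ge0 ?sqr_ge0.
have g0 l : 0 <= g l by rewrite /g /h; nra.
have mh : measurable_fun setT (h : T -> R).
  by apply: measurable_funD => //; exact: measurable_funX.
have mg : measurable_fun setT (g : T -> R) by exact: measurable_funB.
have hb : exists M, forall n, \sum_(i < n) h (mu i) * <[P i x, P i x]> <= M.
  have /spectral_domP[M hM] := xf; exists (<[x, x]> + M) => n.
  apply: le_trans (lerD (diag_bessel dotE dP n x) (hM n)).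
  by rewrite -big_split /=; apply: ler_sum => i _; rewrite /h mulrDl mul1r.
have gb : exists M, forall n, \sum_(i < n) g (mu i) * <[P i x, P i x]> <= M.
  have [M hM] := hb; exists (2 * M) => n.
  apply: le_trans (ler_wpM2l _ (hM n)) => //; rewrite mulr_sumr.
  apply: ler_sum => i _; rewrite mulrA ler_wpM2r ?(rdot_ge0 dotE)//.
  by rewrite /g /h; nra.
have hfin := (atomic_finite x mh h0).2 hb.
have gfin := (atomic_finite x mg g0).2 gb.
have int k : measurable_fun setT (k : T -> R) -> (forall l, 0 <= k l) ->
    (\int[smeas E x]_l (k l)%:E < +oo)%E -> (smeas E x).-integrable setT (EFin \o k).
  move=> mk k0 kfin; apply/integrableP; split; first exact/measurable_EFinP.
  by under eq_integral do rewrite /= ger0_norm//.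
have -> : \int[smeas E x]_l f l = \int[smeas E x]_l h l - \int[smeas E x]_l g l.
  rewrite -RintegralB//; [|exact: int|exact: int].
  by congr Rintegral; apply/funext => l; rewrite /g opprB addrCA subrr addr0.
rewrite (_ : (fun n => _) = fun n => \sum_(i < n) h (mu i) * <[P i x, P i x]> -
    \sum_(i < n) g (mu i) * <[P i x, P i x]>).
  by apply: cvgB; exact: atomic_cvg.
apply/funext => n; rewrite -sumrB; apply: eq_bigr => i _.
by rewrite -mulrBl /g opprB addrCA subrr addr0.
Qed.

(** The vector with components f(mu_n) P_n x exists by [diag_synth] and represents the spectral
    form, so [xget] has a witness. Any other witness agrees with it, since all the P_m y lie in the
    domain and can serve as tests. *)
Lemma spectral_integral_atom x n : spectral_dom E f x ->
  P n (spectral_integral E f x) = (f (mu n))%:C *: P n x.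
Proof.
move=> xf; have /spectral_domP[M hM] := xf.
have [||Y PY] := @diag_synth _ _ _ dotE _ dP (fun n => (f (mu n))%:C *: P n x) M.
- by move=> i; rewrite (diagZ dP) (diag_idem dP).
- by move=> m; under eq_bigr do rewrite rdotZl rdotZr mulrA -expr2.
have YE w : spectral_dom E f w -> <[Y, w]> = rform E f x w.
  move=> wf; apply: (cvg_unique _ (@diag_polar _ _ _ _ dP Y w)) => //.
  rewrite (_ : (fun n => _) = fun n =>
     (\sum_(i < n) f (mu i) * <[P i (x + w), P i (x + w)]> -
      \sum_(i < n) f (mu i) * <[P i (x - w), P i (x - w)]>) / 4).
    apply: cvgMl; apply: cvgB; apply: atomic_Rintegral; apply: spectral_domD => //.
    exact: spectral_domN.
  apply/funext => m; rewrite -sumrB mulr_suml; apply: eq_bigr => i _.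
  rewrite PY rdotZl !(diagD dP) (diagN dP).
  by rewrite !(rdotDl, rdotDr, rdotNl, rdotNr) (rdotC _ (P i w) (P i x)); field.
rewrite -PY; congr (P n _); rewrite /spectral_integral /=.
case: xgetP => [y _ /(spectral_repP dotE) yE|/(_ Y)]; last first.
  by move=> []; apply/(spectral_repP dotE).
apply: (diag_ext dotE dP) => m; apply/eqP; rewrite -subr_eq0 -(rdot_eq0 dotE).
rewrite -(diagN dP) -(diagD dP) (diag_rdot dP).
rewrite (diag_sym dP) rdotDl rdotNl.
by rewrite (yE _ (spectral_dom_atom _ _)) (YE _ (spectral_dom_atom _ _)) subrr.
Qed.

End SpectralDecomposition.

(** * Eigenvalues and eigenspaces of A *)

Section Diagonalization.
Variables (R : realType) (H : completeNormedModType R[i]).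
Variable dot : {dot H for Num.conj}.
Hypothesis dotE : forall x : H, `|x| ^+ 2 = dot x x.
Local Notation "<[ x , y ]>" := (rdot dot x y).
Local Notation T := (measurableTypeR R).
Local Notation proj := Defs.proj.
Local Notation hnorm_sqr := (hnorm_sqr dotE).
Implicit Types (x y z w : H).

Lemma atoms_exist (E : spectral_measure dot) :
  (forall N (u : nat -> H),
    (forall n, proj E (itvn N) (u n) = u n) -> (forall n, hnorm (u n) <= 1) ->
    exists k : nat -> nat, {homo k : m n / (m < n)%N} /\
      exists l, hnorm (u (k n) - l) @[n --> \oo] --> (0 : R)) ->
  exists B mu, atoms E B mu /\
    forall n, (exists x, proj E (B n) x != 0) \/ (B n = set0 /\ mu n = 1).
Proof.
move=> cpt; have Lc := countable_point_spectrum dotE cpt.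
have [code codeI] := countable_injP _ Lc.
pose L := point_spectrum E.
pose B n : set T := [set m | L m /\ code m = n].
(* An index that codes no eigenvalue has an empty atom; the default value 1 keeps its [mu n]
   positive. *)
pose mu n : R := xget (1 : R) (B n).
have Bmu n r : B n r -> r = mu n.
  move=> Br; rewrite /mu; case: xgetP => [s _ Bs|/(_ r)//].
  by apply: codeI; rewrite ?inE; [case: Br|case: Bs|rewrite (Br.2) (Bs.2)].
have m1 (t : R) : measurable ([set t] : set T) by exact: measurable_set1.
have BE n r : B n r -> B n = [set mu n].
  move=> Br; apply/seteqP; split=> [s /Bmu//|s ->]; by rewrite -(Bmu _ _ Br).
exists B, mu; split; first split.
- move=> n; have [->|/set0P[r Br]] := eqVneq (B n) set0; first exact: measurable0.
  by rewrite (BE _ _ Br).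
- exact: Bmu.
- by move=> i j _ _ [r [[_ <-] [_ <-]]].
- move=> x; rewrite (_ : \bigcup_n B n = L); first exact: proj_point_spectrum.
  by apply/seteqP; split => [r [n _ []]//|r Lr]; exists (code r).
move=> n; have [B0|/set0P[r Br]] := eqVneq (B n) set0.
  by right; split => //; rewrite /mu B0; case: xgetP.
by left; rewrite (BE _ _ Br) -(Bmu _ _ Br); have [[x ?] _] := Br; exists x.
Qed.

(* [oppow] has an empty domain unless A has a spectral measure: a single point
   of a domain provides one, and the spectral theorem is not needed. *)
Lemma oppow_spectral (A : operator H) s0 x0 : dom (oppow dot A s0) x0 ->
  exists2 E : spectral_measure dot, spectral_measure_of A E &
    forall s, oppow dot A s = spectral_integral E (fun l => l `^ s).
Proof.
rewrite /oppow; case: pselect => //= AE _.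
by exists (projT1 (cid AE)) => //; exact: (projT2 (cid AE)).
Qed.

Lemma powR_itvn_le N (s l : R) : 0 <= s -> itvn N l -> `|l `^ s| <= 1 + N%:R `^ s.
Proof.
move=> s0; rewrite /itvn /= in_itv /= => /andP[_ lN].
rewrite ger0_norm ?powR_ge0//; have [l0|l0] := ltP l 0.
  have -> : l `^ s = 1 by rewrite /powR lt_eqF// ln0 ?ltW// mulr0 expR0.
  by rewrite lerDl powR_ge0.
apply: le_trans (_ : N%:R `^ s <= _); last by rewrite lerDr.
by apply: ge0_ler_powR => //; rewrite nnegrE ?ler0n.
Qed.

(** From here on [A] is used only through this interface. In [spec_unbounded] the nonzero component
    ensures that the large [mu n] is a true eigenvalue and not the default value of an empty
    atom. *)
Record spectrum (A : operator H) (P : nat -> H -> H) (mu : nat -> R) (m0 : R) : Prop :=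
 Spectrum {
  spec_diag : diagonal dot P;
  spec_gt0 : 0 < m0;
  spec_ge : forall n, m0 <= mu n;
  spec_dom : forall s x, dom (oppow dot A s) x <->
    exists M, forall n, \sum_(i < n) (mu i `^ s) ^+ 2 * <[P i x, P i x]> <= M;
  spec_oppow : forall s x n, dom (oppow dot A s) x ->
    P n (oppow dot A s x) = (mu n `^ s)%:C *: P n x;
  spec_unbounded : forall M, exists n x, M < mu n /\ P n x != 0 }.

Lemma spectrum_exists (A : operator H) (HApos : positive_operator dot A)
    (HAunb : unbounded A)
    (HVHdense : dense_embedding (X := Vspace dot A) (Y := Hspace H) id)
    (HVHcpt : compact_embedding (X := Vspace dot A) (Y := Hspace H) id)
    (Hcoer : exists2 a0 : R, 0 < a0 &
      forall u, dom (oppow dot A 2^-1) u ->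
        hnorm u <= a0 * hnorm (oppow dot A 2^-1 u)) :
  exists P mu m0, spectrum A P mu m0.
Proof.
have [x0 V0 _] := HVHdense 0 I 1 ltr01.
have [E [domA AE] opE] := oppow_spectral V0.
have mpow (s : R) : measurable_fun setT ((fun l : R => l `^ s) : T -> R).
  exact: measurable_powR.
have cpt : forall N (u : nat -> H),
    (forall n, proj E (itvn N) (u n) = u n) -> (forall n, hnorm (u n) <= 1) ->
    exists k : nat -> nat, {homo k : m n / (m < n)%N} /\
      exists l, hnorm (u (k n) - l) @[n --> \oo] --> (0 : R).
  move=> N u uN u1.
  (* On the range of a bounded spectral window [A^{1/2}] is bounded by this constant, so a sequence
     bounded in H is bounded in V and the compact embedding applies. *)
  pose C : R := 1 + N%:R `^ 2^-1.
  have C0 : 0 < C by rewrite ltr_wpDr// powR_ge0.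
  have fC l : itvn N l -> `|l `^ 2^-1| <= C by apply: powR_itvn_le; rewrite invr_ge0.
  have mN := @measurable_itvn R N.
  have [|| k [hk [l _ kl]]] := HVHcpt u.
  - by move=> n; rewrite /= opE; exact: (spectral_dom_bounded (mpow _) mN C0 fC).
  - exists C => n; rewrite /= opE.
    apply: le_trans (hnorm_spectral_integral dotE (mpow _) mN C0 fC (uN n)) _.
    by rewrite -[leRHS]mulr1 ler_wpM2l// ltW.
  by exists k; split => //; exists l.
have [B [mu [BP Bn]]] := atoms_exist cpt.
have dP := atoms_diagonal dotE BP.
set P := fun n x => proj E (B n) x in dP.
have mid : measurable_fun setT (id : T -> R) by exact: measurable_id.
have Aid n x : dom A x -> P n (A x) = (mu n)%:C *: P n x.
  move=> Ax; rewrite AE//.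
  by apply: (spectral_integral_atom dotE BP mid); move: Ax; rewrite domA.
have [a0 a00 coer] := Hcoer.
pose m0 := Num.min 1 (a0 ^+ 2)^-1.
have a2 : 0 < a0 ^+ 2 by rewrite exprn_gt0.
have m00 : 0 < m0 by rewrite lt_min ltr01 invr_gt0.
have mu_ge n : m0 <= mu n.
  have [[x xn]|[_ ->]] := Bn n; last by rewrite ge_min lexx.
  rewrite ge_min; apply/orP; right.
  have Ax : dom A (P n x) by rewrite domA; exact: (spectral_dom_atom dotE BP mid).
  have Ex : A (P n x) = (mu n)%:C *: P n x.
    apply: (diag_ext dotE dP) => m; rewrite Aid// (diagZ dP) (diag_orth dP).
    by case: eqP => [->//|_]; rewrite !scaler0.
  have x2 : 0 < <[P n x, P n x]> by rewrite lt_def (rdot_eq0 dotE) xn (rdot_ge0 dotE).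
  (* On an eigenvector coercivity reads 1 <= a0 sqrt(mu_n); squaring it back to a bound on mu_n
     needs the sign of mu_n, which positivity of [A] provides. *)
  have mu0 : 0 <= mu n.
    have := HApos _ Ax; rewrite Ex lecE => /andP[_].
    by rewrite -[complex.Re (dot _ _)]/(<[_, _]>) rdotZl /= pmulr_lge0.
  have Vx : dom (oppow dot A 2^-1) (P n x).
    by rewrite opE; exact: (spectral_dom_atom dotE BP (mpow _)).
  have := coer _ Vx.
  have -> : oppow dot A 2^-1 (P n x) = (mu n `^ 2^-1)%:C *: P n x.
    apply: (diag_ext dotE dP) => m; rewrite opE.
    rewrite opE in Vx.
    rewrite [LHS](spectral_integral_atom dotE BP (mpow _) m Vx).
    rewrite (diagZ dP) -/(P m _) (diag_orth dP).
    by case: eqP => [->//|_]; rewrite !scaler0.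
  rewrite hnormZr ger0_norm ?powR_ge0// powR12_sqrt//.
  set t := Num.sqrt (mu n) => h.
  have x1 : 0 < hnorm (P n x) by rewrite lt_def hnorm_ge0 hnorm_eq0 xn.
  have h1 : 1 <= a0 * t by rewrite -(ler_pM2r x1) mul1r -mulrA.
  rewrite -(sqr_sqrtr mu0) -/t -(mul1r (a0 ^+ 2)^-1) ler_pdivrMr//.
  have t0 : 0 <= t by exact: sqrtr_ge0.
  by rewrite mulrC -exprMn -(expr1n _ 2) lerXn2r ?nnegrE ?mulr_ge0// ltW.
exists P, mu, m0; split => //.
- by move=> s x; rewrite opE; exact: (spectral_domP dotE BP (mpow s)).
- move=> s x n; rewrite opE => xs.
  exact: (spectral_integral_atom dotE BP (mpow s)).
(* If all eigenvalues with a nonzero eigenspace were at most M, Parseval's identity would bound [A]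
   by |M|. *)
move=> M; apply/not_existsP => h; apply: HAunb; exists `|M| => x Ax.
have muM n : P n x = 0 \/ `|mu n| <= `|M|.
  have [|/eqP xn] := eqVneq (P n x) 0; [by left|right].
  rewrite ger0_norm ?(le_trans (ltW m00))//; apply: le_trans (ler_norm _).
  by rewrite leNgt; apply/negP => nM; apply: (h n); exists x; split=> //; exact/eqP.
rewrite -(@ler_pXn2r _ 2)// ?nnegrE ?mulr_ge0 ?hnorm_ge0// exprMn !hnorm_sqr.
apply: (cvgr_to_le (@diag_parseval _ _ _ _ dP (A x))); apply: nearW => n.
apply: le_trans (ler_wpM2l (sqr_ge0 _) (diag_bessel dotE dP n x)).
rewrite mulr_sumr; apply: ler_sum => i _; rewrite Aid// rdotZl rdotZr mulrA -expr2.
have [->|hM] := muM i; first by rewrite rdot0l !mulr0.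
by rewrite ler_wpM2r ?(rdot_ge0 dotE)// -real_normK ?num_real// lerXn2r ?nnegrE.
Qed.
End Diagonalization.

(** * The system on one eigenspace *)

Section Block.
Variables (R : realType) (H : completeNormedModType R[i]).
Variable dot : {dot H for Num.conj}.
Hypothesis dotE : forall x : H, `|x| ^+ 2 = dot x x.
Local Notation "<[ x , y ]>" := (rdot dot x y).
Local Notation quad := (H * H * H * H)%type.
Variables (a b : R).
Hypotheses (a0 : 0 < a) (b0 : 0 < b) (ab : a != b).
Implicit Types (x y u v w z : H) (X Y : quad).

Definition ip4 X Y : R :=
  let: (u, v, w, z) := X in let: (u', v', w', z') := Y in
  a * <[u, u']> + <[v, v']> + b * <[w, w']> + <[z, z']>.

(* The generator restricted to an eigenspace of A, in the variables
   (sqrt mu u, v, sqrt mu w, z), with g = sqrt mu and d = gamma mu^theta. *)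
Definition blk (g d : R) X : quad :=
  let: (u, v, w, z) := X in
  (g%:C *: v, - ((a * g)%:C *: u + d%:C *: (v + z)),
   g%:C *: z, - ((b * g)%:C *: w + d%:C *: (v + z))).

(* The damping only acts on v + z. Since a != b, the cross terms with weights
   k1, k2, k3 successively recover au + bw, av + bz and the total energy. *)
Definition lyap (k1 k2 k3 r : R) X Y : R :=
  let: (u, v, w, z) := X in let: (u', v', w', z') := Y in
  ip4 X Y
  + k1 * (<[v + z, a%:C *: u' + b%:C *: w']> + <[v' + z', a%:C *: u + b%:C *: w]>)
  - k2 * (<[a%:C *: u + b%:C *: w, a%:C *: v' + b%:C *: z']> +
          <[a%:C *: u' + b%:C *: w', a%:C *: v + b%:C *: z]>)
  + k3 * (<[u, v']> + <[u', v]> + <[w, z']> + <[w', z]> + r * <[u + w, u' + w']>).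

Local Notation rdotE := (rdotDl, rdotDr, rdotNl, rdotNr, rdotZl, rdotZr).

(** This is where a != b acts: v + z and y2 = a v + b z determine v and z, because (a - b) v = y2 -
    b (v + z) and (a - b) z = a (v + z) - y2. The remaining bounds are elementary; [K] is the
    kinetic and [T] the potential energy. *)
Lemma gram_bounds : exists2 C : R, 1 <= C & forall u v w z,
  let K := <[v, v]> + <[z, z]> in
  let T := a * <[u, u]> + b * <[w, w]> in
  let y1 := a%:C *: u + b%:C *: w in
  let y2 := a%:C *: v + b%:C *: z in
  let y3 := (a ^+ 2)%:C *: u + (b ^+ 2)%:C *: w in
  [/\ K <= C * (<[v + z, v + z]> + <[y2, y2]>), <[y3, y3]> <= C * T,
      <[y1, y1]> <= C * T, <[u + w, u + w]> <= C * T
    & [/\ <[u, u]> + <[w, w]> <= C * T, <[v + z, v + z]> <= C * K,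
          <[y2, y2]> <= C * K & a + b <= C]].
Proof.
have ab2 : 0 < (a - b) ^+ 2 by rewrite exprn_even_gt0//= subr_eq0.
pose c1 := (4 + 2 * a ^+ 2 + 2 * b ^+ 2) / (a - b) ^+ 2.
have c10 : 0 <= c1 by rewrite divr_ge0 ?ltW//; nra.
pose c2 := 2 * (a^-1 + b^-1).
have c20 : 0 <= c2 by rewrite mulr_ge0// addr_ge0// invr_ge0 ltW.
pose c3 := 2 * (a ^+ 2 + b ^+ 2).
have c30 : 0 <= c3 by rewrite /c3; nra.
pose c4 := 2 * (a ^+ 3 + b ^+ 3).
have c40 : 0 <= c4 by rewrite mulr_ge0// addr_ge0// exprn_ge0// ltW.
pose c5 := 2 * (a + b).
have c50 : 0 <= c5 by rewrite mulr_ge0// addr_ge0// ltW.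
exists (2 + c1 + c2 + c3 + c4 + c5); first lra.
have young x y : <[x + y, x + y]> <= 2 * (<[x, x]> + <[y, y]>).
  by have := rdot_ge0 dotE (x - y); rewrite !rdotE (rdotC _ y x); lra.
have weak c t : 0 <= t -> c <= 2 + c1 + c2 + c3 + c4 + c5 ->
  c * t <= (2 + c1 + c2 + c3 + c4 + c5) * t by move=> t0 h; rewrite ler_wpM2r.
move=> u v w z K T y1 y2 y3.
have [[[uu ww] vv] zz] := (rdot_ge0 dotE u, rdot_ge0 dotE w, rdot_ge0 dotE v, rdot_ge0 dotE z).
have K0 : 0 <= K by rewrite addr_ge0.
have T0 : 0 <= T by rewrite addr_ge0// mulr_ge0// ltW.
have uw : 2 * (<[u, u]> + <[w, w]>) <= c2 * T.
  have -> : c2 * T = 2 * (<[u, u]> + <[w, w]>) + 2 * (a / b * <[u, u]> + b / a * <[w, w]>).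
    by rewrite /c2 /T; field; rewrite !gt_eqF.
  by rewrite lerDl mulr_ge0// addr_ge0// mulr_ge0// divr_ge0// ltW.
have aa : 0 <= a ^+ 2 by rewrite sqr_ge0.
have bb : 0 <= b ^+ 2 by rewrite sqr_ge0.
split; [| | | |split].
- apply: le_trans (weak c1 _ _ _); [|by rewrite addr_ge0// rdot_ge0|lra].
  rewrite /c1 mulrAC ler_pdivlMr//.
  have youngB x y : <[x - y, x - y]> <= 2 * (<[x, x]> + <[y, y]>).
    by have := young x (- y); rewrite (rdotNl dot y) (rdotNr dot y) opprK.
  have hv := youngB y2 (b%:C *: (v + z)).
  have hz := youngB (a%:C *: (v + z)) y2.
  have pp := rdot_ge0 dotE (v + z); have yy := rdot_ge0 dotE y2.
  have Ev : y2 - b%:C *: (v + z) = (a - b)%:C *: v.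
    by rewrite /y2 scalerDr opprD addrACA subrr addr0 -scalerBl -rmorphB.
  have Ez : a%:C *: (v + z) - y2 = (a - b)%:C *: z.
    by rewrite /y2 scalerDr opprD addrACA subrr add0r -scalerBl -rmorphB.
  rewrite Ev !rdotZl !rdotZr in hv; rewrite Ez !rdotZl !rdotZr in hz.
  move: pp yy hv hz; rewrite /K; move: <[v + z, v + z]> <[y2, y2]> => p y; nra.
- apply: le_trans (weak c4 _ _ _) => //; [|lra].
  apply: le_trans (young _ _) _; rewrite !rdotZl !rdotZr /c4 /T.
  have : 0 <= a ^+ 3 * (b * <[w, w]>) by rewrite mulr_ge0 ?exprn_ge0 ?mulr_ge0// ltW.
  have : 0 <= b ^+ 3 * (a * <[u, u]>) by rewrite mulr_ge0 ?exprn_ge0 ?mulr_ge0// ltW.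
  have -> : a ^+ 2 * (a ^+ 2 * <[u, u]>) = a ^+ 3 * (a * <[u, u]>) by ring.
  have -> : b ^+ 2 * (b ^+ 2 * <[w, w]>) = b ^+ 3 * (b * <[w, w]>) by ring.
  lra.
- apply: le_trans (weak c5 _ _ _) => //; [|lra].
  apply: le_trans (young _ _) _; rewrite !rdotZl !rdotZr /c5 /T.
  have : 0 <= a * (b * <[w, w]>) by rewrite !mulr_ge0// ltW.
  have : 0 <= b * (a * <[u, u]>) by rewrite !mulr_ge0// ltW.
  lra.
- apply: le_trans (weak c2 _ _ _) => //; [|lra].
  exact: le_trans (young _ _) uw.
- apply: le_trans (weak c2 _ _ _) => //; [|lra].
  by apply: le_trans uw; lra.
- by apply: le_trans (weak 2 _ _ _); [exact: young|exact: K0|lra].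
- apply: le_trans (weak c3 _ _ _) => //; [|lra].
  apply: le_trans (young _ _) _; rewrite !rdotZl !rdotZr /c3 /K; nra.
- by have := a0; have := b0; rewrite /c5; lra.
Qed.
End Block.

(** * Choice of the weights in the perturbed energy *)

Section Lyapunov.
Variable R : realType.

(** The scalar core of the dissipation estimate. With p = v + z, y1 = a u + b w, y2 = a v + b z and
    y3 = a^2 u + b^2 w, the variables stand for P = |p|^2, E1 = |y1|^2, E2 = |y2|^2, YY = |y3|^2, pY
    = (p, y1), py = (p, y2), Y3 = (y1, y3) and s = a + b.

    Absorbing the cross terms requires k1^2 << k2, k2^2 << k1 k3 and k3 << k2; the exponents 4, 6, 7
    of the small number [kap] satisfy this, as 8 > 6, 12 > 11 and 7 > 6. The factor [c] compensates
    the ratio of [g] and [d] in either direction, and kap C <= 1/8 absorbs the constant of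
    [gram_bounds]. *)
Lemma lyapunov_weights (C kap c g d P E1 E2 T K YY pY py Y3 s k1 k2 k3 : R) :
  k1 = kap ^+ 4 * c -> k2 = kap ^+ 6 * c -> k3 = kap ^+ 7 * c ->
  0 < c -> 0 < g -> 0 < d -> c <= 1 -> c * d <= g -> c * g <= d ->
  1 <= C -> 0 < kap -> kap * C <= 8^-1 -> 0 <= s -> s <= C ->
  0 <= P -> 0 <= E1 -> 0 <= E2 -> 0 <= T -> 0 <= K ->
  K <= C * (P + E2) -> YY <= C * T ->
  (forall t, 0 < t -> `|pY| <= (t * P + t^-1 * E1) / 2) ->
  (forall t, 0 < t -> `|py| <= (t * P + t^-1 * E2) / 2) ->
  (forall t, 0 < t -> `|Y3| <= (t * E1 + t^-1 * YY) / 2) ->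
  - d * P + k1 * (- g * E1 - 2 * d * pY + g * py)
  + k2 * (- g * E2 + g * Y3 + s * d * pY) + k3 * (g * K - g * T)
  <= - kap ^+ 8 * c * g * (K + T).
Proof.
move=> k1E k2E k3E c0 g0 d0 c1 cd cg C1 kap0 kapC s0 sC P0 E10 E20 T0 K0 KC YC hpY hpy hY3.
have kap1 : kap <= 8^-1.
  by apply: le_trans kapC; rewrite -[leLHS]mulr1 ler_wpM2l// ltW.
have kn n : 0 < kap ^+ n by rewrite exprn_gt0.
have k10 : 0 < k1 by rewrite k1E mulr_gt0.
have k20 : 0 < k2 by rewrite k2E mulr_gt0.
have k30 : 0 < k3 by rewrite k3E mulr_gt0.
have cgd : c * g * c * g <= c * g * d by rewrite -mulrA ler_wpM2l// mulr_ge0// ltW.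
have kexp n : kap ^+ n.+1 <= 8^-1 * kap ^+ n.
  by rewrite exprS ler_wpM2r// ltW.
have kle1 n : kap ^+ n <= 1 by rewrite exprn_ile1// ?ltW//; lra.
(* Young's inequality for each of the four cross terms *)
have A : - (2 * k1 * d * pY) <= d * P / 8 + k1 * g * E1 / 8.
  have t0 : 0 < (8 * k1)^-1 by rewrite invr_gt0 mulr_gt0.
  have kz : 0 <= 2 * k1 * d by rewrite !mulr_ge0// ltW.
  have := ler_wpM2l kz (hpY _ t0); rewrite invrK.
  have -> : 2 * k1 * d * (((8 * k1)^-1 * P + 8 * k1 * E1) / 2) =
     d * P / 8 + 8 * k1 * d * k1 * E1 by field; rewrite gt_eqF.
  have h : 8 * k1 * d * k1 * E1 <= k1 * g * E1 / 8.
    have -> : 8 * k1 * d * k1 * E1 = (8 * (kap ^+ 4)) * ((c * d) * (k1 * E1)).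
      by rewrite k1E; ring.
    have h1 : 8 * kap ^+ 4 <= 8^-1.
      have := kexp 3%N; have := kexp 2%N; have := kexp 1%N; have := kexp 0%N.
      by rewrite expr0; lra.
    have h2 : c * d * (k1 * E1) <= g * (k1 * E1) by rewrite ler_wpM2r// mulr_ge0// ltW.
    have h3 : 0 <= g * (k1 * E1) by rewrite !mulr_ge0// ltW.
    have h4 : 0 <= c * d * (k1 * E1) by rewrite !mulr_ge0// ltW.
    have -> : k1 * g * E1 / 8 = 8^-1 * (g * (k1 * E1)) by field.
    by apply: ler_pM => //; rewrite mulr_ge0// ltW.
  have h5 : - (2 * k1 * d * pY) <= 2 * k1 * d * `|pY|.
    by rewrite -mulrN ler_wpM2l ?ler_normr ?lexx ?orbT// !mulr_ge0// ltW.
  by move=> h6; apply: le_trans h5 (le_trans h6 _); rewrite lerD2l.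
have B : k1 * g * py <= d * P / 8 + k2 * g * E2 / 8.
  have t0 : 0 < d / (4 * k1 * g) by rewrite divr_gt0// !mulr_gt0.
  have kz : 0 <= k1 * g by rewrite !mulr_ge0// ltW.
  have := ler_wpM2l kz (hpy _ t0); rewrite invf_div.
  have -> : k1 * g * ((d / (4 * k1 * g) * P + 4 * k1 * g / d * E2) / 2) =
     d * P / 8 + 2 * k1 * g * k1 * g / d * E2 by field; rewrite !gt_eqF.
  have h : 2 * k1 * g * k1 * g / d * E2 <= k2 * g * E2 / 8.
    rewrite mulrAC ler_pdivrMr//.
    have -> : 2 * k1 * g * k1 * g * E2 = 2 * kap ^+ 2 * kap ^+ 6 * E2 * (c * g * c * g).
      by rewrite k1E; ring.
    have -> : k2 * g * E2 / 8 * d = 8^-1 * kap ^+ 6 * E2 * (c * g * d).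
      by rewrite k2E; field.
    have h1 : 2 * kap ^+ 2 <= 8^-1.
      by have := kexp 1%N; have := kexp 0%N; rewrite expr0; lra.
    apply: ler_pM => //.
    - by rewrite mulr_ge0// mulr_ge0 ?mulr_ge0// ltW.
    - by rewrite !mulr_ge0// ltW.
    - by rewrite ler_wpM2r// ler_wpM2r// ltW.
  have h5 : k1 * g * py <= k1 * g * `|py|.
    by rewrite ler_wpM2l ?ler_norm// mulr_ge0// ltW.
  by move=> h6; apply: le_trans h5 (le_trans h6 _); rewrite lerD2l.
have D : k2 * g * Y3 <= k1 * g * E1 / 4 + k3 * g * T / 8.
  have t0 : 0 < k1 / (2 * k2) by rewrite divr_gt0// mulr_gt0.
  have kz : 0 <= k2 * g by rewrite !mulr_ge0// ltW.
  have := ler_wpM2l kz (hY3 _ t0); rewrite invf_div.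
  have -> : k2 * g * ((k1 / (2 * k2) * E1 + 2 * k2 / k1 * YY) / 2) =
     k1 * g * E1 / 4 + k2 * k2 / k1 * g * YY by field; rewrite !gt_eqF.
  have h : k2 * k2 / k1 * g * YY <= k3 * g * T / 8.
    have -> : k2 * k2 / k1 = k3 * kap.
      by rewrite k1E k2E k3E; field; rewrite !gt_eqF.
    have -> : k3 * g * T / 8 = k3 * g * (8^-1 * T) by ring.
    rewrite (_ : k3 * kap * g * YY = k3 * g * (kap * YY)); last by ring.
    apply: ler_wpM2l; first by rewrite mulr_ge0// ltW.
    apply: le_trans (_ : kap * (C * T) <= _); first by rewrite ler_wpM2l// ltW.
    by rewrite mulrA ler_wpM2r.
  have h5 : k2 * g * Y3 <= k2 * g * `|Y3|.
    by rewrite ler_wpM2l ?ler_norm// mulr_ge0// ltW.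
  by move=> h6; apply: le_trans h5 (le_trans h6 _); rewrite lerD2l.
have F : s * k2 * d * pY <= d * P / 8 + k1 * g * E1 / 8.
  have [s00|sp] := leP s 0.
    have -> : s = 0 by apply/eqP; rewrite eq_le s00.
    by rewrite !mul0r addr_ge0// !mulr_ge0 ?invr_ge0// ltW.
  have t0 : 0 < (4 * s * k2)^-1 by rewrite invr_gt0 !mulr_gt0.
  have kz : 0 <= s * k2 * d by rewrite !mulr_ge0// ltW.
  have := ler_wpM2l kz (hpY _ t0); rewrite invrK.
  have -> : s * k2 * d * (((4 * s * k2)^-1 * P + 4 * s * k2 * E1) / 2) =
     d * P / 8 + 2 * (s * kap) ^+ 2 * kap ^+ 6 * ((c * d) * (k1 * E1)).
    by rewrite k2E k1E; field; rewrite !gt_eqF.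
  have h : 2 * (s * kap) ^+ 2 * kap ^+ 6 * ((c * d) * (k1 * E1)) <= k1 * g * E1 / 8.
    have sk : s * kap <= 8^-1.
      by apply: le_trans kapC; rewrite mulrC ler_wpM2l// ltW.
    have sk0 : 0 <= s * kap by rewrite mulr_ge0// ltW.
    have h1 : 2 * (s * kap) ^+ 2 * kap ^+ 6 <= 8^-1.
      have h0 : (s * kap) ^+ 2 <= 8^-1 * 8^-1 by rewrite expr2 ler_pM.
      have := kle1 6%N; have := kn 6%N; move: (kap ^+ 6) => x x0 x1.
      have : (s * kap) ^+ 2 * x <= 8^-1 * 8^-1 * 1 by apply: ler_pM; rewrite ?sqr_ge0// ltW.
      rewrite -mulrA; lra.
    have -> : k1 * g * E1 / 8 = 8^-1 * (g * (k1 * E1)) by field.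
    apply: ler_pM => //.
    - by rewrite mulr_ge0 ?mulr_ge0 ?sqr_ge0// ltW.
    - by rewrite !mulr_ge0// ltW.
    - by rewrite ler_wpM2r// mulr_ge0// ltW.
  have h5 : s * k2 * d * pY <= s * k2 * d * `|pY|.
    by rewrite ler_wpM2l ?ler_norm// !mulr_ge0// ltW.
  by move=> h6; apply: le_trans h5 (le_trans h6 _); rewrite lerD2l.
have kC n : kap ^+ n.+1 * C <= 8^-1 * kap ^+ n.
  by rewrite exprSr -mulrA mulrC ler_wpM2r// ltW.
have k3d : k3 * g <= kap ^+ 7 * d.
  by rewrite k3E -mulrA ler_wpM2l// ltW.
have G : k3 * g * K <= d * P / 8 + k2 * g * E2 / 8.
  have kg0 : 0 <= k3 * g by rewrite mulr_ge0// ltW.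
  apply: le_trans (ler_wpM2l kg0 KC) _; rewrite mulrDr mulrDr; apply: lerD.
    rewrite mulrA (_ : d * P / 8 = 8^-1 * d * P); last by field.
    rewrite ler_wpM2r//.
    apply: le_trans (_ : kap ^+ 7 * d * C <= _); first by rewrite ler_wpM2r//; lra.
    rewrite mulrAC; apply: ler_wpM2r; first exact: ltW.
    by apply: le_trans (kC 6%N) _; have := kle1 6%N; lra.
  rewrite mulrA (_ : k2 * g * E2 / 8 = 8^-1 * (k2 * g) * E2); last by field.
  rewrite ler_wpM2r//.
  have -> : k3 * g * C = kap ^+ 7 * C * (c * g) by rewrite k3E; ring.
  have -> : 8^-1 * (k2 * g) = 8^-1 * kap ^+ 6 * (c * g) by rewrite k2E; ring.
  by rewrite ler_wpM2r ?mulr_ge0// ltW.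
(* The surviving terms in P, E2 and T dominate K + T, by gram_bounds. *)
have cg0 : 0 <= c * g by rewrite mulr_ge0// ltW.
have M : kap ^+ 8 * c * g * (K + T) <= d * P / 2 + k2 * g * E2 / 2 + k3 * g * T / 2.
  have -> : kap ^+ 8 * c * g * (K + T) = kap ^+ 8 * (c * g) * K + kap ^+ 8 * (c * g) * T by ring.
  apply: lerD.
    have kg0 : 0 <= kap ^+ 8 * (c * g) by rewrite mulr_ge0// ltW.
    apply: le_trans (ler_wpM2l kg0 KC) _.
    have -> : kap ^+ 8 * (c * g) * (C * (P + E2)) =
      (kap ^+ 8 * C) * (c * g * P) + (kap ^+ 8 * C) * (c * g * E2) by ring.
    have cE : 0 <= c * g * E2 by rewrite mulr_ge0.
    apply: lerD.
      rewrite (_ : d * P / 2 = 2^-1 * (d * P)); last by field.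
      apply: ler_pM.
      - by rewrite mulr_ge0 ?(ltW (kn _))// (le_trans ler01).
      - by rewrite mulr_ge0.
      - by have := kC 7%N; have := kle1 7%N; lra.
      - by rewrite ler_wpM2r.
    rewrite (_ : k2 * g * E2 / 2 = kap ^+ 6 / 2 * (c * g * E2)); last by rewrite k2E; field.
    rewrite ler_wpM2r//; have := kC 7%N; have := kexp 6%N; have := kn 6%N; have := kn 7%N.
    lra.
  rewrite (_ : k3 * g * T / 2 = kap ^+ 7 / 2 * (c * g) * T); last by rewrite k3E; field.
  rewrite ler_wpM2r// ler_wpM2r//; have := kexp 7%N; have := kn 7%N; lra.
have E1g : 0 <= k1 * g * E1 by rewrite !mulr_ge0// ltW.
have Tg : 0 <= k3 * g * T by rewrite !mulr_ge0// ltW.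
have E2g : 0 <= k2 * g * E2 by rewrite !mulr_ge0// ltW.
have dP : 0 <= d * P by rewrite mulr_ge0// ltW.
rewrite !mulNr.
have -> : - (d * P) + k1 * (- (g * E1) - 2 * d * pY + g * py) +
  k2 * (- (g * E2) + g * Y3 + s * d * pY) + k3 * (g * K - g * T) =
  - (d * P) - k1 * g * E1 - k2 * g * E2 - k3 * g * T + - (2 * k1 * d * pY) + k1 * g * py
  + k2 * g * Y3 + s * k2 * d * pY + k3 * g * K by ring.
lra.
Qed.
End Lyapunov.

(** * Dissipation of the perturbed energy on one block *)

Section BlockEnergy.
Variables (R : realType) (H : completeNormedModType R[i]).
Variable dot : {dot H for Num.conj}.
Hypothesis dotE : forall x : H, `|x| ^+ 2 = dot x x.
Local Notation "<[ x , y ]>" := (rdot dot x y).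
Local Notation quad := (H * H * H * H)%type.
Variables (a b : R).
Hypotheses (a0 : 0 < a) (b0 : 0 < b) (ab : a != b).
Implicit Types (x y u v w z : H) (X Y Z : quad).
Local Notation rdotE := (rdotDl, rdotDr, rdotNl, rdotNr, rdotZl, rdotZr).
Local Notation ip4 := (ip4 dot a b).
Local Notation lyap := (lyap dot a b).
Local Notation blk := (blk a b).

Lemma lyapC k1 k2 k3 r X Y : lyap k1 k2 k3 r X Y = lyap k1 k2 k3 r Y X.
Proof.
case: X Y => [[[u v] w] z] [[[u' v'] w'] z'] /=; rewrite !rdotE.
by rewrite !(rdotC _ u') !(rdotC _ v') !(rdotC _ w') !(rdotC _ z'); ring.
Qed.

Lemma lyapDl k1 k2 k3 r X Y Z :
  lyap k1 k2 k3 r (X + Y) Z = lyap k1 k2 k3 r X Z + lyap k1 k2 k3 r Y Z.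
Proof.
case: X Y Z => [[[u v] w] z] [[[u' v'] w'] z'] [[[u1 v1] w1] z1] /=.
by rewrite !rdotE; ring.
Qed.

Lemma lyapZl k1 k2 k3 r (t : R) X Y :
  lyap k1 k2 k3 r (t%:C *: X) Y = t * lyap k1 k2 k3 r X Y.
Proof.
case: X Y => [[[u v] w] z] [[[u' v'] w'] z'] /=.
by rewrite !rdotE; ring.
Qed.

Lemma lyap_i k1 k2 k3 r X : lyap k1 k2 k3 r X ('i *: X) = 0.
Proof.
case: X => [[[u v] w] z] /=; rewrite !rdotE.
rewrite !rdotil !rdot_i0.
have iC x y : <[x, 'i *: y]> = - <[y, 'i *: x]> by rewrite -rdotil rdotC.
by rewrite (iC v u) (iC w u) (iC z u) (iC w v) (iC z w); ring.
Qed.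

Lemma ip4_lyap X Y : ip4 X Y = lyap 0 0 0 0 X Y.
Proof. by case: X Y => [[[u v] w] z] [[[u' v'] w'] z'] /=; ring. Qed.

Lemma ip4_ge0 X : 0 <= ip4 X X.
Proof.
case: X => [[[u v] w] z] /=.
by rewrite !addr_ge0 ?mulr_ge0 ?(rdot_ge0 dotE) ?(ltW a0) ?(ltW b0).
Qed.

Definition damp (g d : R) : R := Num.min 1 (Num.min (g / d) (d / g)).

Lemma damp_props g d : 0 < g -> 0 < d ->
  [/\ 0 < damp g d, damp g d <= 1, damp g d * d <= g & damp g d * g <= d].
Proof.
move=> g0 d0; rewrite /damp; split.
- by rewrite !lt_min ltr01 !divr_gt0.
- by rewrite ge_min lexx.
- by rewrite -ler_pdivlMr// !ge_min lexx orbT.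
- by rewrite -ler_pdivlMr// !ge_min lexx !orbT.
Qed.

(** The last parameter d / g is chosen so that the derivative of (d / g) |u + w|^2 cancels the
    damping contribution -d (u + w, v + z) of the cross terms (u, v) and (w, z). *)
Definition energy (kap g d : R) : quad -> quad -> R :=
  lyap (kap ^+ 4 * damp g d) (kap ^+ 6 * damp g d) (kap ^+ 7 * damp g d) (d / g).

Definition dissipative (kap : R) := forall g d, 0 < g -> 0 < d ->
  [/\ forall X, ip4 X X <= 2 * energy kap g d X X,
      forall X, energy kap g d X X <= 2 * ip4 X X
    & forall X, energy kap g d X (blk g d X) <= - (kap ^+ 8 * damp g d * g) * ip4 X X].

Lemma energy_exists : exists2 kap : R, 0 < kap & dissipative kap.
Proof.
have [C C1 gram] := gram_bounds dotE a0 b0 ab.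
have C0 : 0 < C by exact: lt_le_trans ltr01 C1.
pose kap := (8 * C)^-1.
have kap0 : 0 < kap by rewrite invr_gt0 mulr_gt0.
have kapC : kap * C <= 8^-1.
  by rewrite /kap invfM -mulrA mulVf ?mulr1// gt_eqF.
exists kap => // g d g0 d0; have [c0 c1 cd cg] := damp_props g0 d0.
pose c := damp g d.
have kap1 : kap <= 8^-1.
  by apply: le_trans kapC; rewrite -[leLHS]mulr1 ler_wpM2l// ltW.
have kn n : 0 < kap ^+ n by rewrite exprn_gt0.
have kexp n : kap ^+ n.+1 <= 8^-1 * kap ^+ n by rewrite exprS ler_wpM2r// ltW.
have k4 : 64 * kap ^+ 4 <= 8 * kap.
  by have := kexp 3%N; have := kexp 2%N; have := kexp 1%N; rewrite expr1; lra.
have k46 : kap ^+ 6 <= kap ^+ 4 by have := kexp 5%N; have := kexp 4%N; have := kn 4%N; lra.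
have k47 : kap ^+ 7 <= kap ^+ 4 by have := kexp 6%N; have := kn 6%N; lra.
(* All added terms together are at most half of the energy, so the perturbed energy is equivalent to
   it with constant 2, uniformly in [g] and [d]. *)
have equiv X : `|energy kap g d X X - ip4 X X| <= ip4 X X / 2.
  case: X => [[[u v] w] z]; have [KC YC E1C QC [uwC PC E2C sC]] := gram u v w z.
  rewrite /energy /=.
  set p := v + z in KC PC *; set y1 := a%:C *: u + b%:C *: w in E1C *.
  set y2 := a%:C *: v + b%:C *: z in KC E2C *; set q := u + w in QC *.
  have h1 := rdot_le dotE p y1 ltr01; have h2 := rdot_le dotE y1 y2 ltr01.
  have h3 := rdot_le dotE u v ltr01; have h4 := rdot_le dotE w z ltr01.
  rewrite invr1 !mul1r in h1 h2 h3 h4.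
  have gr x := rdot_ge0 dotE x.
  rewrite -/c.
  set K := <[v, v]> + <[z, z]> in PC E2C.
  set T := a * <[u, u]> + b * <[w, w]> in E1C QC uwC.
  (* The ratio d / g has no uniform bound, but it always comes with the factor [damp], which
     compensates it. *)
  have dg : c * (d / g) <= 1 by rewrite mulrA ler_pdivrMr// mul1r.
  have dg0 : 0 <= c * (d / g) by rewrite mulr_ge0 ?divr_ge0// ltW.
  have -> : a * <[u, u]> + <[v, v]> + b * <[w, w]> + <[z, z]> = K + T by rewrite /K /T; ring.
  set k := kap ^+ 4 in k4 k46 k47 *.
  have k0 : 0 <= k by exact/ltW/kn.
  have small e t s : 0 <= e -> e <= k -> `|t| <= s -> `|e * t| <= k * s.
    by move=> e0 ek ts; rewrite normrM ger0_norm// ler_pM.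
  have b1 : `|k * c * (<[p, y1]> + <[p, y1]>)| <= k * (C * K + C * T).
    apply: small; [by rewrite mulr_ge0// ltW|by rewrite ler_piMr|].
    by apply: le_trans (ler_normD _ _) _; lra.
  have b2 : `|kap ^+ 6 * c * (<[y1, y2]> + <[y1, y2]>)| <= k * (C * K + C * T).
    apply: small; [by rewrite mulr_ge0// ltW| |].
      by apply: le_trans k46; rewrite ler_piMr// ltW.
    by apply: le_trans (ler_normD _ _) _; lra.
  have K0 : 0 <= K by rewrite addr_ge0.
  have T0 : 0 <= T by rewrite addr_ge0// mulr_ge0// ltW.
  have CK : K <= C * K by rewrite ler_peMl.
  have b3 : `|kap ^+ 7 * c * (<[u, v]> + <[u, v]> + <[w, z]> + <[w, z]>)| <= k * (C * K + C * T).
    apply: small; [by rewrite mulr_ge0// ltW| |].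
      by apply: le_trans k47; rewrite ler_piMr// ltW.
    apply: le_trans (_ : 2 * `|<[u, v]>| + 2 * `|<[w, z]>| <= _).
      have -> : <[u, v]> + <[u, v]> + <[w, z]> + <[w, z]> = 2 * <[u, v]> + 2 * <[w, z]>.
        by ring.
      by apply: le_trans (ler_normD _ _) _; rewrite !normrM !normr_nat.
    by move: h3 h4 uwC CK; rewrite /K; clear; lra.
  have b4 : `|kap ^+ 7 * (c * (d / g)) * <[q, q]>| <= k * (C * T).
    apply: small; [by rewrite mulr_ge0// ltW| |by rewrite ger0_norm].
    by apply: le_trans k47; rewrite ler_piMr// ltW.
  have kCb t : 0 <= t -> k * (C * t) <= t / 64.
    move=> t0; rewrite mulrA ler_pdivlMr// mulrAC -[leRHS]mul1r ler_wpM2r//.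
    apply: le_trans (_ : 8 * (kap * C) <= _); last by lra.
    rewrite (_ : k * C * 64 = 64 * k * C); last by ring.
    by rewrite mulrA ler_wpM2r// ltW.
  have := kCb _ K0; have := kCb _ T0; rewrite mulrDr in b1 b2 b3.
  set e := (X in `|X| <= _).
  have -> : e = k * c * (<[p, y1]> + <[p, y1]>) - kap ^+ 6 * c * (<[y1, y2]> + <[y1, y2]>)
     + kap ^+ 7 * c * (<[u, v]> + <[u, v]> + <[w, z]> + <[w, z]>)
     + kap ^+ 7 * (c * (d / g)) * <[q, q]>.
    by rewrite /e; ring.
  move: b1 b2 b3 b4; rewrite !ler_norml.
  by move=> /andP[? ?] /andP[? ?] /andP[? ?] /andP[? ?] ? ?; apply/andP; split; lra.
split=> [X|X|X].
- by have := equiv X; rewrite ler_norml => /andP[]; lra.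
- by have := equiv X; rewrite ler_norml => /andP[]; have := ip4_ge0 X; lra.
case: X => [[[u v] w] z]; have [KC YC E1C QC [uwC PC E2C sC]] := gram u v w z.
set p := v + z in KC PC; set y1 := a%:C *: u + b%:C *: w in E1C.
set y2 := a%:C *: v + b%:C *: z in KC E2C.
set y3 := (a ^+ 2)%:C *: u + (b ^+ 2)%:C *: w in YC.
have s0 : 0 <= a + b by rewrite addr_ge0// ltW.
set K := <[v, v]> + <[z, z]> in KC PC E2C.
set T := a * <[u, u]> + b * <[w, w]> in YC E1C QC uwC.
have K0 : 0 <= K by rewrite addr_ge0// (rdot_ge0 dotE).
have T0 : 0 <= T by rewrite addr_ge0// mulr_ge0 ?(rdot_ge0 dotE)// ltW.
have := @lyapunov_weights R C kap c g d <[p, p]> <[y1, y1]> <[y2, y2]> T K <[y3, y3]>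
  <[p, y1]> <[p, y2]> <[y1, y3]> (a + b) _ _ _ erefl erefl erefl
  c0 g0 d0 c1 cd cg C1 kap0 kapC s0 sC (rdot_ge0 dotE _) (rdot_ge0 dotE _)
  (rdot_ge0 dotE _) T0 K0 KC YC (fun t => @rdot_le _ _ _ dotE t p y1)
    (fun t => @rdot_le _ _ _ dotE t p y2)
  (fun t => @rdot_le _ _ _ dotE t y1 y3).
have -> : - kap ^+ 8 * c * g * (K + T) =
   - (kap ^+ 8 * damp g d * g) * ip4 (u, v, w, z) (u, v, w, z).
  by rewrite /K /T /c /=; ring.
move=> h; apply: le_trans h; rewrite le_eqVlt; apply/orP; left; apply/eqP.
rewrite /energy /= -/c /p /y1 /y2 /y3 /K /T !rdotE.
rewrite (rdotC _ v u) (rdotC _ w u) (rdotC _ z u) (rdotC _ w v) (rdotC _ z v) (rdotC _ z w).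
by field; rewrite gt_eqF.
Qed.
End BlockEnergy.

(** * Inversion and size of one block *)

Section BlockResolvent.
Variables (R : realType) (H : completeNormedModType R[i]).
Variable dot : {dot H for Num.conj}.
Hypothesis dotE : forall x : H, `|x| ^+ 2 = dot x x.
Local Notation "<[ x , y ]>" := (rdot dot x y).
Local Notation quad := (H * H * H * H)%type.
Variables (a b : R).
Hypotheses (a0 : 0 < a) (b0 : 0 < b) (ab : a != b).
Implicit Types (x y u v w z : H) (X Y Z F : quad) (c : R[i]).
Local Notation rdotE := (rdotDl, rdotDr, rdotNl, rdotNr, rdotZl, rdotZr).
Local Notation ip4 := (ip4 dot a b).
Local Notation blk := (blk a b).

Definition quad_map (Q : H -> H) X : quad :=
  let: (u, v, w, z) := X in (Q u, Q v, Q w, Q z).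

(** Components of the solution are kept as formal combinations of the data, so that vector
    identities reduce to identities of coefficients, which [field] decides. *)
Definition lin4 c1 c2 c3 c4 F : H :=
  let: (f1, f2, f3, f4) := F in c1 *: f1 + c2 *: f2 + c3 *: f3 + c4 *: f4.

Lemma lin4D c1 c2 c3 c4 e1 e2 e3 e4 F :
  lin4 c1 c2 c3 c4 F + lin4 e1 e2 e3 e4 F =
  lin4 (c1 + e1) (c2 + e2) (c3 + e3) (c4 + e4) F.
Proof.
by case: F => [[[f1 f2] f3] f4] /=; rewrite !scalerDl addrACA; congr (_ + _);
  rewrite addrACA; congr (_ + _); rewrite addrACA.
Qed.

Lemma lin4Z c c1 c2 c3 c4 F :
  c *: lin4 c1 c2 c3 c4 F = lin4 (c * c1) (c * c2) (c * c3) (c * c4) F.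
Proof. by case: F => [[[f1 f2] f3] f4] /=; rewrite !scalerDr !scalerA. Qed.

Lemma lin4N c1 c2 c3 c4 F :
  - lin4 c1 c2 c3 c4 F = lin4 (- c1) (- c2) (- c3) (- c4) F.
Proof. by rewrite -scaleN1r lin4Z !mulN1r. Qed.

Lemma quad_eta F : F = (lin4 1 0 0 0 F, lin4 0 1 0 0 F, lin4 0 0 1 0 F, lin4 0 0 0 1 F).
Proof.
by case: F => [[[f1 f2] f3] f4]; rewrite /lin4 !scale0r !scale1r ?addr0 ?add0r ?addr0.
Qed.

Lemma lin4_map (Q : H -> H) c1 c2 c3 c4 F :
  (forall (c : R[i]) x y, Q (c *: x + y) = c *: Q x + Q y) ->
  Q (lin4 c1 c2 c3 c4 F) = lin4 c1 c2 c3 c4 (quad_map Q F).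
Proof.
move=> QL; have QD x y : Q (x + y) = Q x + Q y by have := QL 1 x y; rewrite !scale1r.
have Q0 : Q 0 = 0 by apply: (addrI (Q 0)); rewrite -QD !addr0.
have QZ c x : Q (c *: x) = c *: Q x by have := QL c x 0; rewrite !addr0 Q0 addr0.
by case: F => [[[f1 f2] f3] f4] /=; rewrite !QD !QZ.
Qed.

(** Cramer's rule. Eliminating v = (i l u - f1) / g and z = (i l w - f3) / g leaves a 2 x 2 system
    for u and w with matrix rows (al + ka, ka) and (ka, be + ka). Commutation with linear maps [Q]
    is recorded so that the solution stays in the range of [P n] when the data do. *)
Lemma blk_surj (l g d : R) : 0 < g -> 0 < d -> exists S : quad -> quad,
  (forall F, ('i * l%:C) *: S F - blk g d (S F) = F) /\
  forall (Q : H -> H) F, (forall (c : R[i]) x y, Q (c *: x + y) = c *: Q x + Q y) ->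
    quad_map Q (S F) = S (quad_map Q F).
Proof.
move=> g0 d0.
pose il : R[i] := 'i * l%:C; pose G : R[i] := g%:C; pose D : R[i] := d%:C.
pose al : R[i] := (a * g ^+ 2 - l ^+ 2)%:C; pose be : R[i] := (b * g ^+ 2 - l ^+ 2)%:C.
pose ka : R[i] := il * D.
pose De := al * be + ka * (al + be).
(* The real part of the determinant is al be and its imaginary part l d (al + be). For l = 0 the
   former is a b g^4; otherwise both vanish only if al = be = 0, which forces a = b. *)
have De0 : De != 0.
  rewrite /De /ka /il /al /be /D eq_complex /= negb_and -negb_and; apply/negP.
  rewrite !(mul0r, mulr0, mul1r, sub0r, subr0, add0r, addr0, oppr0) => /andP[/eqP h1 /eqP h2].
  have := h2 => /eqP; rewrite !mulf_eq0 => /orP[|/eqP h3].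
    move=> /orP[/eqP l0|]; last by rewrite gt_eqF.
    move: h1; rewrite l0 expr0n/= !subr0 => /eqP.
    by rewrite !mulf_eq0 ?expf_eq0 /= !gt_eqF.
  move: h1 => /eqP; rewrite mulf_eq0 => /orP[] /eqP h4; have {h3} := h3; rewrite h4.
    rewrite add0r => h5; move/eqP: ab; apply.
    by apply: (mulIf (lt0r_neq0 (exprn_gt0 2 g0))); lra.
  rewrite addr0 => h5; move/eqP: ab; apply.
  by apply: (mulIf (lt0r_neq0 (exprn_gt0 2 g0))); lra.
have G0 : G != 0 by rewrite eq_complex /= gt_eqF.
have alE : al = a%:C * G ^+ 2 + il ^+ 2.
  by rewrite /al /il /G exprMn sqr_i mulN1r !(rmorphB, rmorphM, rmorphXn).
have beE : be = b%:C * G ^+ 2 + il ^+ 2.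
  by rewrite /be /il /G exprMn sqr_i mulN1r !(rmorphB, rmorphM, rmorphXn).
pose U := lin4 (((be + ka) * (il + D) - ka * D) / De) ((be + ka) * G / De)
  (((be + ka) * D - ka * (il + D)) / De) (- ka * G / De).
pose W := lin4 (((al + ka) * D - ka * (il + D)) / De) (- ka * G / De)
  (((al + ka) * (il + D) - ka * D) / De) ((al + ka) * G / De).
pose V F := G^-1 *: (il *: U F - lin4 1 0 0 0 F).
pose Z F := G^-1 *: (il *: W F - lin4 0 0 1 0 F).
exists (fun F => (U F, V F, W F, Z F)); split => [F|Q F QL]; last first.
  by rewrite /V /Z /U /W /= !lin4Z !lin4N !lin4D !lin4Z !(lin4_map _ _ _ _ _ QL).
rewrite [RHS]quad_eta /blk -/G -/D -/il.
rewrite [LHS](_ : _ = (il *: U F - G *: V F,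
    il *: V F + ((a * g)%:C *: U F + D *: (V F + Z F)),
    il *: W F - G *: Z F,
    il *: Z F + ((b * g)%:C *: W F + D *: (V F + Z F)))); last first.
  by rewrite -[RHS]/(_, _, _, _); congr (_, _, _, _); rewrite /= opprK.
have -> : (a * g)%:C = a%:C * G by rewrite rmorphM.
have -> : (b * g)%:C = b%:C * G by rewrite rmorphM.
rewrite /V /Z /U /W !(lin4Z, lin4N, lin4D).
have De0' : (a%:C * G ^+ 2 + il ^+ 2) * (b%:C * G ^+ 2 + il ^+ 2) +
  il * D * (a%:C * G ^+ 2 + il ^+ 2 + (b%:C * G ^+ 2 + il ^+ 2)) != 0.
  by rewrite -alE -beE.
rewrite /De /ka alE beE.
congr (_, _, _, _); congr (lin4 _ _ _ _ F); field; rewrite ?G0 ?De0' //.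
Qed.

Lemma ip4_scale_i (l : R) X : ip4 (('i * l%:C) *: X) (('i * l%:C) *: X) = l ^+ 2 * ip4 X X.
Proof.
case: X => [[[u v] w] z] /=.
have E x : <[('i * l%:C) *: x, ('i * l%:C) *: x]> = l ^+ 2 * <[x, x]>.
  by rewrite mulrC -scalerA rdotZl rdotZr rdotii mulrA.
by rewrite !E; ring.
Qed.

Ltac prods_ge0 := by split; repeat (assumption || apply: mulr_ge0).

Lemma ip4_blk_le : exists2 M : R, 0 < M & forall g d X,
  ip4 (blk g d X) (blk g d X) <= M * (g ^+ 2 + d ^+ 2) * ip4 X X.
Proof.
exists (2 * (a + b) + 8); first by rewrite addr_gt0// mulr_gt0// addr_gt0.
move=> g d [[[u v] w] z] /=.
have young x y : <[x + y, x + y]> <= 2 * (<[x, x]> + <[y, y]>).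
  by have := rdot_ge0 dotE (x - y); rewrite !rdotE (rdotC _ y x); lra.
have h1 := young ((a * g)%:C *: u) (d%:C *: (v + z)).
have h2 := young ((b * g)%:C *: w) (d%:C *: (v + z)).
have h3 := young v z.
rewrite !rdotNl !rdotNr !opprK (rdotZl _ g v) (rdotZr _ g v) (rdotZl _ g z) (rdotZr _ g z).
rewrite (rdotZl _ d) (rdotZr _ d) (rdotZl _ _ u) (rdotZr _ _ u) in h1.
rewrite (rdotZl _ d) (rdotZr _ d) (rdotZl _ _ w) (rdotZr _ _ w) in h2.
move: h1 h2 h3; have := rdot_ge0 dotE u; have := rdot_ge0 dotE v.
have := rdot_ge0 dotE w; have := rdot_ge0 dotE z.
set A1 := <[_ + _, _ + _]>; set A2 := <[(b * g)%:C *: w + _, _]>.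
move: A1 A2 => A1 A2.
set pp := <[v + z, v + z]>; move: pp => pp.
move: <[u, u]> <[v, v]> <[w, w]> <[z, z]> => uu vv ww zz z0 w0 v0 u0 h1 h2 h3.
have a0' := ltW a0; have b0' := ltW b0.
have g2 := sqr_ge0 g; have d2 := sqr_ge0 d.
have dp : d ^+ 2 * pp <= d ^+ 2 * (2 * (vv + zz)) by rewrite ler_wpM2l.
have F1 : 0 <= a * (g ^+ 2 * vv) /\ 0 <= b * (g ^+ 2 * vv) by prods_ge0.
have F2 : 0 <= a * (g ^+ 2 * zz) /\ 0 <= b * (g ^+ 2 * zz) by prods_ge0.
have F3 : 0 <= a * (b * (g ^+ 2 * uu)) /\ 0 <= a * (b * (g ^+ 2 * ww)) by prods_ge0.
have F4 : 0 <= g ^+ 2 * (a * uu) /\ 0 <= g ^+ 2 * (b * ww) by prods_ge0.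
have F5 : 0 <= d ^+ 2 * (a * uu) /\ 0 <= d ^+ 2 * (b * ww) by prods_ge0.
have F6 : 0 <= a * (d ^+ 2 * vv) /\ 0 <= b * (d ^+ 2 * vv) by prods_ge0.
have F7 : 0 <= a * (d ^+ 2 * zz) /\ 0 <= b * (d ^+ 2 * zz) by prods_ge0.
have F8 : 0 <= a * (d ^+ 2 * (a * uu)) /\ 0 <= b * (d ^+ 2 * (a * uu)) by prods_ge0.
have F9 : 0 <= a * (d ^+ 2 * (b * ww)) /\ 0 <= b * (d ^+ 2 * (b * ww)) by prods_ge0.
have F0 : 0 <= g ^+ 2 * vv /\ 0 <= g ^+ 2 * zz by split; apply: mulr_ge0.
case: F1 F2 F3 F4 F5 => ? ? [? ?] [? ?] [? ?] [? ?].
case: F6 F7 F8 F9 F0 => ? ? [? ?] [? ?] [? ?] [? ?].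
lra.
Qed.
End BlockResolvent.

(** * Resolvent *)

Section Coordinates.
Variables (R : realType) (H : completeNormedModType R[i]).
Variable dot : {dot H for Num.conj}.
Hypothesis dotE : forall x : H, `|x| ^+ 2 = dot x x.
Local Notation "<[ x , y ]>" := (rdot dot x y).
Local Notation quad := (H * H * H * H)%type.
Local Notation hnorm_sqr := (hnorm_sqr dotE).
Variables (A : operator H) (P : nat -> H -> H) (mu : nat -> R) (m0 : R).
Hypothesis SP : spectrum dot A P mu m0.
Variables (a b gamma theta : R).
Hypotheses (a0 : 0 < a) (b0 : 0 < b) (gamma0 : 0 < gamma) (theta1 : theta <= 1).
Implicit Types (x y u v w z : H) (X Y Z W : quad) (c : R[i]).
Local Notation ip4 := (ip4 dot a b).
Local Notation HH := (energy_space dot A a b).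
Local Notation V := (dom (oppow dot A 2^-1)).
Let dP := spec_diag SP.

Definition freq n : R := Num.sqrt (mu n).
Definition dmp n : R := gamma * mu n `^ theta.

(** The factor [freq] replaces u by its component of [A^{1/2} u], so that the squared energy norm is
    the sum of the [ip4] of the coordinates. *)
Definition coords n Z : quad :=
  let: (u, v, w, z) := Z in
  ((freq n)%:C *: P n u, P n v, (freq n)%:C *: P n w, P n z).

Lemma mu_gt0 n : 0 < mu n.
Proof. exact: lt_le_trans (spec_gt0 SP) (spec_ge SP n). Qed.

Lemma freq_gt0 n : 0 < freq n.
Proof. by rewrite sqrtr_gt0 mu_gt0. Qed.

Lemma freq_sqr n : freq n * freq n = mu n.
Proof. by rewrite -expr2 sqr_sqrtr// ltW// mu_gt0. Qed.

Lemma dmp_gt0 n : 0 < dmp n.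
Proof. by rewrite mulr_gt0// powR_gt0// mu_gt0. Qed.

Lemma powR2_freq n : mu n `^ 2^-1 = freq n.
Proof. by rewrite powR12_sqrt// ltW// mu_gt0. Qed.

Lemma VP u : V u <->
  exists M, forall n, \sum_(i < n) <[(freq i)%:C *: P i u, (freq i)%:C *: P i u]> <= M.
Proof.
split=> [/(spec_dom SP)[M hM]|[M hM]].
  exists M => n; apply: le_trans (hM n); apply: ler_sum => i _.
  by rewrite rdotZl rdotZr mulrA powR2_freq expr2.
apply/(spec_dom SP); exists M => n; apply: le_trans (hM n); apply: ler_sum => i _.
by rewrite rdotZl rdotZr mulrA powR2_freq expr2.
Qed.

Lemma V_cvg u : V u ->
  \sum_(i < n) <[(freq i)%:C *: P i u, (freq i)%:C *: P i u]> @[n --> \oo] -->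
  hnorm (oppow dot A 2^-1 u) ^+ 2.
Proof.
move=> Vu; rewrite hnorm_sqr.
rewrite (_ : (fun n => _) = fun n =>
  \sum_(i < n) <[P i (oppow dot A 2^-1 u), P i (oppow dot A 2^-1 u)]>).
  exact: (diag_parseval dP).
by apply/funext => n; apply: eq_bigr => i _; rewrite (spec_oppow SP)// powR2_freq.
Qed.

Lemma nrm_ge0 Z : 0 <= @nrm R HH Z.
Proof. by case: Z => [[[u v] w] z] /=; rewrite sqrtr_ge0. Qed.

Lemma nrm_cvg Z : @carrier R HH Z ->
  \sum_(i < n) ip4 (coords i Z) (coords i Z) @[n --> \oo] --> @nrm R HH Z ^+ 2.
Proof.
case: Z => [[[u v] w] z] /= [Vu Vw].
rewrite sqr_sqrtr; last first.
  by do ![apply: sqr_ge0 | apply: addr_ge0 | apply: mulr_ge0 | exact: ltW].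
rewrite (_ : (fun n => _) = fun n =>
  a * (\sum_(i < n) <[(freq i)%:C *: P i u, (freq i)%:C *: P i u]>) +
  \sum_(i < n) <[P i v, P i v]> +
  b * (\sum_(i < n) <[(freq i)%:C *: P i w, (freq i)%:C *: P i w]>) +
  \sum_(i < n) <[P i z, P i z]>); last first.
  by apply/funext => n; rewrite !mulr_sumr -!big_split.
rewrite !hnorm_sqr -!hnorm_sqr.
apply: cvgD; last by rewrite hnorm_sqr; exact: (diag_parseval dP).
apply: cvgD; last by apply: cvgMr; exact: V_cvg.
apply: cvgD; first by apply: cvgMr; exact: V_cvg.
by rewrite hnorm_sqr; exact: (diag_parseval dP).
Qed.

Lemma coords_proj n Z : quad_map (P n) (coords n Z) = coords n Z.
Proof.
case: Z => [[[u v] w] z] /=.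
by rewrite !(diagZ dP) !(diag_idem dP).
Qed.

Lemma coords_inj Z W : (forall n, coords n Z = coords n W) -> Z = W.
Proof.
case: Z W => [[[u v] w] z] [[[u' v'] w'] z'] h.
have g0 n : (freq n)%:C != 0 :> R[i].
  by rewrite eq_complex /= eqxx andbT gt_eqF// freq_gt0.
congr (_, _, _, _); apply: (diag_ext dotE dP) => n; have [h1 h2 h3 h4] := h n => //.
  exact: (scalerI (g0 n) h1).
exact: (scalerI (g0 n) h3).
Qed.

Lemma coords_linear n c Z W : coords n (c *: Z + W) = c *: coords n Z + coords n W.
Proof.
case: Z W => [[[u v] w] z] [[[u' v'] w'] z'] /=.
rewrite !(diag_linear dP) !scalerDr !scalerA.
by rewrite -[RHS]/(_, _, _, _) ![in RHS]/= !scalerA ![c * (freq n)%:C]mulrC.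
Qed.

Lemma carrier_linear c Z W : @carrier R HH Z -> @carrier R HH W ->
  @carrier R HH (c *: Z + W).
Proof.
have VL x y : V x -> V y -> V (c *: x + y).
  move=> /VP[M hM] /VP[N hN]; apply/VP.
  exists (2 * ((complex.Re c) ^+ 2 + (complex.Im c) ^+ 2) * M + 2 * N) => n.
  have c0 : 0 <= 2 * ((complex.Re c) ^+ 2 + (complex.Im c) ^+ 2) :> R.
    by rewrite mulr_ge0// addr_ge0// sqr_ge0.
  apply: le_trans (lerD (ler_wpM2l c0 (hM n)) (ler_wpM2l _ (hN n))) => //.
  rewrite !mulr_sumr -big_split /=; apply: ler_sum => i _.
  rewrite (diag_linear dP) scalerDr scalerA mulrC -scalerA.
  set p := _%:C *: P i x; set q := _%:C *: P i y.
  have := rdot_ge0 dotE (c *: p - q).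
  have : <[c *: p, c *: p]> = ((complex.Re c) ^+ 2 + (complex.Im c) ^+ 2) * <[p, p]>.
    have e1 : <[p, c *: p]> = complex.Re c * <[p, p]>.
      by rewrite rdotC rdotZc rdot_i0 mulr0 subr0.
    have e2 : <[p, 'i *: (c *: p)]> = - (complex.Im c * <[p, p]>).
      have e3 : <[p, 'i *: ('i *: p)]> = - <[p, p]>.
        by have := rdotil dot p ('i *: p); rewrite rdotii => ->; rewrite opprK.
      have e4 : <[c *: p, 'i *: p]> = complex.Im c * <[p, p]>.
        by rewrite rdotZc rdot_i0 e3; ring.
      by have := rdotil dot p (c *: p); rewrite [X in X = _]rdotC e4 => ->; rewrite opprK.
    by rewrite rdotZc e1 e2; ring.
  rewrite !(rdotDl, rdotDr, rdotNl, rdotNr) (rdotC _ q) -mulrA => ->; lra.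
case: Z W => [[[u v] w] z] [[[u' v'] w'] z'] /= [? ?] [? ?].
by split; apply: VL.
Qed.

Lemma psum_bound (I : nat -> R) (J : nat -> R) k M : (forall i, I i <= k * J i) ->
  0 <= k -> (forall n, \sum_(i < n) J i <= M) -> forall n, \sum_(i < n) I i <= k * M.
Proof.
move=> IJ k0 JM n; apply: le_trans (ler_wpM2l k0 (JM n)).
by rewrite mulr_sumr; apply: ler_sum => i _.
Qed.

(** Riesz-Fischer in the energy space. Dividing by [freq] is harmless since its square is at least
    m0. *)
Lemma coords_synth (X : nat -> quad) M : (forall n, quad_map (P n) (X n) = X n) ->
  (forall n, \sum_(i < n) ip4 (X i) (X i) <= M) ->
  exists2 Z, @carrier R HH Z & forall n, coords n Z = X n.
Proof.
move=> PX XM.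
pose X1 n := (X n).1.1.1; pose X2 n := (X n).1.1.2.
pose X3 n := (X n).1.2; pose X4 n := (X n).2.
have XE n : X n = (X1 n, X2 n, X3 n, X4 n).
  by rewrite /X1 /X2 /X3 /X4; case: (X n) => [[[]]].
have PXn n : [/\ P n (X1 n) = X1 n, P n (X2 n) = X2 n, P n (X3 n) = X3 n &
    P n (X4 n) = X4 n].
  move: (PX n); rewrite /X1 /X2 /X3 /X4; case: (X n) => [[[x1 x2] x3] x4] /=.
  by case=> -> -> -> ->.
have PX1 n : P n (X1 n) = X1 n by have [] := PXn n.
have PX2 n : P n (X2 n) = X2 n by have [] := PXn n.
have PX3 n : P n (X3 n) = X3 n by have [] := PXn n.
have PX4 n : P n (X4 n) = X4 n by have [] := PXn n.
have ipE n : ip4 (X n) (X n) = a * <[X1 n, X1 n]> + <[X2 n, X2 n]> +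
   b * <[X3 n, X3 n]> + <[X4 n, X4 n]> by rewrite XE.
have g x := rdot_ge0 dotE x.
have ga x : 0 <= a * <[x, x]> by rewrite mulr_ge0// ltW.
have gb x : 0 <= b * <[x, x]> by rewrite mulr_ge0// ltW.
have h1 n : \sum_(i < n) <[X1 i, X1 i]> <= a^-1 * M.
  apply: (@psum_bound (fun i => <[X1 i, X1 i]>) (fun i => ip4 (X i) (X i)) _ _ _ _ XM)
    => [i|]; last by rewrite invr_ge0 ltW.
  rewrite -(ler_pM2l a0) mulrA mulfV ?gt_eqF// mul1r ipE.
  by have := gb (X3 i); have := g (X2 i); have := g (X4 i); lra.
have h3 n : \sum_(i < n) <[X3 i, X3 i]> <= b^-1 * M.
  apply: (@psum_bound (fun i => <[X3 i, X3 i]>) (fun i => ip4 (X i) (X i)) _ _ _ _ XM)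
    => [i|]; last by rewrite invr_ge0 ltW.
  rewrite -(ler_pM2l b0) mulrA mulfV ?gt_eqF// mul1r ipE.
  by have := ga (X1 i); have := g (X2 i); have := g (X4 i); lra.
have h2 n : \sum_(i < n) <[X2 i, X2 i]> <= 1 * M.
  apply: (@psum_bound (fun i => <[X2 i, X2 i]>) (fun i => ip4 (X i) (X i)) _ _ _ _ XM)
    => // i; rewrite mul1r ipE.
  by have := ga (X1 i); have := gb (X3 i); have := g (X4 i); lra.
have h4 n : \sum_(i < n) <[X4 i, X4 i]> <= 1 * M.
  apply: (@psum_bound (fun i => <[X4 i, X4 i]>) (fun i => ip4 (X i) (X i)) _ _ _ _ XM)
    => // i; rewrite mul1r ipE.
  by have := ga (X1 i); have := gb (X3 i); have := g (X2 i); lra.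
have sV (Y : nat -> H) N : (forall n, P n (Y n) = Y n) ->
    (forall n, \sum_(i < n) <[Y i, Y i]> <= N) ->
    exists2 u, V u & forall n, (freq n)%:C *: P n u = Y n.
  move=> PY YN.
  have gE n : (freq n)%:C * ((freq n)^-1)%:C = 1 :> R[i].
    by rewrite -rmorphM mulfV// gt_eqF// freq_gt0.
  have [||u uY] := @diag_synth _ _ _ dotE _ dP (fun n => ((freq n)^-1)%:C *: Y n) (m0^-1 * N).
  - by move=> n; rewrite (diagZ dP) PY.
  - have m00 := spec_gt0 SP.
    apply: (@psum_bound (fun i => <[((freq i)^-1)%:C *: Y i, ((freq i)^-1)%:C *: Y i]>)
      (fun i => <[Y i, Y i]>) _ _ _ _ YN) => [i|]; last by rewrite invr_ge0 ltW.
    rewrite rdotZl rdotZr mulrA -invfM freq_sqr ler_wpM2r//.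
    by rewrite lef_pV2 ?posrE ?mu_gt0// (spec_ge SP).
  have uY' n : (freq n)%:C *: P n u = Y n by rewrite uY scalerA gE scale1r.
  exists u => //; apply/VP; exists N => n.
  by under eq_bigr => i _ do rewrite uY'.
have [u Vu uX] := sV _ _ PX1 h1; have [w Vw wX] := sV _ _ PX3 h3.
have [v vX] := diag_synth dotE dP PX2 h2; have [z zX] := diag_synth dotE dP PX4 h4.
by exists (u, v, w, z) => // n; rewrite /= uX vX wX zX -XE.
Qed.

Lemma dom_oppow_atom s n x : dom (oppow dot A s) (P n x).
Proof.
apply/(spec_dom SP); exists ((mu n `^ s) ^+ 2 * <[P n x, P n x]>) => m.
under eq_bigr => i _ do rewrite (diag_orth dP).
have t0 : 0 <= (mu n `^ s) ^+ 2 * <[P n x, P n x]>.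
  by rewrite mulr_ge0 ?sqr_ge0// (rdot_ge0 dotE).
case: (ltnP n m) => nm; last first.
  by rewrite big1// => i _; case: eqP => [ni|];
    [move: (ltn_ord i); rewrite ni ltnNge nm|rewrite rdot0l mulr0].
rewrite (bigD1 (Ordinal nm))//= eqxx big1 ?addr0// => i.
by rewrite -val_eqE /= => /negPf ->; rewrite rdot0l mulr0.
Qed.

Lemma oppow_atom s n x : oppow dot A s (P n x) = (mu n `^ s)%:C *: P n x.
Proof.
apply: (diag_ext dotE dP) => m; rewrite (spec_oppow SP); last exact: dom_oppow_atom.
rewrite (diagZ dP) (diag_orth dP).
by case: eqP => [->//|_]; rewrite !scaler0.
Qed.

(** Since mu_n / m0 >= 1 and theta <= 1, the power theta of the quotient is at most the quotient.
    Hence V lies in the domain of [A^{theta/2}]. *)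
Lemma powR_mu_le n : mu n `^ theta <= (m0 `^ theta / m0) * mu n.
Proof.
have m00 := spec_gt0 SP; have mm := spec_ge SP n.
set q := mu n / m0.
have q1 : 1 <= q by rewrite ler_pdivlMr// mul1r.
have q0 : 0 <= q by exact: le_trans ler01 q1.
have muE : mu n = m0 * q by rewrite mulrC divfK// gt_eqF.
have -> : m0 `^ theta / m0 * mu n = m0 `^ theta * q by rewrite muE mulrA divfK// gt_eqF.
rewrite muE powRM ?(ltW m00)// ler_wpM2l ?powR_ge0//.
by rewrite -[leRHS]powRr1//; exact: ler_powR.
Qed.

Lemma V_dom_half u : V u -> dom (oppow dot A (theta / 2)) u.
Proof.
move=> /VP[M hM]; apply/(spec_dom SP); exists ((m0 `^ theta / m0) * M).
apply: (@psum_bound (fun i => (mu i `^ (theta / 2)) ^+ 2 * <[P i u, P i u]>)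
   (fun i => <[(freq i)%:C *: P i u, (freq i)%:C *: P i u]>) _ _ _ _ hM)
  => [i|]; last by rewrite divr_ge0 ?powR_ge0// ltW// (spec_gt0 SP).
rewrite rdotZl rdotZr (mulrA (freq i)) freq_sqr mulrA ler_wpM2r ?(rdot_ge0 dotE)//.
apply: le_trans (powR_mu_le i); rewrite expr2 -powRD; last by rewrite (gt_eqF (mu_gt0 i)) implybT.
by rewrite -splitr.
Qed.

Local Notation blk := (blk a b).
Local Notation AA := (system_operator dot A a b gamma theta).
Local Opaque oppow rdot.

Lemma V_i u : V u -> V ('i *: u).
Proof.
move=> /VP[M hM]; apply/VP; exists M => n; apply: le_trans (hM n).
apply: ler_sum => i _; rewrite (diagZ dP) scalerA mulrC -scalerA.
by rewrite rdotii.
Qed.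

Lemma V_add u v : V u -> V v -> V (u + v).
Proof.
move=> Vu Vv.
have := @carrier_linear 1 (u, 0, u, 0) (v, 0, v, 0).
by rewrite /= !scale1r => h; case: h.
Qed.

Lemma oppow_i s u : dom (oppow dot A s) u -> dom (oppow dot A s) ('i *: u) ->
  oppow dot A s ('i *: u) = 'i *: oppow dot A s u.
Proof.
move=> su siu; apply: (diag_ext dotE dP) => n.
rewrite (spec_oppow SP)// (diagZ dP) (diagZ dP) (spec_oppow SP)//.
by rewrite !scalerA mulrC.
Qed.

Lemma rdot_oppow_atom s n u y : dom (oppow dot A s) u ->
  <[oppow dot A s u, oppow dot A s (P n y)]> = mu n `^ s * mu n `^ s * <[P n u, y]>.
Proof.
move=> su.
transitivity <[oppow dot A s u, (mu n `^ s)%:C *: P n y]>.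
  by congr rdot; exact: oppow_atom.
rewrite rdotZr -mulrA; congr (_ * _).
transitivity <[P n (oppow dot A s u), y]>; first exact/esym/(diag_sym dP).
rewrite -rdotZl; congr rdot; exact: (spec_oppow SP).
Qed.

Lemma V_half u : V u -> dom (oppow dot A (theta / 2)) u.
Proof. exact: V_dom_half. Qed.

Definition rforce k u x phi : R :=
  k * <[oppow dot A 2^-1 u, oppow dot A 2^-1 phi]> +
  gamma * <[oppow dot A (theta / 2) x, oppow dot A (theta / 2) phi]>.

Lemma forceE k u x phi : V u -> V x -> V phi ->
  force dot A gamma theta k u x phi =
  rforce k u x phi +i* rforce k u x ('i *: phi).
Proof.
move=> Vu Vx Vphi; rewrite /force /rforce.
rewrite -[LHS]/(k%:C * oppowV' dot A 1 u phi + gamma%:C * oppowV' dot A theta x phi).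
have E s y : dom (oppow dot A s) phi -> dom (oppow dot A s) ('i *: phi) ->
    dot (oppow dot A s y) (oppow dot A s phi) =
    <[oppow dot A s y, oppow dot A s phi]> +i*
    <[oppow dot A s y, oppow dot A s ('i *: phi)]>.
  by move=> s1 s2; rewrite dot_rdot oppow_i.
have Vi := V_i Vphi.
rewrite /oppowV' mul1r (E _ _ Vphi Vi) (E _ _ (V_half Vphi) (V_half Vi)).
move: <[oppow dot A 2^-1 u, oppow dot A 2^-1 phi]>
  <[oppow dot A 2^-1 u, oppow dot A 2^-1 ('i *: phi)]>
  <[oppow dot A (theta / 2) x, oppow dot A (theta / 2) phi]>
  <[oppow dot A (theta / 2) x, oppow dot A (theta / 2) ('i *: phi)]> => p1 p2 p3 p4.
by apply/eqP; rewrite eq_complex /=; apply/andP; split; apply/eqP; ring.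
Qed.

(** Testing the functional on vectors P_n y gives the components of [h]; conversely, polarised
    Parseval sums the components back to any test vector in V. Only real parts are compared, the
    imaginary ones following with ['i *: phi]. *)
Lemma representsP k u x h : V u -> V x ->
  represents dot A (force dot A gamma theta k u x) h <->
  forall n, P n h = (k * mu n)%:C *: P n u + (gamma * mu n `^ theta)%:C *: P n x.
Proof.
move=> Vu Vx.
have tt n : mu n `^ (theta / 2) * mu n `^ (theta / 2) = mu n `^ theta.
  rewrite -powRD; last by rewrite (gt_eqF (mu_gt0 n)) implybT.
  by rewrite -splitr.
have hh n : mu n `^ 2^-1 * mu n `^ 2^-1 = mu n.
  by rewrite powR2_freq freq_sqr.
have step n y : rforce k u x (P n y) =
    <[(k * mu n)%:C *: P n u + (gamma * mu n `^ theta)%:C *: P n x, y]>.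
  transitivity (k * (mu n `^ 2^-1 * mu n `^ 2^-1 * <[P n u, y]>) +
    gamma * (mu n `^ (theta / 2) * mu n `^ (theta / 2) * <[P n x, y]>)).
    congr (_ * _ + _ * _); first exact: rdot_oppow_atom.
    by apply: rdot_oppow_atom; exact: V_half.
  by rewrite rdotDl !rdotZl hh tt !mulrA.
split=> [rep n|hP phi Vphi].
  apply: (rdot_ext dotE) => y; rewrite -step (diag_sym dP).
  have Vy : V (P n y) by exact: dom_oppow_atom.
  by have := rep _ Vy; rewrite forceE// /toV' [RHS]dot_rdot => -[<- _].
have real psi : V psi -> rforce k u x psi = <[h, psi]>.
  move=> Vpsi.
  have c1 : (\sum_(i < n) <[P i h, P i psi]>) @[n --> \oo] --> <[h, psi]>.
    exact: (diag_polar dP).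
  apply: (cvg_unique _ _ c1) => //; rewrite /rforce.
  rewrite (_ : (fun n => _) = fun n =>
    k * (\sum_(i < n) <[P i (oppow dot A 2^-1 u), P i (oppow dot A 2^-1 psi)]>) +
    gamma * (\sum_(i < n) <[P i (oppow dot A (theta / 2) x),
                             P i (oppow dot A (theta / 2) psi)]>)).
    by apply: cvgD; apply: cvgMr; exact: (diag_polar dP).
  apply/funext => n; rewrite !mulr_sumr -big_split /=; apply: eq_bigr => i _.
  symmetry; have e1 := spec_oppow SP i Vu; have e2 := spec_oppow SP i Vpsi.
  have e3 := spec_oppow SP i (V_half Vx); have e4 := spec_oppow SP i (V_half Vpsi).
  transitivity (k * <[(mu i `^ 2^-1)%:C *: P i u, (mu i `^ 2^-1)%:C *: P i psi]> +
    gamma * <[(mu i `^ (theta / 2))%:C *: P i x, (mu i `^ (theta / 2))%:C *: P i psi]>).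
    by congr (_ * _ + _ * _); congr rdot.
  rewrite hP rdotDl !rdotZl !rdotZr -!mulrA.
  have ht := tt i; have hm := hh i; move: ht hm.
  move: (mu i `^ theta) (mu i `^ (theta / 2)) (mu i `^ 2^-1) => t t2 m2 <- <-.
  by ring.
by rewrite forceE// /toV' [RHS]dot_rdot !real//; exact: V_i.
Qed.

(** The bridge between the operator and its blocks: the conditions that the sums in V' lie in H, and
    their values, all become equations between coordinates. Once a square-summable family solves
    these equations, membership in the domain is automatic. *)
Lemma graphP Z W : (dom AA Z /\ AA Z = W) <->
  [/\ @carrier R HH Z, @carrier R HH W
    & forall n, coords n W = blk (freq n) (dmp n) (coords n Z)].
Proof.
case: Z W => [[[u v] w] z] [[[w1 w2] w3] w4].
have g0 n : (freq n)%:C != 0 :> R[i].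
  by rewrite eq_complex /= eqxx andbT gt_eqF// freq_gt0.
have fE k n y : (k * freq n)%:C *: ((freq n)%:C *: P n y) = (k * mu n)%:C *: P n y.
  by rewrite scalerA -rmorphM -mulrA freq_sqr.
split=> [[/= [[Vu Vv Vw Vz] [F1 F2]] [<- <- <- <-]]|[[Vu Vw] [V1 V3] cE]].
  split => // n.
  have Vvz := V_add Vv Vz.
  have ofP k y : V y -> inH dot A (force dot A gamma theta k y (v + z)) ->
      P n (ofV' dot A (force dot A gamma theta k y (v + z))) =
      (k * mu n)%:C *: P n y + (gamma * mu n `^ theta)%:C *: P n (v + z).
    move=> Vy [h hrep]; rewrite /ofV'; case: xgetP => [h' _ hrep'|/(_ h)//].
    by have := (@representsP k y (v + z) h' Vy Vvz).1 hrep'; apply.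
  by rewrite /= !fE !(diagN dP) !ofP// (diagD dP).
have wv : w1 = v.
  apply: (diag_ext dotE dP) => n; have [h1 _ _ _] := cE n.
  exact: (scalerI (g0 n) h1).
have wz : w3 = z.
  apply: (diag_ext dotE dP) => n; have [_ _ h3 _] := cE n.
  exact: (scalerI (g0 n) h3).
subst w1 w3; have Vvz := V_add V1 V3.
have rep k y y' : V y -> (forall n, P n y' = - ((k * freq n)%:C *: ((freq n)%:C *: P n y) +
     (dmp n)%:C *: (P n v + P n z))) ->
     represents dot A (force dot A gamma theta k y (v + z)) (- y').
  move=> Vy yE; apply/(@representsP k y (v + z) _ Vy Vvz) => n.
  by rewrite (diagN dP) yE opprK fE (diagD dP).
have r1 : represents dot A (force dot A gamma theta a u (v + z)) (- w2).
  by apply: rep => // n; have /(congr1 (fun X : quad => X.1.1.2)) := cE n.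
have r2 : represents dot A (force dot A gamma theta b w (v + z)) (- w4).
  by apply: rep => // n; have /(congr1 (fun X : quad => X.2)) := cE n.
have ofE k y h : V y -> represents dot A (force dot A gamma theta k y (v + z)) h ->
    ofV' dot A (force dot A gamma theta k y (v + z)) = h.
  move=> Vy hrep; rewrite /ofV'; case: xgetP => [h' _ hrep'|/(_ h)//].
  apply: (diag_ext dotE dP) => n.
  rewrite ((@representsP k y (v + z) h' Vy Vvz).1 hrep').
  by rewrite ((@representsP k y (v + z) h Vy Vvz).1 hrep).
split; first by split => //=; split; [exists (- w2)|exists (- w4)].
by rewrite /= (ofE _ _ _ Vu r1) (ofE _ _ _ Vw r2) !opprK.
Qed.
End Coordinates.

(** * From block estimates to the resolvent *)

Section Resolvent.
Variables (R : realType) (H : completeNormedModType R[i]).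
Variable dot : {dot H for Num.conj}.
Hypothesis dotE : forall x : H, `|x| ^+ 2 = dot x x.
Local Notation quad := (H * H * H * H)%type.
Variables (A : operator H) (P : nat -> H -> H) (mu : nat -> R) (m0 : R).
Hypothesis SP : spectrum dot A P mu m0.
Variables (a b gamma theta : R).
Hypotheses (a0 : 0 < a) (b0 : 0 < b) (ab : a != b).
Hypotheses (gamma0 : 0 < gamma) (theta1 : theta <= 1).
Implicit Types (X Y Z W F : quad) (c : R[i]) (l : R).
Local Notation ip4 := (ip4 dot a b).
Local Notation blk := (blk a b).
Local Notation HH := (energy_space dot A a b).
Local Notation AA := (system_operator dot A a b gamma theta).
Local Notation freq := (freq mu).
Local Notation dmp := (dmp mu gamma theta).
Local Notation coords := (coords P mu).
Local Notation carrier := (@carrier R HH).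
Local Notation nrm := (@nrm R HH).
Let dP := spec_diag SP.

Lemma blk_linear g d c X Y : blk g d (c *: X + Y) = c *: blk g d X + blk g d Y.
Proof.
case: X Y => [[[u v] w] z] [[[u' v'] w'] z'].
have s (t : R[i]) x y : t *: (c *: x + y) = c *: (t *: x) + t *: y.
  by rewrite scalerDr !scalerA mulrC.
have q (t t' : R[i]) x y x1 y1 x2 y2 :
   - (t *: (c *: x + y) + t' *: ((c *: x1 + y1) + (c *: x2 + y2))) =
   c *: - (t *: x + t' *: (x1 + x2)) - (t *: y + t' *: (y1 + y2)) :> H.
  rewrite (addrACA (c *: x1)) -(scalerDr c x1) !s addrACA -(scalerDr c).
  by rewrite scalerN -opprD.
by congr (_, _, _, _); rewrite /= ?q ?s.
Qed.

Lemma coordsB n X Y : coords n (X - Y) = coords n X - coords n Y.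
Proof.
by rewrite addrC -scaleN1r (coords_linear SP) scaleN1r addrC.
Qed.

Lemma carrier0 : carrier 0.
Proof.
have V0 : dom (oppow dot A 2^-1) 0.
  by rewrite -(diag0 dP 0%N); exact: (dom_oppow_atom dotE SP).
by split.
Qed.

Lemma carrierZD c X Y : carrier X -> carrier Y -> carrier (c *: X + Y).
Proof. exact: (@carrier_linear _ _ _ dotE _ _ _ _ SP a b). Qed.

Lemma carrierB X Y : carrier X -> carrier Y -> carrier (X - Y).
Proof. by move=> cX cY; rewrite addrC -scaleN1r; exact: carrierZD. Qed.

Lemma ip4_eq0 X : ip4 X X <= 0 -> X = 0.
Proof.
case: X => [[[u v] w] z] /= h.
have g x := rdot_ge0 dotE x.
have ga : 0 <= a * rdot dot u u by rewrite mulr_ge0// ltW.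
have gb : 0 <= b * rdot dot w w by rewrite mulr_ge0// ltW.
have /eqP : a * rdot dot u u = 0 by have := g v; have := g z; lra.
rewrite mulf_eq0 (gt_eqF a0) /= (rdot_eq0 dotE) => /eqP ->.
have /eqP : b * rdot dot w w = 0 by have := g v; have := g z; lra.
rewrite mulf_eq0 (gt_eqF b0) /= (rdot_eq0 dotE) => /eqP ->.
have /eqP : rdot dot v v = 0 by have := g v; have := g z; lra.
rewrite (rdot_eq0 dotE) => /eqP ->.
have /eqP : rdot dot z z = 0 by have := g v; have := g z; lra.
by rewrite (rdot_eq0 dotE) => /eqP ->.
Qed.

Lemma nrm_le Z W k : carrier Z -> carrier W -> 0 <= k ->
  (forall n, ip4 (coords n Z) (coords n Z) <= k ^+ 2 * ip4 (coords n W) (coords n W)) ->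
  nrm Z <= k * nrm W.
Proof.
move=> cZ cW k0 h.
have nZ := @nrm_ge0 _ _ dot A a b Z; have nW := @nrm_ge0 _ _ dot A a b W.
rewrite -(@ler_pXn2r _ 2)// ?nnegrE ?mulr_ge0// exprMn.
have cvZ := @nrm_cvg _ _ _ dotE _ _ _ _ SP _ _ a0 b0 Z cZ.
have cvW := @nrm_cvg _ _ _ dotE _ _ _ _ SP _ _ a0 b0 W cW.
apply: (cvgr_to_le cvZ); apply: nearW => n.
have wn := @psum_le _ (fun i => ip4 (coords i W) (coords i W)) _ n
  (fun i => ip4_ge0 dotE a0 b0 _) cvW.
apply: le_trans (ler_wpM2l (sqr_ge0 k) wn).
by rewrite mulr_sumr; apply: ler_sum => i _.
Qed.

Lemma coords_le Z n : carrier Z -> ip4 (coords n Z) (coords n Z) <= nrm Z ^+ 2.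
Proof.
move=> cZ; have cvZ := @nrm_cvg _ _ _ dotE _ _ _ _ SP _ _ a0 b0 Z cZ.
have := @psum_le _ (fun i => ip4 (coords i Z) (coords i Z)) _ n.+1
  (fun i => ip4_ge0 dotE a0 b0 _) cvZ.
apply: le_trans; rewrite big_ord_recr /= lerDr.
by apply: sumr_ge0 => i _; exact: ip4_ge0.
Qed.

Lemma nrm_psum Z n : carrier Z -> \sum_(i < n) ip4 (coords i Z) (coords i Z) <= nrm Z ^+ 2.
Proof.
move=> cZ; have cvZ := @nrm_cvg _ _ _ dotE _ _ _ _ SP _ _ a0 b0 Z cZ.
exact: (@psum_le _ (fun i => ip4 (coords i Z) (coords i Z)) _ n
  (fun i => ip4_ge0 dotE a0 b0 _) cvZ).
Qed.

(** Pair the equation with Y in the perturbed energy form B. The term i l Y drops out, so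
    dissipation gives (rho / 2) B(Y, Y) <= B(Y, F) and Young's inequality yields rho^2 B(Y, Y) <= 4
    B(F, F). The equivalence of B with the energy costs a factor 2 on each side. *)
Lemma block_resolvent_le k g d l Y F : 0 < k -> 0 < g -> 0 < d ->
  (forall X, ip4 X X <= 2 * energy dot a b k g d X X) ->
  (forall X, energy dot a b k g d X X <= 2 * ip4 X X) ->
  (forall X, energy dot a b k g d X (blk g d X) <= - (k ^+ 8 * damp g d * g) * ip4 X X) ->
  ('i * l%:C) *: Y - blk g d Y = F ->
  ip4 Y Y <= (4 / (k ^+ 8 * damp g d * g)) ^+ 2 * ip4 F F.
Proof.
move=> k0 g0 d0 e1 e2 e3 FE.
set rho := k ^+ 8 * damp g d * g.
have rho0 : 0 < rho.
  by have [c0 _ _ _] := damp_props g0 d0; rewrite !mulr_gt0// exprn_gt0.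
pose B := energy dot a b k g d.
have BD X Y' Z : B (X + Y') Z = B X Z + B Y' Z by exact: lyapDl.
have BZ t X Z : B (t%:C *: X) Z = t * B X Z by exact: lyapZl.
have BC X Z : B X Z = B Z X by exact: lyapC.
have BF : B Y F = - B Y (blk g d Y).
  rewrite BC -FE -scaleN1r -(rmorph1 (real_complex R)) -rmorphN BD mulrC -scalerA !BZ.
  by rewrite [B ('i *: Y) _]BC /B /energy lyap_i mulr0 add0r mulN1r lyapC.
have B0 X : 0 <= B X X.
  by have := ip4_ge0 dotE a0 b0 X; have := e1 X; rewrite -/(B X X); lra.
have low : rho / 2 * B Y Y <= B Y F.
  rewrite BF lerNr; apply: le_trans (e3 Y) _; rewrite mulNr lerN2 -/rho.
  by have := e2 Y; rewrite -/(B Y Y) -mulrA ler_pM2l//; lra.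
have up : 2 * rho * B Y F <= rho ^+ 2 / 2 * B Y Y + 2 * B F F.
  have := B0 ((rho / 2)%:C *: Y + (-1)%:C *: F).
  rewrite BD !BZ ![B _ (_ + _)]BC !BD !BZ (BC F Y); lra.
have h : rho ^+ 2 * B Y Y <= 4 * B F F.
  have := ler_wpM2l (ltW rho0) low; rewrite mulrA; lra.
rewrite exprMn exprVn mulrAC ler_pdivlMr ?exprn_gt0//.
have := e2 F; rewrite -/(B F F) => eF.
have := e1 Y; rewrite -/(B Y Y) => eY.
have r2 : 0 <= rho ^+ 2 by rewrite sqr_ge0.
have := ler_wpM2l r2 eY; lra.
Qed.

(** Here the block is small against l: its image of Y takes at most half of l^2 |Y|^2 in |i l Y|^2
    <= 2 |F|^2 + 2 |blk Y|^2 and is absorbed on the left. *)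
Lemma block_resolvent_large M g d l Y F : 0 < M ->
  (forall X, ip4 (blk g d X) (blk g d X) <= M * (g ^+ 2 + d ^+ 2) * ip4 X X) ->
  4 * M * (g ^+ 2 + d ^+ 2) <= l ^+ 2 -> l != 0 ->
  ('i * l%:C) *: Y - blk g d Y = F ->
  ip4 Y Y <= (2 / l) ^+ 2 * ip4 F F.
Proof.
move=> M0 hM hl l0 FE.
have l2 : 0 < l ^+ 2 by rewrite exprn_even_gt0.
have young X Z : ip4 (X + Z) (X + Z) <= 2 * (ip4 X X + ip4 Z Z).
  pose B := lyap dot a b 0 0 0 0.
  have BD X1 Y1 Z1 : B (X1 + Y1) Z1 = B X1 Z1 + B Y1 Z1 by exact: lyapDl.
  have BZ t X1 Z1 : B (t%:C *: X1) Z1 = t * B X1 Z1 by exact: lyapZl.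
  have BC X1 Z1 : B X1 Z1 = B Z1 X1 by exact: lyapC.
  have := ip4_ge0 dotE a0 b0 (X + (-1)%:C *: Z); rewrite !ip4_lyap -/B.
  by rewrite !BD !BZ ![B _ (_ + _)]BC !BD !BZ (BC Z X); lra.
have := ip4_scale_i dot a b l Y.
have -> : ('i * l%:C) *: Y = F + blk g d Y by rewrite -FE subrK.
move=> E; have := young F (blk g d Y); rewrite E => h1.
rewrite exprMn exprVn mulrAC ler_pdivlMr//.
have h2 := hM Y; have h3 := ip4_ge0 dotE a0 b0 Y.
have := ler_wpM2r h3 hl; lra.
Qed.

Lemma resolventE Y l : dom AA Y -> carrier Y /\
  carrier (('i * l%:C) *: Y - AA Y) /\ forall n,
  coords n (('i * l%:C) *: Y - AA Y) =
  ('i * l%:C) *: coords n Y - blk (freq n) (dmp n) (coords n Y).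
Proof.
move=> dY; have [] := (graphP dotE SP a b gamma theta1 Y (AA Y)).1 (conj dY erefl).
move=> cY cAY E; split => //; split.
  rewrite addrC -scaleN1r addrC; apply: carrierZD => //.
  by rewrite scaleN1r -(add0r (- _)); exact: carrierB carrier0 cAY.
by move=> n; rewrite coordsB E -[_ *: Y]addr0 (coords_linear SP) /= !(diag0 dP) !scaler0 addr0.
Qed.

Section Bound.
Variables (l K : R).
Hypothesis K0 : 0 <= K.
Hypothesis block_le : forall n Y F,
  ('i * l%:C) *: Y - blk (freq n) (dmp n) Y = F -> ip4 Y Y <= K ^+ 2 * ip4 F F.

Lemma resolvent_le Y : dom AA Y -> nrm Y <= K * nrm (('i * l%:C) *: Y - AA Y).
Proof.
move=> dY; have [cY [cF E]] := resolventE l dY.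
by apply: nrm_le => // n; exact/block_le/esym/E.
Qed.

(** Each block equation is solved by [blk_surj]; the uniform bound [block_le] makes the solutions
    square-summable, and with zero data it gives uniqueness. *)
Lemma resolvent_surj X : carrier X ->
  exists! Y, dom AA Y /\ ('i * l%:C) *: Y - AA Y = X.
Proof.
move=> cX.
have /choice[S hS] n := blk_surj H a0 b0 ab l (freq_gt0 SP n) (dmp_gt0 SP theta gamma0 n).
pose y n := S n (coords n X).
have yE n : ('i * l%:C) *: y n - blk (freq n) (dmp n) (y n) = coords n X by exact: (hS n).1.
have [||Y cY YE] := @coords_synth _ _ _ dotE _ _ _ _ SP a b a0 b0 y (K ^+ 2 * nrm X ^+ 2).
- by move=> n; rewrite (hS n).2 ?(coords_proj SP)//; exact: (diag_linear dP n).
- apply: (@psum_bound _ (fun i => ip4 (y i) (y i)) (fun i => ip4 (coords i X) (coords i X))).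
  + by move=> n; exact: block_le (yE n).
  + exact: sqr_ge0.
  + by move=> n; exact: nrm_psum.
have cW : carrier (('i * l%:C) *: Y - X).
  by apply: carrierZD => //; rewrite -(add0r (- X)); exact: carrierB carrier0 cX.
have c0 n : coords n 0 = 0 by rewrite /= !(diag0 dP) !scaler0.
have [dY AY] : dom AA Y /\ AA Y = ('i * l%:C) *: Y - X.
  apply/(graphP dotE SP a b gamma theta1); split => // n.
  by rewrite coordsB -[_ *: Y]addr0 (coords_linear SP) c0 addr0 YE -yE opprB addrCA subrr addr0.
exists Y; split; first by split => //; rewrite AY opprB addrCA subrr addr0.
move=> Y' [dY' AY']; have [cY' [_ E']] := resolventE l dY'.
apply: (coords_inj dotE SP) => n; apply/eqP; rewrite -subr_eq0; apply/eqP/ip4_eq0.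
apply: le_trans (block_le (n := n) (F := 0) _) _.
  have bB U W : blk (freq n) (dmp n) (U - W) = blk (freq n) (dmp n) U - blk (freq n) (dmp n) W.
    by rewrite addrC -scaleN1r blk_linear scaleN1r addrC.
  have e1 := yE n; have e2 := E' n; rewrite -YE in e1; rewrite AY' in e2.
  rewrite bB scalerBr -[RHS](subrr (coords n X)) -{1}e1 [in RHS]e2.
  by rewrite !opprD !opprK -!addrA; congr (_ + _); rewrite addrCA.
have -> : ip4 0 0 = 0 by rewrite /= !rdot0l; ring.
by rewrite mulr0.
Qed.

Lemma resolvent_setP : resolvent_set (X := HH) AA ('i * l%:C).
Proof.
by split; [exact: resolvent_surj|exists K; exact: resolvent_le].
Qed.

Lemma resolvent_norm_le : (resolvent_norm (X := HH) AA l <= K%:E)%E.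
Proof.
apply: ge_ereal_sup => _ [X [cX X1] <-]; rewrite lee_fin.
have [Y [[dY YE] _]] := resolvent_surj cX.
rewrite /resolvent; case: xgetP => [Z _ [dZ ZE]|/(_ Y)[]//].
apply: le_trans (resolvent_le dZ) _; rewrite ZE.
by rewrite -[leRHS]mulr1 ler_wpM2l.
Qed.

End Bound.
End Resolvent.

(** * Growth of the decay rates and decay of the resolvent *)

Section Rates.
Variables (R : realType) (H : completeNormedModType R[i]).
Variable dot : {dot H for Num.conj}.
Hypothesis dotE : forall x : H, `|x| ^+ 2 = dot x x.
Local Notation quad := (H * H * H * H)%type.
Variables (A : operator H) (P : nat -> H -> H) (mu : nat -> R) (m0 : R).
Hypothesis SP : spectrum dot A P mu m0.
Variables (a b gamma theta : R).
Hypotheses (a0 : 0 < a) (b0 : 0 < b) (ab : a != b).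
Hypotheses (gamma0 : 0 < gamma) (theta1 : theta <= 1).
Implicit Types (X Y Z W F : quad) (c l : R).
Local Notation ip4 := (ip4 dot a b).
Local Notation blk := (blk a b).
Local Notation HH := (energy_space dot A a b).
Local Notation AA := (system_operator dot A a b gamma theta).
Local Notation freq := (freq mu).
Local Notation dmp := (dmp mu gamma theta).

Definition rate k n : R := k ^+ 8 * damp (freq n) (dmp n) * freq n.

Lemma powR_mu_ge x delta n : delta <= x ->
  m0 `^ (x - delta) * mu n `^ delta <= mu n `^ x.
Proof.
move=> dx; have m00 := spec_gt0 SP; have mn := mu_gt0 SP n.
have -> : mu n `^ x = mu n `^ (x - delta) * mu n `^ delta.
  by rewrite -powRD ?subrK// (gt_eqF mn) implybT.
rewrite ler_wpM2r ?powR_ge0//; apply: ge0_ler_powR; rewrite ?nnegrE ?subr_ge0//.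
- exact: ltW.
- exact: ltW.
- exact: (spec_ge SP).
Qed.

(** Up to constants the rate is the minimum of g, g^2 / d and d, that is, of the powers 1/2, 1 -
    theta and theta of mu_n; the three hypotheses on [delta] and the constants [c1], [c2], [c3]
    correspond to these. *)
Lemma rate_ge k delta : 0 < k -> delta <= 2^-1 -> delta <= theta ->
  delta <= 1 - theta -> exists2 c, 0 < c & forall n, c * mu n `^ delta <= rate k n.
Proof.
move=> k0 d1 d2 d3; have m00 := spec_gt0 SP.
pose c1 := m0 `^ (2^-1 - delta); pose c2 := m0 `^ (1 - theta - delta) / gamma.
pose c3 := gamma * m0 `^ (theta - delta).
have c10 : 0 < c1 by rewrite powR_gt0.
have c20 : 0 < c2 by rewrite divr_gt0// powR_gt0.
have c30 : 0 < c3 by rewrite mulr_gt0// powR_gt0.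
pose c := Num.min c1 (Num.min c2 c3).
have c0 : 0 < c by rewrite !lt_min c10 c20 c30.
exists (k ^+ 8 * c) => [|n]; first by rewrite mulr_gt0// exprn_gt0.
have g0 := freq_gt0 SP n; have dn0 := dmp_gt0 SP theta gamma0 n.
have mn := mu_gt0 SP n.
have p0 : 0 < mu n `^ delta by rewrite powR_gt0.
have k8 : 0 < k ^+ 8 by rewrite exprn_gt0.
rewrite /rate -(mulrA (k ^+ 8) c) -(mulrA (k ^+ 8) (damp _ _)) (ler_pM2l k8).
rewrite -(ler_pdivrMr _ _ g0) /damp !le_min.
have h1 : c * mu n `^ delta <= freq n.
  rewrite -(powR2_freq SP); apply: le_trans (powR_mu_ge n d1).
  by rewrite ler_pM2r// ge_min lexx.
have h2 : c * mu n `^ delta * dmp n <= freq n * freq n.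
  rewrite (freq_sqr SP) /dmp -[leRHS](powRr1 (ltW mn)).
  have -> : mu n `^ 1 = mu n `^ (1 - theta) * mu n `^ theta.
    by rewrite -powRD ?subrK// (gt_eqF mn) implybT.
  rewrite mulrA ler_wpM2r ?powR_ge0//.
  apply: le_trans (powR_mu_ge n d3); rewrite mulrAC ler_wpM2r ?(ltW p0)//.
  by rewrite -ler_pdivlMr// !ge_min lexx orbT.
have h3 : c * mu n `^ delta <= dmp n.
  apply: le_trans (ler_wpM2l (ltW gamma0) (powR_mu_ge n d2)).
  by rewrite mulrA ler_wpM2r ?(ltW p0)// !ge_min lexx !orbT.
apply/and3P; split.
- by rewrite ler_pdivrMr// mul1r.
- by rewrite ler_pdivrMr// mulrAC ler_pdivlMr.
- by rewrite ler_wpM2r// invr_ge0 ltW.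
Qed.

Lemma speed_le : exists2 C, 0 < C & forall n, freq n ^+ 2 + dmp n ^+ 2 <= C * mu n ^+ 2.
Proof.
have m00 := spec_gt0 SP; pose q := m0 `^ theta / m0.
exists (m0^-1 + gamma ^+ 2 * q ^+ 2) => [|n].
  by rewrite ltr_wpDr ?invr_gt0// mulr_ge0// sqr_ge0.
have mn := mu_gt0 SP n; rewrite mulrDl; apply: lerD.
  rewrite expr2 (freq_sqr SP) mulrC ler_pdivlMr// expr2 ler_pM2l//.
  exact: (spec_ge SP).
have -> : gamma ^+ 2 * q ^+ 2 * mu n ^+ 2 = (gamma * (q * mu n)) ^+ 2 by ring.
have q0 : 0 <= q by rewrite divr_ge0 ?powR_ge0// ltW.
have qm : 0 <= gamma * (q * mu n).
  by apply: mulr_ge0; [exact: ltW|apply: mulr_ge0 => //; exact: ltW].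
rewrite lerXn2r ?nnegrE ?(ltW (dmp_gt0 SP theta gamma0 n))//.
by rewrite /dmp ler_wpM2l ?(ltW gamma0)//; exact: (powR_mu_le SP theta1).
Qed.

Lemma resolvent_all c l k : 0 < c -> 0 < k ->
  dissipative dot a b k ->
  (forall n, c <= rate k n) -> resolvent_set (X := HH) AA ('i * l%:C).
Proof.
move=> c0 k0 en cr.
apply: (@resolvent_setP _ _ _ dotE _ _ _ _ SP a b gamma theta a0 b0 ab gamma0 theta1 l (4 / c)).
  by rewrite divr_ge0// ltW.
move=> n Y F YF; have g0 := freq_gt0 SP n; have d0 := dmp_gt0 SP theta gamma0 n.
have [e1 e2 e3] := en _ _ g0 d0.
apply: le_trans (block_resolvent_le dotE a0 b0 k0 g0 d0 e1 e2 e3 YF) _.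
have r0 : 0 < rate k n by exact: lt_le_trans (cr n).
rewrite ler_wpM2r ?(ip4_ge0 dotE a0 b0)// -/(rate k n).
rewrite lerXn2r ?nnegrE ?divr_ge0// ?(ltW r0) ?(ltW c0)//.
by rewrite ler_pM2l// lef_pV2 ?posrE.
Qed.

Lemma resolvent_decay k delta : 0 < k ->
  dissipative dot a b k ->
  0 < delta -> delta <= 2^-1 -> delta <= theta -> delta <= 1 - theta ->
  exists2 C, 0 < C & forall l, 1 <= `|l| ->
    (resolvent_norm (X := HH) AA l <= (C / `|l| `^ delta)%:E)%E.
Proof.
move=> k0 en d0 d1 d2 d3; have [c c0 cr] := rate_ge k0 d1 d2 d3.
have [M M0 hM] := ip4_blk_le dotE a0 b0; have [C1 C10 hC] := speed_le.
(* The border between the regimes: for |l| >= s mu_n the hypothesis of [block_resolvent_large]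
   holds; for |l| < s mu_n the bound 4 / rate is at most a multiple of mu_n^(-delta), hence of
   |l|^(-delta). *)
pose s := Num.sqrt (4 * M * C1).
have s0 : 0 < s by rewrite sqrtr_gt0 !mulr_gt0.
have s2 : s ^+ 2 = 4 * M * C1 by rewrite sqr_sqrtr// ltW// !mulr_gt0.
have sd0 : 0 < s `^ delta by rewrite powR_gt0.
pose C := 2 + 4 / c * s `^ delta.
have C0 : 0 < C by rewrite addr_gt0// mulr_gt0// divr_gt0.
exists C => // l l1.
have l0 : 0 < `|l| by exact: lt_le_trans l1.
have ln0 : l != 0 by rewrite -normr_gt0.
have ld0 : 0 < `|l| `^ delta by rewrite powR_gt0.
apply: (@resolvent_norm_le _ _ _ dotE _ _ _ _ SP a b gamma theta a0 b0 ab gamma0 theta1).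
  by rewrite divr_ge0// ltW.
move=> n Y F YF; have g0 := freq_gt0 SP n; have dn0 := dmp_gt0 SP theta gamma0 n.
have mn := mu_gt0 SP n.
have [big|small] := leP (s * mu n) `|l|.
  have hl : 4 * M * (freq n ^+ 2 + dmp n ^+ 2) <= l ^+ 2.
    rewrite -(real_normK (num_real l)); apply: le_trans (_ : (s * mu n) ^+ 2 <= _).
      have -> : (s * mu n) ^+ 2 = 4 * M * (C1 * mu n ^+ 2) by rewrite mulrA -s2; ring.
      by rewrite ler_pM2l ?mulr_gt0.
    by rewrite lerXn2r ?nnegrE ?mulr_ge0// ltW.
  apply: le_trans (block_resolvent_large dotE a0 b0 M0 (hM _ _) hl ln0 YF) _.
  rewrite ler_wpM2r ?(ip4_ge0 dotE a0 b0)//.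
  rewrite -(real_normK (num_real (2 / l))) normrM normfV normr_nat.
  rewrite lerXn2r ?nnegrE ?divr_ge0 ?(ltW C0) ?(ltW ld0)//.
  apply: ler_pM => //.
    by rewrite /C lerDl mulr_ge0 ?divr_ge0// ltW.
  rewrite lef_pV2 ?posrE// -[leRHS]powRr1 ?(ltW l0)//.
  by apply: ler_powR => //; lra.
have [e1 e2 e3] := en _ _ g0 dn0.
apply: le_trans (block_resolvent_le dotE a0 b0 k0 g0 dn0 e1 e2 e3 YF) _.
have p0 : 0 < mu n `^ delta by rewrite powR_gt0.
have r0 : 0 < rate k n by apply: lt_le_trans (cr n); rewrite mulr_gt0.
rewrite ler_wpM2r ?(ip4_ge0 dotE a0 b0)// -/(rate k n).
rewrite lerXn2r ?nnegrE ?divr_ge0// ?(ltW r0) ?(ltW C0) ?(ltW ld0)//.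
apply: le_trans (_ : 4 / c * s `^ delta / `|l| `^ delta <= _); last first.
  by rewrite ler_pM2r ?invr_gt0// lerDr.
rewrite ler_pdivrMr// mulrAC ler_pdivlMr//.
apply: le_trans (_ : 4 * (s `^ delta * mu n `^ delta) <= _).
  rewrite -powRM ?(ltW s0) ?(ltW mn)// ler_pM2l//.
  apply: ge0_ler_powR; rewrite ?nnegrE ?mulr_ge0// ltW//.
rewrite (_ : 4 / c * s `^ delta * rate k n = 4 * (s `^ delta * (rate k n / c))); last by ring.
rewrite ler_pM2l// ler_pM2l// ler_pdivlMr//.
by rewrite mulrC.
Qed.

Lemma ln_le_powR delta (x : R) : 0 < delta -> 1 <= x -> ln x <= x `^ delta / delta.
Proof.
move=> d0 x1; rewrite ler_pdivlMr//.
have x0 : 0 < x by exact: lt_le_trans x1.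
have p0 : 0 < x `^ delta by rewrite powR_gt0.
rewrite mulrC -ln_powR; apply: le_trans (_ : x `^ delta - 1 <= _); last by rewrite lerBlDr lerDl.
by have := expR_ge1Dx (ln (x `^ delta)); rewrite lnK ?posrE//; lra.
Qed.
End Rates.

(** * Semigroup *)

Section RealLimits.
Variable R : realType.

Lemma right_lim0P (f : R -> R) : f x @[x --> 0^'+] --> (0 : R) <->
  forall e, 0 < e -> exists2 d, 0 < d & forall x, 0 < x -> x < d -> `|f x| < e.
Proof.
split=> [/cvgr0Pnorm_lt h e e0|h].
  have [d /= d0 hd] := h e e0; exists d => // x x0 xd.
  by apply: (hd x _ x0); rewrite /ball_ /= sub0r normrN gtr0_norm.
apply/cvgr0Pnorm_lt => e e0; have [d d0 hd] := h e e0.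
exists d => // x; rewrite /ball_ /= sub0r normrN => xd x0.
by apply: hd => //; move: xd; rewrite gtr0_norm.
Qed.

Lemma punctured_lim0P (f : R -> R) : f x @[x --> 0^'] --> (0 : R) <->
  forall e, 0 < e -> exists2 d, 0 < d & forall x, x != 0 -> `|x| < d -> `|f x| < e.
Proof.
split=> [/cvgr0Pnorm_lt h e e0|h].
  have [d /= d0 hd] := h e e0; exists d => // x x0 xd.
  by apply: (hd x _ x0); rewrite /ball_ /= sub0r normrN.
apply/cvgr0Pnorm_lt => e e0; have [d d0 hd] := h e e0.
by exists d => // x; rewrite /ball_ /= sub0r normrN => xd x0; apply: hd.
Qed.

Lemma is_derive_lim (f : R -> R) (t l : R) :
  (h^-1 * (f (t + h) - f t) - l) @[h --> 0^'] --> (0 : R) -> is_derive t 1 f l.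
Proof.
move=> fl.
have E : (fun h => h^-1 *: ((f \o shift t) (h *: 1) - f t)) =
    (fun h => h^-1 * (f (t + h) - f t)).
  by apply/funext => h; rewrite /= -[h *: 1]/(h * 1) mulr1 [h + t]addrC.
have c : (fun h => h^-1 *: ((f \o shift t) (h *: 1) - f t)) @ 0^' --> l.
  by rewrite E; apply/subr_cvg0.
split; first by apply/cvg_ex; exists l.
by apply: cvg_lim.
Qed.

(** The function exp(-k t) f(t) is nonincreasing. The constant [k] may have any sign: it is negative
    for energy decay, and lower bounds are obtained by applying the lemma to the opposite of a
    norm. *)
Lemma gronwall_le (f f' : R -> R) (k T : R) : 0 < T ->
  (forall t, 0 < t -> t <= T -> is_derive t 1 f (f' t)) ->
  (forall t, 0 < t -> t <= T -> f' t <= k * f t) ->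
  f x @[x --> 0^'+] --> f 0 -> f T <= expR (k * T) * f 0.
Proof.
move=> T0 df f'k f0.
pose g t := expR (- k * t) * f t.
have dg t : 0 < t -> t <= T -> is_derive t 1 g (expR (- k * t) * (f' t - k * f t)).
  move=> t0 tT; have d1 := df t t0 tT.
  have d3 : is_derive t 1 (fun t : R => - k * t) (- k).
    apply/is_derive_lim/punctured_lim0P => e e0; exists 1 => // x x0 _.
    by rewrite (_ : _ - _ = 0) ?normr0//; field.
  have d2 := is_derive1_comp (is_derive_expR (- k * t)) d3.
  apply: is_derive_eq (is_deriveM d2 d1) _.
  by rewrite /GRing.scale /=; ring.
have gle : g T <= g 0.
  apply: (@ler0_derive1_le_cc _ g 0 T) => //; rewrite ?in_itv /= ?lexx ?ltW//.
  - by move=> x; rewrite in_itv /= => /andP[x0 xT]; have [] := dg _ x0 (ltW xT).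
  - move=> x; rewrite in_itv /= => /andP[x0 xT].
    have [_] := dg _ x0 (ltW xT); rewrite derive1E => ->.
    by rewrite pmulr_rle0 ?expR_gt0// subr_le0 f'k// ltW.
  apply/continuous_within_itvP => //; split.
  - move=> x; rewrite in_itv /= => /andP[x0 xT].
    have [dx _] := dg _ x0 (ltW xT).
    by apply/differentiable_continuous; rewrite -derivable1_diffP.
  - apply: cvgM => //; apply: cvg_at_right_filter.
    by apply: continuous_comp; [exact: mulrl_continuous|exact: continuous_expR].
  - have [dx _] := dg _ T0 (lexx T).
    apply: cvg_at_left_filter.
    by apply/differentiable_continuous; rewrite -derivable1_diffP.
rewrite /g mulr0 expR0 mul1r mulNr expRN in gle.
by move: gle; rewrite ler_pdivrMl ?expR_gt0// mulrC.
Qed.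
End RealLimits.

(** * Quadratic forms along curves *)

Section PsdForm.
Variables (R : realType) (E : lmodType R[i]) (B : E -> E -> R).
Hypothesis BD : forall X Y Z, B (X + Y) Z = B X Z + B Y Z.
Hypothesis BZ : forall (t : R) X Y, B (t%:C *: X) Y = t * B X Y.
Hypothesis BC : forall X Y, B X Y = B Y X.
Hypothesis B0 : forall X, 0 <= B X X.
Implicit Types (X Y Z : E).

Lemma formDr X Y Z : B X (Y + Z) = B X Y + B X Z.
Proof. by rewrite BC BD !(BC _ X). Qed.

Lemma formZr (t : R) X Y : B X (t%:C *: Y) = t * B X Y.
Proof. by rewrite BC BZ BC. Qed.

Lemma form_CS X Y : B X Y ^+ 2 <= B X X * B Y Y.
Proof.
have := B0 X; have := B0 Y.
have h t : 0 <= t ^+ 2 * B X X + 2 * t * B X Y + B Y Y.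
  by have := B0 (t%:C *: X + Y); rewrite !(BD, formDr, BZ, formZr) (BC Y X); lra.
move: (B X X) (B X Y) (B Y Y) h => x m y h y0 x0.
have [xp|] := ltP 0 x.
  have := h (- m / x).
  have -> : (- m / x) ^+ 2 * x + 2 * (- m / x) * m + y = (x * y - m ^+ 2) / x.
    by field; rewrite gt_eqF.
  by rewrite pmulr_lge0 ?invr_gt0// subr_ge0.
(* If B(X, X) = 0 the quadratic polynomial is affine; were B(X, Y) nonzero, the value of t below
   would make it -1. *)
move=> xn; have {xn x0} xe : x = 0 by apply/eqP; rewrite eq_le xn x0.
have [->|m0] := eqVneq m 0; first by rewrite expr0n /= mulr_ge0// xe.
have := h (- (y + 1) / (2 * m)); rewrite xe.
have -> : (- (y + 1) / (2 * m)) ^+ 2 * 0 + 2 * (- (y + 1) / (2 * m)) * m + y = -1 by field.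
by rewrite ler0N1.
Qed.

Lemma form_norm_le X Y : `|B X Y| <= Num.sqrt (B X X) * Num.sqrt (B Y Y).
Proof.
rewrite -sqrtr_sqr -sqrtrM//; apply: ler_wsqrtr; exact: form_CS.
Qed.

Lemma form_young X Y : B (X + Y) (X + Y) <= 2 * B X X + 2 * B Y Y.
Proof.
by have := B0 (X + (-1)%:C *: Y); rewrite !(BD, formDr, BZ, formZr) (BC Y X); lra.
Qed.

Lemma form_cvg (T : Type) (F : set_system T) (FF : ProperFilter F) (u : T -> E) u0 :
  B (u h - u0) (u h - u0) @[h --> F] --> (0 : R) ->
  B (u h) (u h) @[h --> F] --> B u0 u0.
Proof.
move=> qc.
have sc : Num.sqrt (B (u h - u0) (u h - u0)) @[h --> F] --> (0 : R).
  rewrite -[X in _ --> X](@sqrtr0 R).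
  by apply: (cvg_comp _ _ qc); exact: sqrt_continuous.
apply/subr_cvg0/norm_cvg0P.
have bc : 2 * (Num.sqrt (B u0 u0) * Num.sqrt (B (u h - u0) (u h - u0))) +
    B (u h - u0) (u h - u0) @[h --> F] --> (0 : R).
  rewrite -[X in _ --> X](addr0 (0 : R)); apply: cvgD => //.
  rewrite -[X in _ --> X](mulr0 (2 : R)); apply: cvgMr.
  by rewrite -[X in _ --> X](mulr0 (Num.sqrt (B u0 u0))); apply: cvgMr.
apply: (squeeze_cvgr _ (cvg_cst 0) bc); near=> h.
rewrite normr_ge0 /=.
have := form_norm_le u0 (u h - u0); have q0 := B0 (u h - u0).
have -> : B (u h) (u h) - B u0 u0 = 2 * B u0 (u h - u0) + B (u h - u0) (u h - u0).
  rewrite -[in LHS](subrK u0 (u h)) !(BD, formDr) (BC u0 (u h)) (BC (- u0) u0).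
  rewrite (BC (-u0) (u h)); ring.
move=> hn; apply: le_trans (ler_normD _ _) _.
by rewrite (ger0_norm q0) lerD2r normrM normr_nat ler_pM2l.
Unshelve. all: by end_near. Qed.

(** It suffices that the difference quotient converges in the seminorm of the form; the remainder is
    2 B(z, r) + h B(D + r, D + r), controlled by Cauchy-Schwarz. *)
Lemma form_deriv (z : R -> E) (D : E) (t : R) :
  let r h := (h^-1)%:C *: (z (t + h) - z t) - D in
  B (r h) (r h) @[h --> 0^'] --> (0 : R) ->
  is_derive t 1 (fun s => B (z s) (z s)) (2 * B (z t) D).
Proof.
move=> r qc; apply: is_derive_lim.
have sc : Num.sqrt (B (r h) (r h)) @[h --> 0^'] --> (0 : R).
  rewrite -[X in _ --> X](@sqrtr0 R).
  by apply: (cvg_comp _ _ qc); exact: sqrt_continuous.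
apply/norm_cvg0P.
have bc : 2 * (Num.sqrt (B (z t) (z t)) * Num.sqrt (B (r h) (r h))) +
    `|h| * (2 * B D D + 2 * B (r h) (r h)) @[h --> 0^'] --> (0 : R).
  rewrite -[X in _ --> X](addr0 (0 : R)); apply: cvgD.
    rewrite -[X in _ --> X](mulr0 (2 : R)); apply: cvgMr.
    by rewrite -[X in _ --> X](mulr0 (Num.sqrt (B (z t) (z t)))); apply: cvgMr.
  rewrite -[X in _ --> X](mul0r (2 * B D D + 2 * 0)).
  apply: cvgM; last by apply: cvgD; [exact: cvg_cst|apply: cvgMr; exact: qc].
  by apply/norm_cvg0P; exact: nbhs_dnbhs.
apply: (squeeze_cvgr _ (cvg_cst 0) bc); near=> h.
rewrite normr_ge0 /=.
have h0 : h != 0 by near: h; exact: nbhs_dnbhs_neq.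
have zE : z (t + h) = z t + h%:C *: (D + r h).
  rewrite /r [D + _]addrC subrK scalerA -rmorphM mulfV// scale1r.
  by rewrite [RHS]addrC subrK.
have := form_norm_le (z t) (r h).
have q1 := B0 (D + r h).
have q2 := form_young D (r h).
have calc rh : h^-1 * (B (z t + h%:C *: (D + rh)) (z t + h%:C *: (D + rh)) -
    B (z t) (z t)) - 2 * B (z t) D = 2 * B (z t) rh + h * B (D + rh) (D + rh).
  rewrite !(BD, formDr, BZ, formZr) (BC D (z t)) (BC rh (z t)).
  by field.
rewrite zE calc.
move=> hn; apply: le_trans (ler_normD _ _) _; rewrite !normrM normr_nat.
by apply: lerD; [rewrite ler_pM2l|rewrite (ger0_norm q1) ler_wpM2l].
Unshelve. all: by end_near. Qed.
End PsdForm.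

(** * Orbits of the semigroup in coordinates *)

Section Semigroup.
Variables (R : realType) (H : completeNormedModType R[i]).
Variable dot : {dot H for Num.conj}.
Hypothesis dotE : forall x : H, `|x| ^+ 2 = dot x x.
Local Notation quad := (H * H * H * H)%type.
Variables (A : operator H) (P : nat -> H -> H) (mu : nat -> R) (m0 : R).
Hypothesis SP : spectrum dot A P mu m0.
Variables (a b gamma theta : R).
Hypotheses (a0 : 0 < a) (b0 : 0 < b) (ab : a != b).
Hypotheses (gamma0 : 0 < gamma) (theta1 : theta <= 1).
Implicit Types (X Y Z W F : quad) (c : R[i]) (l t : R).
Local Notation ip4 := (ip4 dot a b).
Local Notation blk := (blk a b).
Local Notation HH := (energy_space dot A a b).
Local Notation AA := (system_operator dot A a b gamma theta).
Local Notation freq := (freq mu).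
Local Notation dmp := (dmp mu gamma theta).
Local Notation coords := (coords P mu).
Local Notation carrier := (@carrier R HH).
Local Notation nrm := (@nrm R HH).
Let dP := spec_diag SP.
Let cB X Y (cX : carrier X) (cY : carrier Y) : carrier (X - Y) :=
  carrierB dotE SP cX cY.
Let cZD c X Y (cX : carrier X) (cY : carrier Y) : carrier (c *: X + Y) :=
  carrierZD dotE SP c cX cY.
Let ip4_0 := ip4_ge0 dotE a0 b0.

Lemma ip4_young X Y : ip4 (X + Y) (X + Y) <= 2 * ip4 X X + 2 * ip4 Y Y.
Proof.
rewrite !ip4_lyap; apply: form_young => *; rewrite ?lyapDl ?lyapZl//.
- exact: lyapC.
- by rewrite -ip4_lyap.
Qed.

Lemma carrierD X Y : carrier X -> carrier Y -> carrier (X + Y).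
Proof. by move=> cX cY; rewrite -[X]scale1r; exact: cZD. Qed.

Lemma carrierZ c X : carrier X -> carrier (c *: X).
Proof. by move=> cX; rewrite -[_ *: X]addr0; apply: cZD => //; exact: (carrier0 dotE SP). Qed.

Lemma coordsZ n c X : coords n (c *: X) = c *: coords n X.
Proof.
rewrite -[_ *: X]addr0 (coords_linear SP).
have -> : coords n 0 = 0 by rewrite /= !(diag0 dP) !scaler0.
by rewrite addr0.
Qed.

(** A triangle inequality up to the factor 2, obtained from Young's inequality on coordinates; the
    limits below are insensitive to that factor. *)
Lemma nrmD2 X Y : carrier X -> carrier Y -> nrm (X + Y) <= 2 * (nrm X + nrm Y).
Proof.
move=> cX cY.
have nX := @nrm_ge0 _ _ dot A a b X; have nY := @nrm_ge0 _ _ dot A a b Y.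
have nXY := @nrm_ge0 _ _ dot A a b (X + Y).
have cv := @nrm_cvg _ _ _ dotE _ _ _ _ SP _ _ a0 b0 _ (carrierD cX cY).
suff h : nrm (X + Y) ^+ 2 <= 2 * nrm X ^+ 2 + 2 * nrm Y ^+ 2.
  rewrite -(@ler_pXn2r _ 2)// ?nnegrE ?mulr_ge0 ?addr_ge0//.
  by apply: le_trans h _; nra.
apply: (cvgr_to_le cv); apply: nearW => n.
apply: le_trans (lerD (ler_wpM2l _ (nrm_psum dotE SP a0 b0 n cX))
  (ler_wpM2l _ (nrm_psum dotE SP a0 b0 n cY))) => //.
rewrite !mulr_sumr -big_split; apply: ler_sum => i _.
have -> : coords i (X + Y) = coords i X + coords i Y.
  by rewrite -[X in coords i (X + _)]scale1r (coords_linear SP) scale1r.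
exact: ip4_young.
Qed.

Lemma nrmZ_le (r : R) X : carrier X -> nrm (r%:C *: X) <= `|r| * nrm X.
Proof.
move=> cX; apply: (nrm_le dotE SP a0 b0) => //; first exact: carrierZ.
by move=> n; rewrite coordsZ real_normK ?num_real// !ip4_lyap lyapZl lyapC lyapZl mulrA expr2.
Qed.

Lemma nrmN X : carrier X -> nrm (- X) <= nrm X.
Proof.
move=> cX; have := nrmZ_le (-1) cX.
by rewrite rmorphN rmorph1 scaleN1r normrN1 mul1r.
Qed.

Variable S : R -> quad -> quad.
Hypotheses (S_C0 : C0_semigroup (X := HH) S) (S_contr : contractive (X := HH) S).
Hypothesis S_gen : generator (X := HH) S AA.

Lemma sg_carrier t X : 0 <= t -> carrier X -> carrier (S t X).
Proof. by case: S_C0 => h _ _ _ t0; case: (h t t0) => + _ _; apply. Qed.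

Lemma sg_linear t c X Y : 0 <= t -> carrier X -> carrier Y ->
  S t (c *: X + Y) = c *: S t X + S t Y.
Proof. by case: S_C0 => h _ _ _ t0; case: (h t t0) => _ + _; apply. Qed.

Lemma sgB t X Y : 0 <= t -> carrier X -> carrier Y -> S t (X - Y) = S t X - S t Y.
Proof. by move=> t0 cX cY; rewrite addrC -scaleN1r sg_linear// scaleN1r addrC. Qed.

Lemma sgZ t c X : 0 <= t -> carrier X -> S t (c *: X) = c *: S t X.
Proof.
move=> t0 cX; have s0 : S t 0 = 0.
  by rewrite -(subrr X) sgB// !subrr.
by rewrite -[_ *: X]addr0 sg_linear// ?s0 ?addr0//; exact: (carrier0 dotE SP).
Qed.

Lemma sgD s t X : 0 <= s -> 0 <= t -> carrier X -> S (s + t) X = S s (S t X).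
Proof. by case: S_C0 => _ _ h _; exact: h. Qed.

Lemma dom_carrier Z : dom AA Z -> carrier Z /\ carrier (AA Z).
Proof.
move=> dZ; have [h _] := graphP dotE SP a b gamma theta1 Z (AA Z).
by have [] := h (conj dZ erefl).
Qed.

Lemma dom_coords Z n : dom AA Z -> coords n (AA Z) = blk (freq n) (dmp n) (coords n Z).
Proof.
move=> dZ; have [h _] := graphP dotE SP a b gamma theta1 Z (AA Z).
by have [] := h (conj dZ erefl).
Qed.

Lemma carrier_quot h X Y W : carrier X -> carrier Y -> carrier W ->
  carrier ((h^-1)%:C *: (X - Y) - W :> quad).
Proof. by move=> cX cY cW; apply: cB => //; apply: carrierZ; exact: cB. Qed.

Lemma sg_quot Z : dom AA Z ->
  nrm ((h^-1)%:C *: (S h Z - Z) - AA Z) @[h --> 0^'+] --> (0 : R).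
Proof. by move=> dZ; have [cZ cW] := dom_carrier dZ; apply/(S_gen cZ cW). Qed.

Lemma sg_dom Z t : dom AA Z -> 0 <= t -> dom AA (S t Z) /\ AA (S t Z) = S t (AA Z).
Proof.
move=> dZ t0; have [cZ cW] := dom_carrier dZ.
have cSZ := sg_carrier t0 cZ; have cSW := sg_carrier t0 cW.
apply/(S_gen cSZ cSW)/right_lim0P => e e0.
have /right_lim0P/(_ e e0)[d d0 hd] := sg_quot dZ.
exists d => // h h0 hd'; apply: le_lt_trans (hd h h0 hd').
have cS := sg_carrier (ltW h0) cZ.
rewrite !ger0_norm ?nrm_ge0//.
have -> : (h^-1)%:C *: (S h (S t Z) - S t Z) - S t (AA Z) =
  S t ((h^-1)%:C *: (S h Z - Z) - AA Z).
  have cD := cB cS cZ; rewrite (sgB t0 (carrierZ _ cD) cW) (sgZ _ t0 cD) (sgB t0 cS cZ).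
  by rewrite -(sgD (ltW h0) t0 cZ) -(sgD t0 (ltW h0) cZ) [h + t]addrC.
by apply: S_contr => //; exact: carrier_quot.
Qed.

(** The generator only gives a right derivative at 0. For t > 0 contractivity carries it to t, and
    the left quotient is handled by factoring out S(t - k) with k = -h. *)
Lemma sg_deriv Z t : dom AA Z -> 0 < t ->
  nrm ((h^-1)%:C *: (S (t + h) Z - S t Z) - S t (AA Z)) @[h --> 0^'] --> (0 : R).
Proof.
move=> dZ t0; have [cZ cW] := dom_carrier dZ.
apply/punctured_lim0P => e e0.
have e4 : 0 < e / 4 by rewrite divr_gt0.
have /right_lim0P/(_ _ e4)[d d0 hd] := sg_quot dZ.
have [_ _ _ /(_ _ cW) /right_lim0P/(_ _ e4)[d' d'0 hd']] := S_C0.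
exists (Num.min t (Num.min d d')) => [|h h0]; first by rewrite !lt_min t0 d0.
rewrite !lt_min => /and3P[ht hd1 hd2].
rewrite ger0_norm ?nrm_ge0//.
have [hp|hn|/eqP] := ltrgt0P h; last by rewrite (negPf h0).
  rewrite gtr0_norm// in hd1; have cS := sg_carrier (ltW hp) cZ.
  have -> : (h^-1)%:C *: (S (t + h) Z - S t Z) - S t (AA Z) =
    S t ((h^-1)%:C *: (S h Z - Z) - AA Z).
    have cD := cB cS cZ; have t0' := ltW t0.
    rewrite (sgB t0' (carrierZ _ cD) cW) (sgZ _ t0' cD) (sgB t0' cS cZ).
    by rewrite -(sgD t0' (ltW hp) cZ).
  apply: le_lt_trans (S_contr (ltW t0) _) _; first exact: carrier_quot.
  have := hd h hp hd1; rewrite ger0_norm ?nrm_ge0//; lra.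
rewrite ltr0_norm// in ht hd1 hd2; pose k := - h.
have k0 : 0 < k by rewrite oppr_gt0.
have tk : 0 <= t - k by rewrite subr_ge0 ltW.
have cS := sg_carrier (ltW k0) cZ; have cSW := sg_carrier (ltW k0) cW.
(* The left quotient differs from its limit by the right quotient error at 0 and by S(k) A Z - A Z,
   both transported by the contraction S(t - k). *)
have -> : (h^-1)%:C *: (S (t + h) Z - S t Z) - S t (AA Z) =
   S (t - k) ((k^-1)%:C *: (S k Z - Z) - AA Z) + - S (t - k) (S k (AA Z) - AA Z).
  have cD := cB cS cZ; have cQ := carrierZ (k^-1)%:C cD.
  rewrite (sgB tk cQ cW) (sgB tk cSW cW) (sgZ _ tk cD) (sgB tk cS cZ).
  rewrite -(sgD tk (ltW k0) cZ) -(sgD tk (ltW k0) cW) subrK.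
  rewrite [in RHS]opprB [RHS]addrA [in RHS]subrK; congr (_ - _).
  by rewrite /k invrN rmorphN scaleNr -scalerN opprB opprK.
have cU : carrier (S (t - k) ((k^-1)%:C *: (S k Z - Z) - AA Z)).
  by apply: sg_carrier => //; exact: carrier_quot.
have cU' : carrier (S (t - k) (S k (AA Z) - AA Z)) by apply: sg_carrier => //; exact: cB.
apply: le_lt_trans (nrmD2 cU _) _.
  by rewrite -[- _]add0r; apply: cB => //; exact: (carrier0 dotE SP).
have h1 := S_contr tk (carrier_quot k cS cZ cW).
have h2 := S_contr tk (cB cSW cW); have h3 := nrmN cU'.
have := hd k k0 hd1; have := hd' k k0 hd2.
rewrite !ger0_norm ?nrm_ge0// => h4 h5.
apply: le_lt_trans (_ : 2 * (nrm ((k^-1)%:C *: (S k Z - Z) - AA Z) + nrm (S k (AA Z) - AA Z)) < _).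
  by rewrite ler_pM2l//; apply: lerD => //; exact: le_trans h3 h2.
lra.
Qed.

(* A coordinate of a differentiable curve is differentiated inside any form
   dominated by the energy. *)
Lemma coords_deriv (B : quad -> quad -> R) (n : nat) (z : R -> quad) (D : quad) t (d : R) :
  (forall X Y Z, B (X + Y) Z = B X Z + B Y Z) ->
  (forall (s : R) X Y, B (s%:C *: X) Y = s * B X Y) ->
  (forall X Y, B X Y = B Y X) -> (forall X, 0 <= B X X) ->
  (forall X, B X X <= 2 * ip4 X X) ->
  0 < d -> carrier D -> (forall s, `|s - t| < d -> carrier (z s)) ->
  nrm ((h^-1)%:C *: (z (t + h) - z t) - D) @[h --> 0^'] --> (0 : R) ->
  is_derive t 1 (fun s => B (coords n (z s)) (coords n (z s)))
    (2 * B (coords n (z t)) (coords n D)).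
Proof.
move=> BD BZ BC B0 Ble d0 cD cz zD.
apply: (form_deriv BD BZ BC B0).
have q2 : 2 * nrm ((h^-1)%:C *: (z (t + h) - z t) - D) ^+ 2 @[h --> 0^'] --> (0 : R).
  rewrite -[X in _ --> X](mulr0 (2 : R)); apply: cvgMr.
  by have h2 := cvgM zD zD; rewrite mulr0 in h2; exact: h2.
apply: (squeeze_cvgr _ (cvg_cst 0) q2); near=> h.
rewrite B0 /=.
have hd : `|h| < d.
  by near: h; exists d => // h; rewrite /ball_ /= sub0r normrN.
rewrite -(coordsB SP) -coordsZ -(coordsB SP).
apply: le_trans (Ble _) _; rewrite ler_pM2l//; apply: (coords_le dotE SP a0 b0).
apply: carrier_quot => //; apply: cz; first by rewrite addrC addKr.
by rewrite subrr normr0.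
Unshelve. all: by end_near. Qed.

Lemma psum_split (f : nat -> R) N m : (N <= m)%N ->
  \sum_(i < m) f i = \sum_(i < N) f i + \sum_(N <= i < m) f i.
Proof. by move=> Nm; rewrite -!(big_mkord xpredT f) (big_cat_nat (leq0n N) Nm). Qed.

Lemma psum_eq0 (f : nat -> R) N : (forall i, (i < N)%N -> f i = 0) ->
  \sum_(i < N) f i = 0.
Proof. by move=> f0; rewrite big1// => i _; exact: f0. Qed.

Lemma psum_stop (f : nat -> R) N m : (forall i, 0 <= f i) ->
  (forall i, (N <= i)%N -> f i = 0) -> \sum_(i < m) f i <= \sum_(i < N) f i.
Proof.
move=> f0 fN; have [mN|Nm] := leqP m N; first by rewrite (psum_split f mN) lerDl; apply: sumr_ge0.
rewrite (psum_split f (ltnW Nm)).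
suff -> : \sum_(N <= i < m) f i = 0 by rewrite addr0.
by rewrite big_nat big1// => i /andP[Ni _]; exact: fN.
Qed.

Lemma quad_map_blk n g d X : quad_map (P n) (blk g d X) = blk g d (quad_map (P n) X).
Proof.
case: X => [[[u v] w] z]; congr (_, _, _, _).
- exact: (diagZ dP).
- by rewrite (diagN dP) !(diagD dP) !(diagZ dP) (diagD dP).
- exact: (diagZ dP).
- by rewrite (diagN dP) !(diagD dP) !(diagZ dP) (diagD dP).
Qed.

Lemma blk0 g d : blk g d (0 : quad) = 0.
Proof. by congr (_, _, _, _); rewrite /= ?addr0 ?scaler0 ?addr0 ?oppr0. Qed.

Lemma ip4_00 : ip4 0 0 = 0.
Proof. by rewrite /= !rdot0l; ring. Qed.

(** Keeping finitely many coordinates makes the block images summable, so the truncated vector lies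
    in the domain; this gives density of the domain. *)
Lemma truncation Z N : carrier Z -> exists2 Z', dom AA Z' &
  forall n, coords n Z' = if (n < N)%N then coords n Z else 0.
Proof.
move=> cZ.
pose x n := if (n < N)%N then coords n Z else 0.
have Px n : quad_map (P n) (x n) = x n.
  rewrite /x; case: ifP => _; first exact: (coords_proj SP).
  by rewrite /= !(diag0 dP).
have xN n : (N <= n)%N -> x n = 0 by rewrite /x ltnNge => ->.
have [|Z' cZ' xE] := @coords_synth _ _ _ dotE _ _ _ _ SP a b a0 b0 x
  (\sum_(i < N) ip4 (x i) (x i)) Px.
  move=> m; apply: (@psum_stop (fun i => ip4 (x i) (x i))) => // i Ni.
  by rewrite xN// ip4_00.
pose y n := blk (freq n) (dmp n) (x n).
have [||W cW yE] := @coords_synth _ _ _ dotE _ _ _ _ SP a b a0 b0 y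
  (\sum_(i < N) ip4 (y i) (y i)).
- by move=> n; rewrite quad_map_blk Px.
- move=> m; apply: (@psum_stop (fun i => ip4 (y i) (y i))) => // i Ni.
  by rewrite /y xN// blk0 ip4_00.
have [_ h] := graphP dotE SP a b gamma theta1 Z' W.
have [|dZ' _] := h; first by split => // n; rewrite yE /y -xE.
by exists Z'.
Qed.

Lemma truncation_err Z Z' N : carrier Z -> carrier Z' ->
  (forall n, coords n Z' = if (n < N)%N then coords n Z else 0) ->
  nrm (Z - Z') ^+ 2 <= nrm Z ^+ 2 - \sum_(i < N) ip4 (coords i Z) (coords i Z).
Proof.
move=> cZ cZ' E.
have cv := @nrm_cvg _ _ _ dotE _ _ _ _ SP _ _ a0 b0 _ (cB cZ cZ').
apply: (cvgr_to_le cv); exists N => // m /= Nm.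
have tot := nrm_psum dotE SP a0 b0 m cZ.
rewrite lerBrDr; apply: le_trans tot.
rewrite (@psum_split (fun i => ip4 (coords i Z) (coords i Z)) _ _ Nm).
rewrite (@psum_split (fun i => ip4 (coords i (Z - Z')) (coords i (Z - Z'))) _ _ Nm).
rewrite (@psum_eq0 (fun i => ip4 (coords i (Z - Z')) (coords i (Z - Z')))).
  rewrite add0r [leRHS]addrC lerD2r big_nat [leRHS]big_nat; apply: ler_sum => i /andP[Ni _].
  by rewrite (coordsB SP) E ltnNge Ni subr0.
by move=> i iN; rewrite (coordsB SP) E iN subrr ip4_00.
Qed.

Lemma dense_dom Z n (e : R) : carrier Z -> 0 < e -> exists2 Z', dom AA Z' &
  [/\ carrier Z', nrm (Z - Z') ^+ 2 < e & coords n Z' = coords n Z].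
Proof.
move=> cZ e0.
have cv := @nrm_cvg _ _ _ dotE _ _ _ _ SP _ _ a0 b0 _ cZ.
have /cvgrPdist_lt/(_ _ e0)[N _ hN] := cv.
(* The cut lies beyond index [n], so the approximation leaves the n-th coordinate unchanged. *)
pose M := maxn N n.+1.
have [Z' dZ' E] := truncation M cZ.
have [cZ' _] := dom_carrier dZ'.
exists Z' => //; split => //.
- apply: le_lt_trans (truncation_err cZ cZ' E) _.
  have := hN M (leq_maxl _ _); apply: le_lt_trans; exact: ler_norm.
- by rewrite E leq_maxr.
Qed.

Section Decay.
Variables (k : R).
Hypothesis k0 : 0 < k.
Hypothesis en : dissipative dot a b k.
Local Notation rate := (rate mu gamma theta k).

(** On the domain the n-th coordinate has the block as derivative, so its perturbed energy B
    satisfies B' <= - rate B. The factor 4 is the price of passing from [ip4] to B and back. *)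
Lemma dom_decay Z n t : dom AA Z -> 0 < t ->
  ip4 (coords n (S t Z)) (coords n (S t Z)) <=
  4 * expR (- rate n * t) * ip4 (coords n Z) (coords n Z).
Proof.
move=> dZ t0; have [cZ cW] := dom_carrier dZ.
have g0 := freq_gt0 SP n; have dn0 := dmp_gt0 SP theta gamma0 n.
have [e1 e2 e3] := en g0 dn0.
pose B := energy dot a b k (freq n) (dmp n).
have BD X Y W : B (X + Y) W = B X W + B Y W by exact: lyapDl.
have BZ s X W : B (s%:C *: X) W = s * B X W by exact: lyapZl.
have BC X W : B X W = B W X by exact: lyapC.
have B0 X : 0 <= B X X by have := ip4_0 X; have := e1 X; rewrite -/(B X X); lra.
pose f s := B (coords n (S s Z)) (coords n (S s Z)).
have r0 : 0 < rate n.
  by have [c0 _ _ _] := damp_props g0 dn0; rewrite !mulr_gt0// exprn_gt0.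
have S0 : S 0 Z = Z by case: S_C0 => _ h _ _; exact: h.
have h : f t <= expR (- rate n * t) * f 0.
  apply: (@gronwall_le _ f (fun s => 2 * B (coords n (S s Z)) (coords n (S s (AA Z))))) => //.
  - move=> s s0 st; apply: (@coords_deriv B n (S^~ Z) (S s (AA Z)) s s) => //.
    + exact: sg_carrier (ltW s0) cW.
    + by move=> u us; apply: sg_carrier => //; move: us; rewrite ltr_norml; lra.
    + exact: sg_deriv.
  - move=> s s0 st; have [ds As] := sg_dom dZ (ltW s0).
    rewrite -As (dom_coords n ds) /f.
    have := e3 (coords n (S s Z)); have := e2 (coords n (S s Z)).
    rewrite -/(B _ _) -/(B _ _) -/(rate n) => h2 h3; nra.
  - rewrite /f S0; apply: (form_cvg BD BZ BC B0).
    have q2 : 2 * nrm (S h Z - Z) ^+ 2 @[h --> 0^'+] --> (0 : R).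
      rewrite -[X in _ --> X](mulr0 (2 : R)); apply: cvgMr.
      have [_ _ _ /(_ _ cZ) zc] := S_C0.
      by have h2 := cvgM zc zc; rewrite mulr0 in h2; exact: h2.
    apply: (squeeze_cvgr _ (cvg_cst 0) q2); near=> h.
    rewrite B0 andTb -(coordsB SP); apply: le_trans (e2 _) _; rewrite ler_pM2l//.
    have h0 : 0 < h by near: h; exact: nbhs_right_gt.
    by apply: (coords_le dotE SP a0 b0); apply: cB => //; apply: sg_carrier => //; exact: ltW.
apply: le_trans (e1 _) _; rewrite -/(B _ _) -/(f t).
have := e2 (coords n Z); rewrite -/(B _ _) => h2.
have E0 := expR_gt0 (- rate n * t).
have := ler_wpM2l (ltW E0) h2; rewrite /f S0 in h; rewrite /f; lra.
Unshelve. all: by end_near. Qed.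

(** Approximate Z by domain vectors with the same n-th coordinate: the right-hand side does not
    change and the error is contracted. Splitting the sum doubles the constant 4. *)
Lemma all_decay Z n t : carrier Z -> 0 < t ->
  ip4 (coords n (S t Z)) (coords n (S t Z)) <=
  8 * expR (- rate n * t) * ip4 (coords n Z) (coords n Z).
Proof.
move=> cZ t0; apply/ler_addgt0Pr => e e0.
have e2 : 0 < e / 2 by rewrite divr_gt0.
have [Z' dZ' [cZ' eZ' cE]] := dense_dom n cZ e2.
have h := dom_decay n dZ' t0.
rewrite cE in h.
have cD := cB cZ cZ'.
have -> : coords n (S t Z) = coords n (S t Z') + coords n (S t (Z - Z')).
  by rewrite (sgB (ltW t0) cZ cZ') (coordsB SP) addrC subrK.
apply: le_trans (ip4_young _ _) _.
have h1 := coords_le dotE SP a0 b0 n (sg_carrier (ltW t0) cD).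
have h2 := S_contr (ltW t0) cD.
have h3 : nrm (S t (Z - Z')) ^+ 2 <= nrm (Z - Z') ^+ 2.
  by rewrite lerXn2r ?nnegrE ?nrm_ge0.
lra.
Qed.

(** The exponential decay of each coordinate outweighs the growth of the blocks, so the block images
    of S(t) Z are square-summable and [graphP] applies. *)
Lemma smoothing Z t K : carrier Z -> 0 < t ->
  (forall n, (freq n ^+ 2 + dmp n ^+ 2) * expR (- rate n * t) <= K) -> dom AA (S t Z).
Proof.
move=> cZ t0 hK; have [M M0 hM] := ip4_blk_le dotE a0 b0.
have cS := sg_carrier (ltW t0) cZ.
pose y n := blk (freq n) (dmp n) (coords n (S t Z)).
have [||W cW yE] := @coords_synth _ _ _ dotE _ _ _ _ SP a b a0 b0 y (M * 8 * K * nrm Z ^+ 2).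
- by move=> n; rewrite quad_map_blk (coords_proj SP).
- have K0 : 0 <= K.
    apply: le_trans (hK 0%N); rewrite mulr_ge0 ?expR_ge0// addr_ge0 ?sqr_ge0//.
  apply: (@psum_bound _ (fun i => ip4 (y i) (y i)) (fun i => ip4 (coords i Z) (coords i Z))).
  + move=> n; apply: le_trans (hM _ _ _) _.
    have h1 := all_decay n cZ t0.
    have g2 : 0 <= freq n ^+ 2 + dmp n ^+ 2 by rewrite addr_ge0 ?sqr_ge0.
    have h2 := ler_wpM2l g2 h1.
    have h3 := ler_wpM2r (ip4_0 (coords n Z)) (hK n).
    rewrite -!mulrA; apply: ler_wpM2l; first exact: ltW.
    apply: le_trans h2 _.
    move: h3; set x := ip4 _ _; set E := expR _ => h3.
    rewrite (_ : _ * (8 * E * x) = 8 * ((freq n ^+ 2 + dmp n ^+ 2) * E * x)); last by ring.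
    by rewrite ler_pM2l.
  + by rewrite !mulr_ge0// ltW.
  + by move=> n; exact: (nrm_psum dotE SP a0 b0).
have [_ h] := graphP dotE SP a b gamma theta1 (S t Z) W.
by have [|] := h; first by split => // n; rewrite yE.
Qed.

(** From x^p <= exp(p x): with p = 2 / delta and x = q mu_n^delta the left side is q^p mu_n^2, which
    dominates the size of the block, and q = c t / p makes p x at most rate t. *)
Lemma exp_decay_bound delta (c : R) t : 0 < delta -> 0 < c -> 0 < t ->
  (forall n, c * mu n `^ delta <= rate n) ->
  exists K, forall n, (freq n ^+ 2 + dmp n ^+ 2) * expR (- rate n * t) <= K.
Proof.
move=> d0 c0 t0 cr; have [C C0 hC] := speed_le SP gamma0 theta1.
pose p := 2 / delta; have p0 : 0 < p by rewrite divr_gt0.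
pose q := c * t / p; have q0 : 0 < q by rewrite divr_gt0// mulr_gt0.
exists (C / q `^ p) => n; have mn := mu_gt0 SP n.
have qp : 0 < q `^ p by rewrite powR_gt0.
have m2 : q `^ p * mu n ^+ 2 <= expR (rate n * t).
  have md : 0 < mu n `^ delta by rewrite powR_gt0.
  have -> : q `^ p * mu n ^+ 2 = (q * mu n `^ delta) `^ p.
    rewrite [RHS]powRM ?(ltW q0) ?(ltW md)// -powRrM; congr (_ * _).
    by rewrite /p mulrC divfK ?gt_eqF// powR_mulrn// ltW.
  apply: le_trans (_ : expR (q * mu n `^ delta) `^ p <= _).
    apply: ge0_ler_powR; rewrite ?nnegrE ?expR_ge0 ?(ltW p0)//.
      by rewrite mulr_ge0// ltW.
    by have := expR_ge1Dx (q * mu n `^ delta); lra.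
  rewrite /powR gt_eqF ?expR_gt0// expRK ler_expR.
  rewrite (_ : p * (q * mu n `^ delta) = c * mu n `^ delta * t); last first.
    by rewrite /q; field; rewrite gt_eqF.
  by rewrite ler_pM2r.
rewrite mulNr expRN ler_pdivrMr ?expR_gt0//.
apply: le_trans (hC n) _; rewrite -mulrA ler_pM2l//.
by rewrite mulrC ler_pdivlMr// mulrC.
Qed.

(** Write S(t) = S(t/2) S(t/2): the first half of the time brings the orbit into the domain, where
    the second half is differentiable. *)
Lemma differentiable_all (t0 : \bar R) : (0 <= t0)%E ->
  (forall Z t, carrier Z -> 0 < t -> dom AA (S t Z)) ->
  differentiable_for (X := HH) S t0.
Proof.
move=> t00 sm Z t cZ; move/(le_lt_trans t00); rewrite lte_fin => tp.
have t2 : 0 < t / 2 by rewrite divr_gt0.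
have cS := sg_carrier (ltW t2) cZ.
have dS := sm _ _ cZ t2.
have [_ cA] := dom_carrier dS.
exists (S (t / 2) (AA (S (t / 2) Z))); first exact: (sg_carrier (ltW t2) cA).
have := sg_deriv dS t2.
move=> /punctured_lim0P h; apply/punctured_lim0P => e e0.
have [d d0 hd] := h e e0.
exists (Num.min d (t / 2)) => [|x x0]; first by rewrite lt_min d0.
rewrite lt_min => /andP[xd xt].
have := hd x x0 xd.
have tx : 0 <= t / 2 + x by move: xt; rewrite ltr_norml; lra.
rewrite -(sgD tx (ltW t2) cZ) -(sgD (ltW t2) (ltW t2) cZ).
rewrite (_ : t / 2 + x + t / 2 = t + x); last by field.
by rewrite (_ : t / 2 + t / 2 = t); last by field.
Qed.
End Decay.
End Semigroup.

(** * High-frequency eigenvalues *)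

Section NearRoot.
Variable C : numClosedFieldType.
Implicit Types (p : {poly C}) (r : seq C) (x z : C).

(** Since q'/q is the sum of the 1 / (x - z) over the n roots, one term is at least |q'/q| / n in
    modulus. The inequality is multiplied out so that it makes sense when a denominator vanishes;
    the induction keeps the nearer of two roots. *)
Lemma near_root_prod r x : r != [::] ->
  exists2 z, z \in r & `|x - z| * `|(\prod_(y <- r) ('X - y%:P))^`().[x]|
    <= (size r)%:R * `|(\prod_(y <- r) ('X - y%:P)).[x]|.
Proof.
elim: r => [//|z r IH] _; rewrite !big_cons.
set q := \prod_(y <- r) _ in IH *.
have D : `|(('X - z%:P) * q)^`().[x]| <= `|q.[x]| + `|x - z| * `|q^`().[x]|.
  by rewrite derivM derivXsubC mul1r hornerD hornerM hornerXsubC -normrM ler_normD.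
have E : `|(('X - z%:P) * q).[x]| = `|x - z| * `|q.[x]|.
  by rewrite hornerM hornerXsubC normrM.
have -> : (size (z :: r))%:R * `|(('X - z%:P) * q).[x]| =
    `|x - z| * ((size r)%:R * `|q.[x]|) + `|x - z| * `|q.[x]|.
  by rewrite E -natr1; ring.
have [r0|/IH[y yr hy]] := eqVneq r [::].
  exists z; first exact: mem_head.
  apply: le_trans (ler_wpM2l (normr_ge0 _) D) _.
  by rewrite /q r0 big_nil derivC horner0 normr0 mulr0 addr0 mul0r mulr0 add0r.
have Q (m : C) : 0 <= m -> m <= `|x - z| -> m * `|q^`().[x]| <= (size r)%:R * `|q.[x]| ->
    m * `|(('X - z%:P) * q)^`().[x]| <=
    `|x - z| * ((size r)%:R * `|q.[x]|) + `|x - z| * `|q.[x]|.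
  move=> m0 mz h; apply: le_trans (ler_wpM2l m0 D) _.
  rewrite mulrDr addrC lerD//; last exact: ler_wpM2r.
  by rewrite mulrCA; apply: ler_wpM2l.
have [yz|zy] := real_leP (normr_real (x - y)) (normr_real (x - z)).
  by exists y; [rewrite in_cons yr orbT | exact: Q].
exists z; first exact: mem_head.
by apply: Q => //; apply: le_trans hy; apply: ler_wpM2r => //; exact: ltW.
Qed.

Lemma near_root p x : (1 < size p)%N ->
  exists2 z, root p z & `|x - z| * `|p^`().[x]| <= (size p).-1%:R * `|p.[x]|.
Proof.
move=> p1; have [r pE] := closed_field_poly_normal p.
have p0 : p != 0 by rewrite -size_poly_gt0 ltnW.
have c0 : lead_coef p != 0 by rewrite lead_coef_eq0.
have sE : size p = (size r).+1 by rewrite pE size_scale// size_prod_XsubC.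
have rn : r != [::] by rewrite -size_eq0 -lt0n; move: p1; rewrite sE ltnS.
have [z zr h] := near_root_prod x rn; exists z.
  by rewrite pE rootZ// root_prod_XsubC.
rewrite sE [X in X^`()]pE [X in _ <= _ * `|X.[_]|]pE derivZ !hornerZ !normrM.
by rewrite mulrCA [leRHS]mulrCA; apply: ler_wpM2l.
Qed.
End NearRoot.

(** * A root of the characteristic quartic *)

Section Eigen.
Variables (R : realType) (a b : R).
Hypotheses (a0 : 0 < a) (b0 : 0 < b).

Let tau := Num.sqrt ((a + b) / 2).

(** The bound of [near_root] is applied at x = i tau, the zero of 2 x^2 + a + b. There the
    polynomial takes the value -g (a - b)^2 / 4, free of d, while its derivative is -2 d (a + b);
    the degree 4 supplies the remaining factor. *)
Lemma char_root g d : 0 < g -> 0 < d -> exists2 s : R[i],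
  g%:C * (s ^+ 2 + a%:C) * (s ^+ 2 + b%:C) + d%:C * s * (2 * s ^+ 2 + (a + b)%:C) = 0 &
  complex.Re `|'i * tau%:C - s| <= (a - b) ^+ 2 / (2 * (a + b)) * (g / d).
Proof.
move=> g0 d0.
have gC : g%:C != 0 :> R[i] by rewrite eq_complex /= eqxx andbT gt_eqF.
have ab0 : 0 < a + b by rewrite addr_gt0.
pose q : {poly R[i]} := ('X^2 + a%:C%:P) * ('X^2 + b%:C%:P).
pose l : {poly R[i]} := 'X * (2 *: 'X^2 + (a + b)%:C%:P).
pose p := g%:C *: q + d%:C *: l.
have sq : size (g%:C *: q) = 5.
  by rewrite size_scale// size_mul ?size_XnaddC// -size_poly_eq0 size_XnaddC.
have sl : (size (d%:C *: l) <= 4)%N.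
  apply: leq_trans (size_scale_leq _ _) _; apply: leq_trans (size_polyMleq _ _) _.
  rewrite size_polyX /= add1n ltnS.
  apply: leq_trans (size_polyD _ _) _; rewrite geq_max.
  apply/andP; split; last by rewrite (leq_trans (size_polyC_leq1 _)).
  by rewrite (leq_trans (size_scale_leq _ _))// size_polyXn.
have hE := (hornerXn, hornerX, hornerC, hornerD, hornerZ, hornerM).
have dE := (derivXn, derivX, derivC, derivD, derivZ, derivM).
have sp : size p = 5 by rewrite size_polyDl ?sq.
have [|s sr hs] := @near_root _ p ('i * tau%:C); first by rewrite sp.
exists s.
  by move/rootP: sr; rewrite !hE => <-; ring.
have iE : ('i * tau%:C) ^+ 2 = - ((a + b) / 2)%:C :> R[i].
  have t2 : tau * tau = (a + b) / 2 by rewrite -expr2 sqr_sqrtr// divr_ge0// ltW.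
  by apply/eqP; rewrite eq_complex /=; apply/andP; split; apply/eqP; nra.
have e1 : p.['i * tau%:C] = (- (g * (a - b) ^+ 2 / 4))%:C.
  rewrite !hE iE.
  by apply/eqP; rewrite eq_complex /=; apply/andP; split; apply/eqP; field.
have e2 : p^`().['i * tau%:C] = (- (2 * d * (a + b)))%:C.
  have z0 : 2 * ('i * tau%:C) ^+ 2 + (a + b)%:C = 0 :> R[i].
    by rewrite iE; apply/eqP; rewrite eq_complex /=; apply/andP; split; apply/eqP; field.
  rewrite !dE !hE /= !expr1; set x := 'i * tau%:C in iE z0 *.
  transitivity (2 * g%:C * x * (2 * x ^+ 2 + (a + b)%:C) +
    d%:C * (2 * x ^+ 2 + (a + b)%:C) + 4 * d%:C * x ^+ 2).
    by rewrite rmorphD; ring.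
  rewrite z0 iE.
  by apply/eqP; rewrite eq_complex /=; apply/andP; split; apply/eqP; field.
have RC (r : R) : `|r%:C| = `|r|%:C :> R[i].
  by rewrite normc_def /= expr0n addr0 sqrtr_sqr.
move: hs; rewrite sp e1 e2 !RC !normrN.
have -> : `|'i * tau%:C - s| = (complex.Re `|'i * tau%:C - s|)%:C by rewrite normc_def.
set N := complex.Re _.
have -> : 5%R.-1%:R = 4%:C :> R[i] by rewrite rmorph_nat.
rewrite -!rmorphM lecR (ger0_norm (_ : 0 <= g * _ / 4)); last first.
  by rewrite divr_ge0// mulr_ge0 ?sqr_ge0// ltW.
rewrite ger0_norm; last by rewrite !mulr_ge0// ltW.
move=> h.
have -> : (a - b) ^+ 2 / (2 * (a + b)) * (g / d) =
    4 * (g * (a - b) ^+ 2 / 4) / (2 * d * (a + b)).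
  by field; rewrite !gt_eqF.
by rewrite ler_pdivlMr// !mulr_gt0.
Qed.
End Eigen.

(** * Sectors and limits in the complex plane *)

Section ComplexLimits.
Variable R : realType.

Lemma complex_punctured_lt (f : R[i] -> \bar R) :
  f h @[h --> (0 : (R[i])^o)^'] --> (0 : \bar R)%E ->
  forall e : R, 0 < e -> exists2 d : R, 0 < d &
    forall h : R[i], h != 0 -> complex.Re `|h| < d -> (f h < e%:E)%E.
Proof.
move=> f0 e e0.
have : nbhs (0%:E : \bar R) [set y | (y < e%:E)%E].
  by apply: open_nbhs_nbhs; split; [exact: lray_open|rewrite /= lte_fin].
move=> /f0 [d /= d0 hd].
have dE : d = (complex.Re d)%:C by rewrite RRe_real// gtr0_real.
have dr : 0 < complex.Re d by rewrite dE ltcR in d0.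
exists (complex.Re d) => // h h0 hh.
apply: (hd h _ h0); rewrite /ball_ /= sub0r normrN dE.
by move: hh; rewrite normc_def ltcR; case: (h).
Qed.

(** The point 1 - i t has argument -atan t and modulus 1 / cos(atan t). *)
Lemma sector_line (d : R) : 0 < d -> exists2 e : R, 0 < e &
  forall t : R, `|t| < e -> sector d (1 - 'i * t%:C).
Proof.
move=> d0.
have ca : atan x @[x --> (0 : R)] --> (0 : R).
  by rewrite -[X in _ --> X]atan0; exact: continuous_atan.
move/cvgrPdist_lt/(_ d d0) : ca => [e /= e0 he].
exists e => // t te; have := he t; rewrite /ball_ /= sub0r normrN sub0r normrN => /(_ te) at_d.
have c0 : 0 < cos (atan t) by apply: cos_gt0_pihalf; rewrite atan_gtNpi2 atan_ltpi2.
exists (cos (atan t))^-1, (- atan t); split; [by rewrite invr_gt0|by rewrite normrN|].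
have st : (cos (atan t))^-1 * sin (atan t) = t by rewrite mulrC; exact: atanK.
rewrite cosN sinN mulVf ?gt_eqF// mulrN st.
by apply/eqP; rewrite eq_complex /=; apply/andP; split; apply/eqP; ring.
Qed.

Lemma sector_pos (d r : R) : 0 < d -> 0 < r -> sector d r%:C.
Proof.
by move=> d0 r0; exists r, 0; rewrite normr0 cos0 sin0 mulr1 mulr0; split.
Qed.
End ComplexLimits.

(** * Eigenvectors of the system and the resolvent from below *)

Section Eigenvectors.
Variables (R : realType) (H : completeNormedModType R[i]).
Variable dot : {dot H for Num.conj}.
Hypothesis dotE : forall x : H, `|x| ^+ 2 = dot x x.
Local Notation quad := (H * H * H * H)%type.
Variables (A : operator H) (P : nat -> H -> H) (mu : nat -> R) (m0 : R).
Hypothesis SP : spectrum dot A P mu m0.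
Variables (a b gamma theta : R).
Hypotheses (a0 : 0 < a) (b0 : 0 < b) (ab : a != b).
Hypotheses (gamma0 : 0 < gamma) (theta1 : theta <= 1).
Implicit Types (X Y Z W F : quad).
Local Notation ip4 := (ip4 dot a b).
Local Notation blk := (blk a b).
Local Notation HH := (energy_space dot A a b).
Local Notation AA := (system_operator dot A a b gamma theta).
Local Notation freq := (freq mu).
Local Notation dmp := (dmp mu gamma theta).
Local Notation coords := (coords P mu).
Local Notation carrier := (@carrier R HH).
Local Notation nrm := (@nrm R HH).
Let dP := spec_diag SP.

(** An eigenvector for g s has v = s u, z = s w and (s^2 + a) u = (s^2 + b) w; the choice of [U] and
    [W] solves the last relation. *)
Lemma blk_eigen g d (s : R[i]) (e : H) :
  g%:C * (s ^+ 2 + a%:C) * (s ^+ 2 + b%:C) + d%:C * s * (2 * s ^+ 2 + (a + b)%:C) = 0 ->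
  let U := (s ^+ 2 + b%:C) *: e in let W := (s ^+ 2 + a%:C) *: e in
  blk g d (U, s *: U, W, s *: W) = (g%:C * s) *: (U, s *: U, W, s *: W).
Proof.
move=> E U W; rewrite /U /W; congr (_, _, _, _); rewrite /= ?scalerA//.
- rewrite -!scalerDl scalerA -scalerDl -scaleNr; congr (_ *: _).
  by apply/eqP; rewrite -subr_eq0 -oppr_eq0 -E !rmorphD !rmorphM; apply/eqP; ring.
- rewrite -!scalerDl scalerA -scalerDl -scaleNr; congr (_ *: _).
  by apply/eqP; rewrite -subr_eq0 -oppr_eq0 -E !rmorphD !rmorphM; apply/eqP; ring.
Qed.

Let c0 := (a - b) ^+ 2 / (2 * (a + b)).
Let tau := Num.sqrt ((a + b) / 2).

Lemma system_eigen n x : P n x != 0 -> exists (s : R[i]) Z,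
  [/\ dom AA Z /\ AA Z = s *: Z,
      0 < ip4 (coords n Z) (coords n Z) /\ nrm Z ^+ 2 <= ip4 (coords n Z) (coords n Z),
      `|complex.Re s| <= c0 * (freq n ^+ 2 / dmp n)
    & freq n * (tau - c0 * (freq n / dmp n)) <= complex.Im s].
Proof.
set e := P n x => e0.
have g0 := freq_gt0 SP n; have d0 := dmp_gt0 SP theta gamma0 n.
have [s sE sN] := char_root a0 b0 g0 d0.
pose X : quad := ((s ^+ 2 + b%:C) *: e, s *: ((s ^+ 2 + b%:C) *: e),
  (s ^+ 2 + a%:C) *: e, s *: ((s ^+ 2 + a%:C) *: e)).
have XE : blk (freq n) (dmp n) X = ((freq n)%:C * s) *: X by exact: blk_eigen.
have PX : quad_map (P n) X = X.
  by congr (_, _, _, _); rewrite /= !(diagZ dP) (diag_idem dP).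
pose x_ m := if m == n then X else 0.
have [||Z cZ zE] := @coords_synth _ _ _ dotE _ _ _ _ SP a b a0 b0 x_
    (\sum_(i < n.+1) ip4 (x_ i) (x_ i)).
- by move=> m; rewrite /x_; case: eqP => [->//|_]; rewrite /= !(diag0 dP).
- move=> m; apply: (@psum_stop _ (fun i => ip4 (x_ i) (x_ i))) => i.
    exact: ip4_ge0.
  by move=> ni; rewrite /x_ gtn_eqF// ip4_00.
exists ((freq n)%:C * s), Z; split.
- apply/(graphP dotE SP a b gamma theta1); split => //.
    exact: (carrierZ dotE SP).
  move=> m; rewrite (coordsZ SP) zE /x_; case: eqP => [->//|_].
  by rewrite blk0 scaler0.
- split; last first.
    have cv := @nrm_cvg _ _ _ dotE _ _ _ _ SP _ _ a0 b0 _ cZ.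
    apply: (cvgr_to_le cv); exists 0%N => // m _.
    rewrite (eq_bigr (fun i : 'I_m => ip4 (x_ i) (x_ i))); last by move=> i _; rewrite zE.
    apply: le_trans (@psum_stop _ (fun i => ip4 (x_ i) (x_ i)) n.+1 m _ _) _.
    + by move=> i; exact: ip4_ge0.
    + by move=> i ni; rewrite /x_ gtn_eqF// ip4_00.
    + have h0 : \sum_(i < n) ip4 (x_ i) (x_ i) = 0.
        apply: (@psum_eq0 _ (fun i => ip4 (x_ i) (x_ i))) => i ni.
        by rewrite /x_ ltn_eqF// ip4_00.
      have -> : \sum_(i < n.+1) ip4 (x_ i) (x_ i) = ip4 (x_ n) (x_ n).
        by rewrite big_ord_recr h0; exact: add0r.
      by rewrite zE.
  rewrite zE /x_ eqxx ltNge; apply/negP => /(ip4_eq0 dotE a0 b0)[u0 _ w0 _].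
  (* The eigenvector is not zero: if both displacements vanished, subtracting them would give (a -
     b) e = 0. *)
  have : ((s ^+ 2 + a%:C) - (s ^+ 2 + b%:C)) *: e = 0 by rewrite scalerBl u0 w0 subr0.
  apply/eqP; rewrite scaler_eq0 negb_or e0 andbT.
  rewrite opprD addrACA subrr add0r -rmorphB/= eq_complex /= eqxx andbT subr_eq0//.
- have h1 : `|complex.Re s| <= complex.Re `|'i * tau%:C - s|.
    have := normc_ge_Re ('i * tau%:C - s).
    case: s {sE sN X XE PX x_ zE} => s1 s2; rewrite normc_def /= lecR.
    by rewrite !mul0r mulr0 subrr sub0r normrN.
  have -> : complex.Re ((freq n)%:C * s) = freq n * complex.Re s.
    by case: s {sE sN X XE PX x_ zE h1} => s1 s2 /=; rewrite mul0r subr0.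
  rewrite normrM gtr0_norm// expr2 -(mulrA (freq n)) mulrCA ler_pM2l//.
  exact: le_trans h1 sN.
- have h1 : `|tau - complex.Im s| <= complex.Re `|'i * tau%:C - s|.
    case: s {sE sN X XE PX x_ zE} => s1 s2; rewrite normc_def /= .
    rewrite -[leLHS]sqrtr_sqr; apply: ler_wsqrtr.
    by rewrite (_ : 0 * 0 + 1 * tau - s2 = tau - s2) ?lerDr ?sqr_ge0//; ring.
  have -> : complex.Im ((freq n)%:C * s) = freq n * complex.Im s.
    by case: s {sE sN X XE PX x_ zE h1} => s1 s2 /=; rewrite mul0r addr0.
  rewrite ler_pM2l//.
  by have := le_trans h1 sN; rewrite -/c0 ler_norml => /andP[_]; lra.
Qed.

(** For theta > 1/2 the ratio g / d tends to 0, so Im s is eventually at least g tau / 2, while |Re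
    s| is at most c0 g^2 / d, a multiple of g^(2 (1 - theta)). *)
Lemma eigen_large : 2^-1 < theta -> exists2 C : R, 0 <= C & forall M,
  exists (s : R[i]) Z n, [/\ dom AA Z /\ AA Z = s *: Z,
    0 < ip4 (coords n Z) (coords n Z) /\ nrm Z ^+ 2 <= ip4 (coords n Z) (coords n Z),
    M < complex.Im s
    & `|complex.Re s| <= C * complex.Im s `^ (2 * (1 - theta))].
Proof.
move=> th; have ab0 : 0 < (a + b) / 2 by rewrite divr_gt0// addr_gt0.
have t0 : 0 < tau by rewrite sqrtr_gt0.
have c00 : 0 <= c0 by rewrite divr_ge0 ?sqr_ge0//; lra.
exists (c0 / gamma * (2 / tau) `^ (2 * (1 - theta))) => [|M].
  by rewrite mulr_ge0 ?powR_ge0// divr_ge0// ltW.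
pose q := 2 * c0 / (gamma * tau); pose r := (theta - 2^-1)^-1.
have q0 : 0 <= q by apply: divr_ge0; apply: mulr_ge0 => //; exact: ltW.
have r0 : 0 < r by rewrite invr_gt0 subr_gt0.
(* The first summand makes g tau / 2 exceed |M| + 1; the second makes mu_n^(theta - 1/2) at least q,
   that is, c0 g / d <= tau / 2. *)
have [n [x [mn xn]]] := spec_unbounded SP ((2 * (`|M| + 1) / tau) ^+ 2 + q `^ r).
have [s [Z [sZ Z0 hr hi]]] := system_eigen xn.
have m0' := mu_gt0 SP n; have g0 := freq_gt0 SP n; have gg := freq_sqr SP n.
have h1 : 2 * (`|M| + 1) < freq n * tau.
  rewrite -ltr_pdivrMr// -(@ltr_pXn2r _ 2)// ?nnegrE ?(ltW g0)//; last first.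
    by rewrite divr_ge0// ?(ltW t0)// mulr_ge0// addr_ge0.
  by rewrite [ltRHS]expr2 gg; have := powR_ge0 q r; lra.
have h2 : q <= mu n `^ (theta - 2^-1).
  have -> : q = (q `^ r) `^ (theta - 2^-1).
    by rewrite -powRrM mulVf ?powRr1// gt_eqF// subr_gt0.
  apply: ge0_ler_powR; rewrite ?nnegrE ?powR_ge0 ?subr_ge0 ?ltW//.
  by apply: le_lt_trans mn; rewrite lerDr sqr_ge0.
have h3 : c0 * (freq n / dmp n) <= tau / 2.
  have e : mu n `^ theta = freq n * mu n `^ (theta - 2^-1).
    by rewrite -(powR2_freq SP) -powRD ?(gt_eqF m0') ?implybT// addrC subrK.
  rewrite /dmp e; have p0 : 0 < mu n `^ (theta - 2^-1) by rewrite powR_gt0.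
  have -> : c0 * (freq n / (gamma * (freq n * mu n `^ (theta - 2^-1)))) =
      q * tau / 2 / mu n `^ (theta - 2^-1).
    by rewrite /q; field; rewrite !gt_eqF.
  by rewrite ler_pdivrMr// [leRHS]mulrC mulrA ler_pM2r// ler_pM2r.
have h4 : freq n * (tau / 2) <= complex.Im s.
  by apply: le_trans hi; rewrite ler_pM2l//; lra.
have s0 : 0 < complex.Im s by apply: lt_le_trans h4; rewrite mulr_gt0// divr_gt0.
exists s, Z, n; split => //.
  by have := ler_norm M; nra.
apply: le_trans hr _.
have -> : freq n ^+ 2 / dmp n = gamma^-1 * freq n `^ (2 * (1 - theta)).
  have f2 : freq n `^ 2 = mu n by rewrite powR_mulrn ?expr2// ltW.
  rewrite expr2 gg powRrM f2 powRB ?(gt_eqF m0') ?implybT// powRr1 ?ltW//.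
  by rewrite /dmp invfM mulrCA.
rewrite -2!(mulrA c0) -(mulrA gamma^-1); apply: ler_wpM2l => //.
rewrite ler_pM2l ?invr_gt0// -powRM; [|by rewrite divr_ge0// ltW|exact: ltW].
apply: ge0_ler_powR; rewrite ?nnegrE ?(ltW g0)//; first by rewrite mulr_ge0// subr_ge0.
  by rewrite mulr_ge0 ?(ltW s0)// divr_ge0// ltW.
by rewrite mulrAC ler_pdivlMr//; lra.
Qed.

Lemma eigenZ (s c : R[i]) Z : dom AA Z -> AA Z = s *: Z ->
  dom AA (c *: Z) /\ AA (c *: Z) = s *: (c *: Z).
Proof.
move=> dZ sZ; have [cZ cA] := dom_carrier dotE SP theta1 dZ.
apply/(graphP dotE SP a b gamma theta1); split; [exact: (carrierZ dotE SP)| |].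
  by do 2 apply: (carrierZ dotE SP).
move=> n; have E := dom_coords dotE SP theta1 n dZ.
rewrite scalerA mulrC -scalerA -sZ !(coordsZ SP) E.
by rewrite -[c *: _ in RHS]addr0 blk_linear blk0 addr0.
Qed.

Lemma nrm_gt0 n Z : carrier Z -> 0 < ip4 (coords n Z) (coords n Z) -> 0 < nrm Z.
Proof.
move=> cZ h; rewrite lt_def nrm_ge0 andbT; apply/eqP => z0.
by have := coords_le dotE SP a0 b0 n cZ; rewrite z0 expr0n leNgt h.
Qed.

Lemma nrmZ (r : R) Z : carrier Z -> nrm (r%:C *: Z) = `|r| * nrm Z.
Proof.
move=> cZ; apply/eqP; rewrite eq_le (nrmZ_le dotE SP a0 b0 r cZ) andTb.
have [->|r0] := eqVneq r 0; first by rewrite normr0 mul0r; exact: nrm_ge0.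
have := nrmZ_le dotE SP a0 b0 r^-1 (carrierZ dotE SP r%:C cZ).
rewrite scalerA (_ : r^-1%:C * r%:C = 1) ?scale1r ?normfV; last first.
  by apply/eqP; rewrite eq_complex /= !mulr0 mul0r subr0 addr0 mulVf// !eqxx.
by rewrite -ler_pdivlMl ?normr_gt0// mulrC invrK mulrC.
Qed.

(** At the height of the eigenvalue, i Im s - A acts on the eigenvector as - Re s, so the resolvent
    multiplies its norm by 1 / |Re s|. *)
Lemma resolvent_norm_ge (s : R[i]) Z n : dom AA Z -> AA Z = s *: Z ->
  0 < ip4 (coords n Z) (coords n Z) ->
  resolvent_set (X := HH) AA ('i * (complex.Im s)%:C) ->
  complex.Re s != 0 /\
  ((`|complex.Re s|^-1)%:E <= resolvent_norm (X := HH) AA (complex.Im s))%E.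
Proof.
move=> dZ sZ Z0 [rs [M rM]]; have [cZ _] := dom_carrier dotE SP theta1 dZ.
have nZ := nrm_gt0 cZ Z0.
set l := complex.Im s; set p := complex.Re s.
have E c : ('i * l%:C) *: (c%:C *: Z) - AA (c%:C *: Z) = (- (p * c))%:C *: Z.
  have [_ ->] := eigenZ c%:C dZ sZ.
  rewrite -scalerBl scalerA; congr (_ *: _); rewrite /l /p.
  case: s {sZ rs rM l p} => s1 s2; apply/eqP; rewrite eq_complex /=.
  by apply/andP; split; apply/eqP; ring.
have p0 : p != 0.
  apply/eqP => p0; have := rM Z dZ.
  have := E 1; rewrite rmorph1 scale1r => ->.
  by rewrite p0 mul0r oppr0 nrmZ// normr0 mul0r mulr0 leNgt nZ.
split => //; pose c := (nrm Z)^-1.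
pose X := c%:C *: Z.
have cX : carrier X by exact: (carrierZ dotE SP).
have X1 : nrm X <= 1 by rewrite nrmZ// gtr0_norm ?invr_gt0// mulVf// gt_eqF.
have Yd : dom AA ((- (c / p))%:C *: Z) by have [] := eigenZ (- (c / p))%:C dZ sZ.
have YE : ('i * l%:C) *: ((- (c / p))%:C *: Z) - AA ((- (c / p))%:C *: Z) = X.
  by rewrite E; congr (_%:C *: _); field.
apply: ereal_sup_ubound; exists X => //.
rewrite /resolvent; case: xgetP => [W _ hW|/(_ ((- (c / p))%:C *: Z))[]//].
have [V [_ uV]] := rs X cX.
have <- : (- (c / p))%:C *: Z = W by rewrite -(uV W hW) -(uV _ (conj Yd YE)).
rewrite nrmZ// normrN normrM (gtr0_norm (_ : 0 < c)) ?invr_gt0//.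
by rewrite normfV mulrAC mulVf ?mul1r// gt_eqF.
Qed.

Lemma limsup_resolvent r : 2^-1 < theta -> 2 * (1 - theta) < r ->
  (forall l : R, resolvent_set (X := HH) AA ('i * l%:C)) ->
  limf_esup (fun l : R => (`|l| `^ r)%:E * resolvent_norm (X := HH) AA l)%E
    (@abs_pinfty R) = +oo%E.
Proof.
move=> th rq rs; set q := 2 * (1 - theta) in rq.
have [C C0 hC] := eigen_large th.
apply/eqP; rewrite limf_esupE eq_le leey /=.
apply: le_ereal_inf_tmp => _ [B [M BM] <-].
rewrite leye_eq; apply/eqP/eqyP => N N0.
have k0 : 0 < r - q by rewrite subr_gt0.
(* With C + 1 in place of C the constant is positive even if C = 0. Beyond K^(1/(r - q)) the
   quotient of l^r by (C + 1) l^q exceeds N. *)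
pose K := N * (C + 1); have K0 : 0 < K by rewrite mulr_gt0// ltr_wpDl.
have [s [Z [n [[dZ sZ] [Z0 _] sM sC]]]] := hC (`|M| + K `^ (r - q)^-1).
set l := complex.Im s in sM sC.
have [p0 hp] := resolvent_norm_ge dZ sZ Z0 (rs l).
have Kl : K `^ (r - q)^-1 < l by have := normr_ge0 M; lra.
have l0 : 0 < l by apply: le_lt_trans Kl; exact: powR_ge0.
apply: ereal_sup_ge; exists ((`|l| `^ r)%:E * resolvent_norm (X := HH) AA l)%E.
  exists l => //; apply: BM; rewrite gtr0_norm//.
  by have := ler_norm M; have := powR_ge0 K (r - q)^-1; lra.
apply: le_trans (lee_wpmul2l _ hp); last by rewrite lee_fin powR_ge0.
rewrite -EFinM lee_fin ler_pdivlMr ?normr_gt0// (gtr0_norm l0).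
apply: le_trans (_ : N * ((C + 1) * l `^ q) <= _).
  rewrite ler_pM2l//; apply: le_trans sC _; rewrite ler_wpM2r ?powR_ge0//; lra.
rewrite mulrA -ler_pdivlMr ?powR_gt0// -powRB ?(gt_eqF l0) ?implybT//.
rewrite -[leLHS](_ : (K `^ (r - q)^-1) `^ (r - q) = _).
  by apply: ge0_ler_powR; rewrite ?nnegrE ?powR_ge0 ?ltW.
by rewrite -powRrM mulVf ?powRr1 ?ltW// gt_eqF.
Qed.

Let ip4_0 := ip4_ge0 dotE a0 b0.
Let iD X Y Z : ip4 (X + Y) Z = ip4 X Z + ip4 Y Z.
Proof. by rewrite !ip4_lyap lyapDl. Qed.
Let iZ (s : R) X Y : ip4 (s%:C *: X) Y = s * ip4 X Y.
Proof. by rewrite !ip4_lyap lyapZl. Qed.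
Let iC X Y : ip4 X Y = ip4 Y X.
Proof. by rewrite !ip4_lyap lyapC. Qed.
Let i2 X : ip4 X X <= 2 * ip4 X X.
Proof. by have := ip4_0 X; lra. Qed.

Lemma ip4_scaler (s : R[i]) X : ip4 X (s *: X) = complex.Re s * ip4 X X.
Proof.
have -> : s *: X = (complex.Re s)%:C *: X + (complex.Im s)%:C *: ('i *: X).
  rewrite scalerA -scalerDl; congr (_ *: _); case: s => s1 s2.
  by apply/eqP; rewrite eq_complex /=; apply/andP; split; apply/eqP; ring.
rewrite iC iD !iZ (iC _ X) [X in _ * X + _]ip4_lyap [X in _ + _ * X]ip4_lyap lyap_i mulr0 addr0.
by rewrite -ip4_lyap.
Qed.

(** Gronwall's inequality for the opposite of the squared norm, whose derivative is exactly 2 Re s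
    times itself because i Im s z is orthogonal to z. The curve is required up to 2 T to have
    two-sided derivatives up to T. *)
Lemma eigen_growth (z : R -> quad) (s : R[i]) n T : 0 < T ->
  (forall t, 0 <= t -> t < 2 * T -> carrier (z t)) ->
  (forall t, 0 < t -> t <= T ->
    nrm ((h^-1)%:C *: (z (t + h) - z t) - s *: z t) @[h --> 0^'] --> (0 : R)) ->
  ip4 (coords n (z t)) (coords n (z t)) @[t --> 0^'+] -->
    ip4 (coords n (z 0)) (coords n (z 0)) ->
  expR (2 * complex.Re s * T) * ip4 (coords n (z 0)) (coords n (z 0)) <=
  ip4 (coords n (z T)) (coords n (z T)).
Proof.
move=> T0 cz zD z0.
pose f t := - ip4 (coords n (z t)) (coords n (z t)).
pose f' t := - (2 * ip4 (coords n (z t)) (coords n (s *: z t))).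
have h : f T <= expR (2 * complex.Re s * T) * f 0.
  apply: (@gronwall_le _ f f') => //.
  - move=> t t0 tT; apply: is_deriveN.
    have cZ : carrier (s *: z t).
      by apply: (carrierZ dotE SP); apply: cz; [exact: ltW|lra].
    apply: (@coords_deriv _ _ _ dotE _ _ _ _ SP a b a0 b0 ip4 n z (s *: z t) t (Num.min t T)) => //.
    + by rewrite lt_min t0.
    + by move=> u; rewrite lt_min !ltr_norml => /andP[h1 h2]; apply: cz; lra.
    + exact: zD.
  - by move=> t t0 tT; rewrite /f' /f (coordsZ SP) ip4_scaler; lra.
  - exact: cvgN.
by move: h; rewrite /f mulrN lerN2.
Qed.

(** * No analytic extension to a sector *)

Section Extension.
Variable S : R -> quad -> quad.
Hypotheses (S_C0 : C0_semigroup (X := HH) S) (S_contr : contractive (X := HH) S).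
Hypothesis S_gen : generator (X := HH) S AA.

Lemma sg_eigen_ge (s : R[i]) Z n : dom AA Z -> AA Z = s *: Z ->
  expR (2 * complex.Re s) * ip4 (coords n Z) (coords n Z) <=
  ip4 (coords n (S 1 Z)) (coords n (S 1 Z)).
Proof.
move=> dZ sZ; have [cZ _] := dom_carrier dotE SP theta1 dZ.
have S0 : S 0 Z = Z by case: S_C0 => _ h _ _; exact: h.
have := @eigen_growth (S^~ Z) s n 1 ltr01.
rewrite S0 => h; rewrite -[2 * complex.Re s]mulr1; apply: h.
- by move=> t t0 _; exact: sg_carrier.
- move=> t t0 _; rewrite -(sgZ dotE SP S_C0 s (ltW t0) cZ) -sZ.
  exact: (sg_deriv dotE SP a0 b0 theta1 S_C0 S_contr S_gen).
- apply: (form_cvg iD iZ iC ip4_0).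
  have q2 : nrm (S h Z - Z) ^+ 2 @[h --> 0^'+] --> (0 : R).
    have [_ _ _ /(_ _ cZ) zc] := S_C0.
    by have h2 := cvgM zc zc; rewrite mulr0 in h2; exact: h2.
  apply: (squeeze_cvgr _ (cvg_cst 0) q2); near=> h.
  rewrite ip4_0 andTb -(coordsB SP).
  have h0 : 0 < h by near: h; exact: nbhs_right_gt.
  apply: (coords_le dotE SP a0 b0); apply: (carrierB dotE SP) => //.
  by apply: sg_carrier => //; exact: ltW.
Unshelve. all: by end_near. Qed.

Variables (d : R) (T : R[i] -> quad -> quad).
Hypothesis d0 : 0 < d.
Hypothesis T_bl : forall z, sector d z -> bounded_linear (X := HH) (T z).
Hypothesis T_S : forall t Z, 0 <= t -> carrier Z -> T t%:C Z = S t Z.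
Hypothesis T_D : forall z1 z2 Z, (sector d `|` [set 0]) z1 -> (sector d `|` [set 0]) z2 ->
  carrier Z -> T (z1 + z2) Z = T z1 (T z2 Z).
Hypothesis T_hol : forall z, sector d z ->
  exists2 D : quad -> quad, bounded_linear (X := HH) D &
    opnorm (X := HH) (fun x => h^-1 *: (T (z + h) x - T z x) - D x)
      @[h --> (0 : (R[i])^o)^'] --> (0 : \bar R)%E.

Lemma carrier_small_eq X Y : carrier X -> carrier Y ->
  (forall e, 0 < e -> nrm (X - Y) < e) -> X = Y.
Proof.
move=> cX cY XY; have cXY := carrierB dotE SP cX cY.
have n0 : nrm (X - Y) = 0.
  apply/eqP; rewrite eq_le nrm_ge0 andbT; apply/ler_addgt0Pr => e /XY.
  by rewrite add0r; exact: ltW.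
apply: (coords_inj dotE SP) => n; apply/eqP; rewrite -subr_eq0 -(coordsB SP); apply/eqP.
apply: (ip4_eq0 dotE a0 b0); apply: le_trans (coords_le dotE SP a0 b0 n cXY) _.
by rewrite n0 expr0n.
Qed.

(** The complex derivative D exists by holomorphy, so it can be identified along positive real
    increments h, where T(z + h) Z = T(z) S(h) Z and the quotient tends to T(z) applied to the
    generator at Z. *)
Lemma extension_deriv z (s : R[i]) Z : sector d z -> dom AA Z -> AA Z = s *: Z ->
  nrm Z <= 1 -> forall e, 0 < e -> exists2 r, 0 < r &
  forall h : R[i], h != 0 -> complex.Re `|h| < r ->
  nrm (h^-1 *: (T (z + h) Z - T z Z) - s *: T z Z) < e.
Proof.
move=> dz dZ sZ Z1; have [cZ _] := dom_carrier dotE SP theta1 dZ.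
have [D [cD _ _] Dlim] := T_hol dz.
have lim e : 0 < e -> exists2 r, 0 < r & forall h : R[i], h != 0 ->
    complex.Re `|h| < r -> nrm (h^-1 *: (T (z + h) Z - T z Z) - D Z) < e.
  move=> e0; have [r r0 hr] := complex_punctured_lt Dlim e0.
  exists r => // h h0 hh; rewrite -lte_fin; apply: le_lt_trans (hr h h0 hh).
  by apply: ereal_sup_ubound; exists Z.
suff <- : D Z = s *: T z Z by [].
have [cT Tlin [M TM]] := T_bl dz.
have csT : carrier (s *: T z Z) by apply: (carrierZ dotE SP); exact: cT.
apply: carrier_small_eq => //; first exact: cD.
move=> e e0; have e4 : 0 < e / 4 by lra.
have [r r0 hr] := lim _ e4.
have M1 : 0 < `|M| + 1 by rewrite ltr_wpDl.
have eM : 0 < e / 4 / (`|M| + 1) by rewrite divr_gt0.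
have /right_lim0P/(_ _ eM)[r1 r10 hr1] := sg_quot dotE SP theta1 S_gen dZ.
pose h := Num.min r r1 / 2.
have h0 : 0 < h by rewrite divr_gt0// lt_min r0.
have hr' : h < r by rewrite ltr_pdivrMr// gt_min; apply/orP; left; lra.
have hr1' : h < r1 by rewrite ltr_pdivrMr// gt_min; apply/orP; right; lra.
have hC0 : h%:C != 0 :> R[i] by rewrite eq_complex /= eqxx andbT gt_eqF.
have hN : complex.Re `|h%:C| < r by rewrite normc_def /= expr0n addr0 sqrtr_sqr gtr0_norm.
have hV : (h%:C)^-1 = (h^-1)%:C :> R[i] by rewrite fmorphV.
have cS : carrier (S h Z) by apply: sg_carrier => //; exact: ltW.
have cSZ : carrier (S h Z - Z) by exact: (carrierB dotE SP).
have cz := carrier0 dotE SP a b : carrier 0.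
have T0 : T z 0 = 0.
  by have := Tlin (-1) 0 0 cz cz; rewrite scaler0 addr0 scaleN1r addNr.
have TZ c X : carrier X -> T z (c *: X) = c *: T z X.
  by move=> cX; rewrite -[c *: X]addr0 Tlin// T0 addr0.
have TB X Y : carrier X -> carrier Y -> T z (X - Y) = T z X - T z Y.
  by move=> cX cY; rewrite addrC -scaleN1r Tlin// scaleN1r addrC.
have ThE : T (z + h%:C) Z = T z (S h Z).
  rewrite T_D//; [|by left|by left; exact: sector_pos].
  by rewrite T_S// ltW.
pose Q := (h%:C)^-1 *: (T (z + h%:C) Z - T z Z).
have cQ : carrier Q.
  rewrite /Q ThE; apply: (carrierZ dotE SP); apply: (carrierB dotE SP); exact: cT.
have QE : Q - s *: T z Z = T z ((h^-1)%:C *: (S h Z - Z) - AA Z).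
  rewrite TB; [|exact: (carrierZ dotE SP)|by rewrite sZ; exact: (carrierZ dotE SP)].
  by rewrite TZ// TB// sZ TZ// /Q ThE hV.
have q1 : nrm (Q - s *: T z Z) <= e / 4.
  rewrite QE; have cq : carrier ((h^-1)%:C *: (S h Z - Z) - AA Z).
    apply: (carrierB dotE SP); [exact: (carrierZ dotE SP)|rewrite sZ; exact: (carrierZ dotE SP)].
  apply: le_trans (TM _ cq) _.
  have := hr1 h h0 hr1'; rewrite ger0_norm ?nrm_ge0// ltr_pdivlMr// => hh.
  have n0 := @nrm_ge0 _ _ dot A a b ((h^-1)%:C *: (S h Z - Z) - AA Z).
  have MM := ler_norm M.
  by apply: le_trans (ltW hh); rewrite mulrC; apply: ler_wpM2l => //; lra.
have q2 : nrm (D Z - Q) < e / 4.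
  rewrite -opprB; apply: le_lt_trans (nrmN dotE SP a0 b0 _) (hr _ hC0 hN).
  by apply: (carrierB dotE SP) => //; exact: cD.
have -> : D Z - s *: T z Z = (D Z - Q) + (Q - s *: T z Z) by rewrite addrA subrK.
apply: le_lt_trans (nrmD2 dotE SP a0 b0 _ _) _.
- by apply: (carrierB dotE SP) => //; exact: cD.
- exact: (carrierB dotE SP).
- lra.
Qed.

Lemma nrm_scale_i (l : R) X : carrier X -> nrm (('i * l%:C) *: X) <= `|l| * nrm X.
Proof.
move=> cX; apply: (nrm_le dotE SP a0 b0) => //; first exact: (carrierZ dotE SP).
by move=> n; rewrite (coordsZ SP) ip4_scale_i real_normK ?num_real.
Qed.

(** Moving along 1 - i t turns the eigenvalue s into - i s, whose real part is Im s: the oscillation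
    becomes growth. *)
Lemma extension_path (r : R) (s : R[i]) Z t :
  (forall u : R, `|u| < r -> sector d (1 - 'i * u%:C)) -> `|t| < r ->
  dom AA Z -> AA Z = s *: Z -> nrm Z <= 1 ->
  nrm ((h^-1)%:C *: (T (1 - 'i * (t + h)%:C) Z - T (1 - 'i * t%:C) Z) -
    (- 'i * s) *: T (1 - 'i * t%:C) Z) @[h --> 0^'] --> (0 : R).
Proof.
move=> hs tr dZ sZ Z1; have [cZ _] := dom_carrier dotE SP theta1 dZ.
have cT u : `|u| < r -> carrier (T (1 - 'i * u%:C) Z).
  by move=> ur; have [h _ _] := T_bl (hs u ur); exact: h.
apply/punctured_lim0P => e e0.
have [q q0 hq] := extension_deriv (hs t tr) dZ sZ Z1 e0.
exists (Num.min q (r - `|t|)) => [|x x0]; first by rewrite lt_min q0 subr_gt0.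
rewrite lt_min => /andP[xq xr]; rewrite ger0_norm ?nrm_ge0//.
have txr : `|t + x| < r by apply: le_lt_trans (ler_normD _ _) _; lra.
pose h : R[i] := - 'i * x%:C.
have h0 : h != 0.
  by rewrite mulf_neq0// ?oppr_eq0 ?neq0Ci// eq_complex /= eqxx andbT.
have hN : complex.Re `|h| < q.
  rewrite normc_def /= !(mulr0, mul0r, oppr0, subr0, add0r, addr0) expr0n.
  by rewrite add0r mulN1r sqrrN sqrtr_sqr.
have hE : 1 - 'i * t%:C + h = 1 - 'i * (t + x)%:C.
  by rewrite /h rmorphD; ring.
have hV : ('i * (-1)%:C) * h^-1 = (x^-1)%:C.
  have xC : x%:C != 0 :> R[i] by rewrite eq_complex /= eqxx andbT.
  rewrite fmorphV /h rmorphN1 mulrN1 invfM mulrA mulfV ?mul1r//.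
  by rewrite oppr_eq0 neq0Ci.
apply: le_lt_trans (hq h h0 hN).
rewrite hE.
have -> : (x^-1)%:C *: (T (1 - 'i * (t + x)%:C) Z - T (1 - 'i * t%:C) Z) -
    (- 'i * s) *: T (1 - 'i * t%:C) Z = ('i * (-1)%:C) *: (h^-1 *:
    (T (1 - 'i * (t + x)%:C) Z - T (1 - 'i * t%:C) Z) - s *: T (1 - 'i * t%:C) Z).
  by rewrite [RHS]scalerBr !scalerA hV rmorphN1 mulrN1.
apply: le_trans (nrm_scale_i _ _) _; last by rewrite normrN1 mul1r.
apply: (carrierB dotE SP); apply: (carrierZ dotE SP); last exact: cT.
by apply: (carrierB dotE SP); exact: cT.
Qed.

Lemma extension_growth (r : R) (s : R[i]) Z n T0 :
  (forall u : R, `|u| < r -> sector d (1 - 'i * u%:C)) -> 0 < T0 -> 2 * T0 < r ->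
  dom AA Z -> AA Z = s *: Z -> nrm Z <= 1 ->
  expR (2 * complex.Im s * T0) * (expR (2 * complex.Re s) * ip4 (coords n Z) (coords n Z)) <=
  ip4 (coords n (T (1 - 'i * T0%:C) Z)) (coords n (T (1 - 'i * T0%:C) Z)).
Proof.
move=> hs T00 Tr dZ sZ Z1; have [cZ _] := dom_carrier dotE SP theta1 dZ.
have cT u : `|u| < r -> carrier (T (1 - 'i * u%:C) Z).
  by move=> ur; have [h _ _] := T_bl (hs u ur); exact: h.
pose z t := T (1 - 'i * t%:C) Z.
have z0E : z 0 = S 1 Z by rewrite /z mulr0 subr0; exact: (T_S ler01 cZ).
have r0 : `|0 : R| < r by rewrite normr0; lra.
have := @eigen_growth z (- 'i * s) n T0 T00.
have -> : complex.Re (- 'i * s) = complex.Im s.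
  by case: (s) => s1 s2 /=; ring.
rewrite z0E => h; apply: le_trans (h _ _ _).
- by rewrite ler_pM2l ?expR_gt0//; exact: sg_eigen_ge.
- by move=> t t0 tT; apply: cT; rewrite ger0_norm//; lra.
- move=> t t0 tT; apply: (extension_path hs) => //.
  by rewrite gtr0_norm//; lra.
- rewrite -z0E; apply: cvg_at_right_filter.
  have cz0 : carrier ((- 'i * s) *: z 0) by apply: (carrierZ dotE SP); exact: cT.
  have r1 : 0 < r by rewrite normr0 in r0.
  have [|dz _] := @coords_deriv _ _ _ dotE _ _ _ _ SP a b a0 b0 ip4 n z ((- 'i * s) *: z 0)
    0 r iD iZ iC ip4_0 i2 r1 cz0 _ (extension_path hs r0 dZ sZ Z1).
    by move=> u; rewrite subr0; exact: cT.
  by apply/differentiable_continuous; rewrite -derivable1_diffP.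
Qed.

(** The bounded operator T(1 - i T0) multiplies the squared norm of an eigenvector by at least exp(2
    T0 Im s + 2 Re s). As |Re s| grows at most like the power q < 1 of Im s, this factor exceeds
    exp(T0 Im s) eventually and is unbounded. *)
Lemma extension_absurd : 2^-1 < theta -> False.
Proof.
move=> th; have [r r0 hs] := sector_line d0.
(* A quarter of the admissible height leaves room for 2 T0 < r, which [extension_growth]
   requires. *)
pose T0 := r / 4; have T00 : 0 < T0 by rewrite divr_gt0.
have Tr : `|T0| < r by rewrite gtr0_norm// /T0; lra.
have [_ _ [M hM]] := T_bl (hs _ Tr).
have [C C0 hC] := eigen_large th.
pose q := 2 * (1 - theta); have q1 : 0 < 1 - q by rewrite /q; lra.
pose K := 2 * C / T0; have K0 : 0 <= K by apply: divr_ge0; [exact: mulr_ge0|exact: ltW].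
(* Above K^(1/(1 - q)) the bound on |Re s| is at most T0 Im s / 2; above M^2 / T0 the number T0 Im s
   exceeds M^2, against exp(T0 Im s) <= M^2. *)
have [s [Z [n [[dZ sZ] [Z0 nZ] sM sC]]]] := hC (M ^+ 2 / T0 + K `^ (1 - q)^-1).
have [cZ _] := dom_carrier dotE SP theta1 dZ.
have Zgt := nrm_gt0 cZ Z0.
set w := complex.Im s in sM sC.
have K1 := powR_ge0 K (1 - q)^-1.
have M0 : 0 <= M ^+ 2 / T0 by rewrite divr_ge0 ?sqr_ge0// ltW.
have w0 : 0 < w by lra.
have [dX sX] := eigenZ ((nrm Z)^-1)%:C dZ sZ.
set X := _ *: Z in dX sX.
have X1 : nrm X = 1.
  by rewrite (nrmZ)// gtr0_norm ?invr_gt0// mulVf// gt_eqF.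
have cX : carrier X by exact: (carrierZ dotE SP).
have X2 : 1 <= ip4 (coords n X) (coords n X).
  rewrite (coordsZ SP) iZ iC iZ mulrA -expr2 exprVn ler_pdivlMl ?exprn_gt0//.
  by rewrite mulr1.
have X3 : nrm X <= 1 by rewrite X1.
have T2 : 2 * T0 < r by rewrite /T0; lra.
have g := extension_growth n hs T00 T2 dX sX X3.
have g2 := coords_le dotE SP a0 b0 n (_ : carrier (T (1 - 'i * T0%:C) X)).
have cTX : carrier (T (1 - 'i * T0%:C) X) by have [h _ _] := T_bl (hs _ Tr); exact: h.
have g3 := hM X cX; rewrite X1 mulr1 in g3.
have g4 : nrm (T (1 - 'i * T0%:C) X) ^+ 2 <= M ^+ 2.
  by rewrite lerXn2r ?nnegrE ?nrm_ge0//; apply: le_trans g3; exact: nrm_ge0.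
have g5 : expR (2 * w * T0) * expR (2 * complex.Re s) <= M ^+ 2.
  apply: le_trans (le_trans g (le_trans (g2 cTX) g4)).
  rewrite ler_pM2l ?expR_gt0// -[leLHS]mulr1; apply: ler_wpM2l => //; exact: expR_ge0.
have g6 : C * w `^ q <= w * T0 / 2.
  have wE : w = w `^ (1 - q) * w `^ q.
    by rewrite -powRD ?(gt_eqF w0) ?implybT// subrK powRr1 ?ltW.
  have kw : K <= w `^ (1 - q).
    rewrite -[leLHS](_ : (K `^ (1 - q)^-1) `^ (1 - q) = _).
      by apply: ge0_ler_powR; rewrite ?nnegrE ?powR_ge0 ?(ltW q1) ?(ltW w0)//; lra.
    by rewrite -powRrM mulVf ?powRr1// gt_eqF.
  have := ler_wpM2r (powR_ge0 w q) kw; rewrite -wE /K mulrAC ler_pdivrMr//; lra.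
have g7 : - complex.Re s <= C * w `^ q.
  by apply: le_trans sC; rewrite -normrN; exact: ler_norm.
have g8 : expR (w * T0) <= M ^+ 2.
  by apply: le_trans g5; rewrite -expRD ler_expR; lra.
have g9 := expR_ge1Dx (w * T0).
have : M ^+ 2 <= w * T0 by rewrite -ler_pdivrMr//; lra.
by lra.
Qed.
End Extension.

Lemma not_analytic (S : R -> quad -> quad) : C0_semigroup (X := HH) S ->
  contractive (X := HH) S -> generator (X := HH) S AA -> 2^-1 < theta ->
  ~ analytic_semigroup (X := HH) S.
Proof.
move=> C0 Sc Sg th [d [/andP[d0 _] [T [bl TS TD _ hol]]]].
exact: (extension_absurd C0 Sc Sg d0 bl TS TD hol th).
Qed.
End Eigenvectors.

(** * Conclusions for the resolvent and differentiability *)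

Section Decay.
Variables (R : realType) (H : completeNormedModType R[i]).
Variable dot : {dot H for Num.conj}.
Hypothesis dotE : forall x : H, `|x| ^+ 2 = dot x x.
Local Notation quad := (H * H * H * H)%type.
Variables (A : operator H) (P : nat -> H -> H) (mu : nat -> R) (m0 : R).
Hypothesis SP : spectrum dot A P mu m0.
Variables (a b gamma theta : R).
Hypotheses (a0 : 0 < a) (b0 : 0 < b) (ab : a != b).
Hypotheses (gamma0 : 0 < gamma) (theta0 : 0 < theta) (theta1 : theta <= 1).
Local Notation HH := (energy_space dot A a b).
Local Notation AA := (system_operator dot A a b gamma theta).

Lemma imaginary_axis l : resolvent_set (X := HH) AA ('i * l%:C).
Proof.
have [k k0 en] := energy_exists dotE a0 b0 ab.
(* The exponent 0 is admissible for theta = 1 as well and bounds the rates below by a positive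
   constant. *)
have [|||c c0 hc] := @rate_ge _ _ _ _ _ _ _ SP gamma theta gamma0 k 0 k0.
- by rewrite invr_ge0.
- exact: ltW.
- by rewrite subr_ge0.
apply: (resolvent_all dotE SP a0 b0 ab gamma0 theta1 l c0 k0 en) => n.
by have := hc n; rewrite powRr0 mulr1.
Qed.

Hypothesis theta_lt1 : theta < 1.
Let delta := Num.min 2^-1 (Num.min theta (1 - theta)).
Let delta_gt0 : 0 < delta.
Proof. by rewrite !lt_min invr_gt0 ltr0n theta0 subr_gt0. Qed.
Let delta_half : delta <= 2^-1.
Proof. by rewrite /delta ge_min lexx. Qed.
Let delta_theta : delta <= theta.
Proof. by rewrite /delta !ge_min lexx orbT. Qed.
Let delta_theta1 : delta <= 1 - theta.
Proof. by rewrite /delta !ge_min lexx !orbT. Qed.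

Lemma log_decay : exists C lambda0 : R, [/\ 0 < C, 0 < lambda0 &
  forall l : R, lambda0 <= `|l| ->
    ((ln `|l|)%:E * resolvent_norm (X := HH) AA l <= C%:E)%E].
Proof.
have [k k0 en] := energy_exists dotE a0 b0 ab.
have [C C0 hC] := resolvent_decay dotE SP a0 b0 ab gamma0 theta1 k0 en
  delta_gt0 delta_half delta_theta delta_theta1.
(* From |l| = 1 on the logarithm is nonnegative and at most |l|^delta / delta, which the resolvent
   decay cancels. *)
exists (C / delta), 1; split; [by rewrite divr_gt0|by []|] => l l1.
have l0 : 0 < `|l| by apply: lt_le_trans l1.
have p0 : 0 < `|l| `^ delta by rewrite powR_gt0.
apply: le_trans (lee_wpmul2l _ (hC l l1)) _; first by rewrite lee_fin ln_ge0.
rewrite -EFinM lee_fin mulrCA ler_pM2l// ler_pdivrMr// mulrC.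
exact: ln_le_powR.
Qed.

Lemma differentiable_ge0 (S : R -> quad -> quad) (t0 : \bar R) :
  C0_semigroup (X := HH) S -> contractive (X := HH) S -> generator (X := HH) S AA ->
  (0 <= t0)%E -> differentiable_for (X := HH) S t0.
Proof.
move=> C0 Sc Sg t00; have [k k0 en] := energy_exists dotE a0 b0 ab.
have [c c0 hc] := @rate_ge _ _ _ _ _ _ _ SP gamma theta gamma0 k delta k0
  delta_half delta_theta delta_theta1.
apply: (differentiable_all dotE SP a0 b0 theta1 C0 Sc Sg t00) => Z t cZ t1.
have [K hK] := exp_decay_bound SP gamma0 theta1 delta_gt0 c0 t1 hc.
exact: (smoothing dotE SP a0 b0 gamma0 theta1 C0 Sc Sg k0 en cZ t1 hK).
Qed.
End Decay.

(** Beyond |l| = 1 both factors are nonnegative; the operator norm is so because the unit ball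
    contains 0, whatever value the resolvent takes there. *)
Lemma limsup_log_ge0 (R : realType) (X : normed_space R) (T : operator (ambient X)) :
  carrier (0 : ambient X) -> (forall x : ambient X, 0 <= nrm x) -> nrm (0 : ambient X) = 0 ->
  (0 <= limf_esup (fun l : R => (ln `|l|)%:E * resolvent_norm T l) (@abs_pinfty R))%E.
Proof.
move=> c0 n0 z0; rewrite limf_esupE; apply: le_ereal_inf_tmp => _ [B [M BM] <-].
pose l := `|M| + 1; have l1 : 1 <= l by rewrite lerDr.
apply: ereal_sup_ge; exists ((ln `|l|)%:E * resolvent_norm T l)%E.
  exists l => //; apply: BM; rewrite ger0_norm ?(le_trans ler01)//.
  by have := ler_norm M; rewrite /l; lra.
rewrite mule_ge0//; first by rewrite lee_fin ln_ge0// ger0_norm ?(le_trans ler01).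
apply: ereal_sup_ge; exists (nrm (resolvent T ('i * l%:C) 0))%:E; last by rewrite lee_fin.
by exists 0 => //; split => //; rewrite z0.
Qed.

Theorem theorem1p1 (R : realType) (H : completeNormedModType R[i])
    (dot : {dot H for Num.conj}) (Hdot : forall x : H, `|x| ^+ 2 = dot x x)
    (A : operator H) (HAsa : self_adjoint dot A)
    (HApos : positive_operator dot A) (HAunb : unbounded A)
    (HVHdense : dense_embedding (X := Vspace dot A) (Y := Hspace H) id)
    (HVHcpt : compact_embedding (X := Vspace dot A) (Y := Hspace H) id)
    (HHV'dense :
      dense_embedding (X := Hspace H) (Y := V'space dot A) (toV' dot))
    (HHV'cpt :
      compact_embedding (X := Hspace H) (Y := V'space dot A) (toV' dot))
    (Hcoer : exists2 a0 : R, 0 < a0 &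
      forall u, dom (oppow dot A 2^-1) u ->
        hnorm u <= a0 * hnorm (oppow dot A 2^-1 u))
    (a b gamma : R) (Ha : 0 < a) (Hb : 0 < b) (Hgamma : 0 < gamma)
    (Hab : a != b) :
  let HH := energy_space dot A a b in
  let AA := system_operator dot A a b gamma in
  (forall (theta : R) (S : R -> ambient HH -> ambient HH),
     1 / 2 < theta <= 1 ->
     C0_semigroup S -> contractive S -> generator S (AA theta) ->
     [/\ ~ analytic_semigroup S,
         forall l : R, resolvent_set (AA theta) ('i * l%:C)
       & forall r : R, 2 * (1 - theta) < r <= 1 ->
           limf_esup (fun l : R =>
             (`|l| `^ r)%:E * resolvent_norm (AA theta) l)%E
             (@abs_pinfty R) = +oo%E]) /\
  (forall (theta : R) (S : R -> ambient HH -> ambient HH),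
     0 < theta < 1 ->
     C0_semigroup S -> contractive S -> generator S (AA theta) ->
     let K0 := limf_esup (fun l : R =>
       (ln `|l|)%:E * resolvent_norm (AA theta) l)%E (@abs_pinfty R) in
     [/\ exists2 t0 : R, 0 <= t0 & differentiable_for S t0%:E,
         forall l : R, resolvent_set (AA theta) ('i * l%:C),
         exists C lambda0 : R, [/\ 0 < C, 0 < lambda0 &
           forall l : R, lambda0 <= `|l| ->
             ((ln `|l|)%:E * resolvent_norm (AA theta) l <= C%:E)%E]
       & differentiable_for S (3%:E * K0)%E]).
Proof.
have [P [mu [m0 SP]]] := spectrum_exists Hdot HApos HAunb HVHdense HVHcpt Hcoer.
move=> HH AA; split=> theta S /andP[th0 th1] C0 Sc Sg.
  have th : 2^-1 < theta by rewrite -div1r.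
  have tp : 0 < theta by apply: lt_trans th; rewrite invr_gt0.
  have rs l := @imaginary_axis _ _ _ Hdot _ _ _ _ SP _ _ _ _ Ha Hb Hab Hgamma tp th1 l.
  split => //; first exact: (not_analytic Hdot SP Ha Hb Hab Hgamma th1 C0 Sc Sg th).
  by move=> r /andP[hr _]; exact: (limsup_resolvent Hdot SP Ha Hb Hab Hgamma th1 th hr rs).
have th1' := ltW th1; move=> K0.
have df t0 := @differentiable_ge0 _ _ _ Hdot _ _ _ _ SP _ _ _ _ Ha Hb Hab Hgamma
  th0 th1' th1 S t0 C0 Sc Sg.
split.
- by exists 0 => //; apply: df.
- by move=> l; exact: (imaginary_axis Hdot SP).
- exact: (log_decay Hdot SP).
(* Differentiability holds beyond any nonnegative threshold, and 3 K_0 is one. *)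
- apply: df; apply: mule_ge0 => //; apply: limsup_log_ge0.
  + exact: (carrier0 Hdot SP a b).
  + exact: nrm_ge0.
  + have := nrmZ Hdot SP Ha Hb 0 (carrier0 Hdot SP a b).
    by rewrite normr0 mul0r scaler0.
Qed.
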